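(* Consider the latent space network model and the Range-Adaptive Singular Value Thresholding estimator $\mathring Y=[\mathring Z,\mathring\alpha]$ described in the context; in particular assume (T1)--(T3), (E1)--(E2), (L1)--(L2) and (P1)--(P2). Then for any constant $\varepsilon>0$ there exist constants $C>0$ and $N_\varepsilon\in\mathbb{N}$ such that when $n\geqslant N_\varepsilon$, $$\mathrm{dist}^2(\mathring Y,Y^\star)\leqslant\frac{C\gamma_n}{n}\qquad\text{and}\qquad\|\mathring Y\|_{2\to\infty}\leqslant C$$ with probability $1-O(n^{-\varepsilon})$.
   Context: Model. $k\geqslant 1$ is a fixed integer. For each $n$ we observe a symmetric matrix $A=(A_{ij})\in\mathbb{R}^{n\times n}$ with $A_{ii}=0$ and, independently for $1\leqslant i<j\leqslant n$, $A_{ij}=A_{ji}\sim p(\cdot\mid\Theta^\star_{ij})$ with $\Theta^\star_{ij}=\alpha^\star_i+\alpha^\star_j+\langle z^\star_i,z^\star_j\rangle$, where $p(\cdot\mid\theta)$ is a probability density/mass function with a one-dimensional parameter $\theta\in\mathbb{R}$. The true parameters $Z^\star=[z_1^\star,\dots,z_n^\star]^\top\in\mathbb{R}^{n\times k}$ and $\alpha^\star\in\mathbb{R}^n$ are nonrandom (they may depend on $n$); $Y^\star=[Z^\star,\alpha^\star]$. All quantities called constants do not depend on $n$. Write $\ell(\theta;x)=\log p(x\mid\theta)$, with derivatives $\ell',\ell'',\ell'''$ in $\theta$, and $\mathcal{X}=\{x\in\mathbb{R}:p(x\mid\theta)>0\}$ for the support. The link function $\mu(\theta)$ is the mean of the distribution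 $p(\cdot\mid\theta)$, so $\mathbb{E}(A_{ij})=\mu(\Theta^\star_{ij})$ for $i\neq j$. Norms. $\|X\|_{2\to\infty}=\sup_{\|v\|_2=1}\|Xv\|_\infty$ (largest row $\ell_2$ norm), $\|\cdot\|_{\mathrm F}$ Frobenius norm, $\mathcal{O}(k)$ the $k\times k$ orthogonal matrices, $1_n$ the all-ones vector, $\sigma_{\min}$ the smallest singular value. $g_n\ll h_n$ means $g_n/h_n\to0$. Error. For $Y=[Z,\alpha]$ and $\hat Y=[\hat Z,\hat\alpha]$: $\mathrm{dist}^2(\hat Y,Y)=\min_{Q\in\mathcal{O}(k)}\|\hat Z-ZQ\|_{\mathrm F}^2+\|\hat\alpha-\alpha\|_2^2$. Range-Adaptive Singular Value Thresholding. Inputs: $A$ and hyperparameters $\tau_n,\gamma_n$. 1. Let $A=\sum_{i=1}^n\sigma_iu_iv_i^\top$ be the singular value decomposition and $\tilde E=\sum_{\{i:\sigma_i>\tau_n\}}\sigma_iu_iv_i^\top$. 2. Let $\tilde E_{(1)}\leqslant\cdots\leqslant\tilde E_{(n^2)}$ be the ordered values of all $n^2$ entries of $\tilde E$. Let $1\leqslant l_1<l_2\leqslant n^2$ be the smallest and largest indices such that $\mu^{-1}(e)$ is well-defined (i.e. $e\in\mu(\mathbb{R})$) for $e\in[\tilde E_{(l_1)},\tilde E_{(l_2)}]$. Project $\tilde E$ entrywise onto the interval $[\tilde E_{(\gamma_n)},\tilde E_{(n^2-\gamma_n)}]\cap[\tilde E_{(l_1)},\tilde E_{(l_2)}]$ to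 obtain $\mathring E$. 3. Let $\mathring\Theta\in\mathbb{R}^{n\times n}$ have entries $\mathring\Theta_{ij}=\mu^{-1}(\mathring E_{ij})$, $1\leqslant i,j\leqslant n$. 4. Let $\mathring\alpha=(n\mathrm{I}_n+1_n1_n^\top)^{-1}\mathring\Theta1_n$. 5. Let $\mathring Z=\mathcal{S}_k(\mathring\Theta-\mathring\alpha1_n^\top-1_n\mathring\alpha^\top)\in\mathbb{R}^{n\times k}$, where $\mathcal{S}_k$ is the top-$k$ positively truncated square root: for a symmetric matrix $B$ with eigenvalues $\lambda_1\geqslant\cdots\geqslant\lambda_n$ and corresponding orthonormal eigenvectors $q_1,\dots,q_n$, $\mathcal{S}_k(B)=[\sqrt{\max(\lambda_1,0)}\,q_1,\dots,\sqrt{\max(\lambda_k,0)}\,q_k]$. Output: $\mathring Y=[\mathring Z,\mathring\alpha]$. Conditions on true parameters: (T1) $1_n^\top Z^\star=0$ and $Z^{\star\top}Z^\star$ is diagonal. (T2) There is a constant $M_1>0$ with $\|Z^\star\|_{2\to\infty}\leqslant M_1$ and $\|\alpha^\star\|_\infty\leqslant M_1$. (T3) There is a constant $M_2>0$ with $\sigma_{\min}[Z^{\star\top}Z^\star/n]\geqslant M_2$. Conditions on edgewise distributions: (E1) For any fixed $x\in\mathcal{X}$, $\ell(\theta;x)$ is three times differentiable in $\theta$; and for any constant $b>0$ there are constants $\kappa_1(b),\kappa_2(b),\kappa_3(b)>0$ such that $\kappa_1(b)\leqslant-\ell''(\theta;x)\leqslant\kappa_2(b)$ and $|\ell'''(\theta;x)|\leqslant\kappa_3(b)$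 for all $\theta\in[-b,b]$ and $x\in\mathcal{X}$. (E2) There are constants $K,s>0$ such that for any $t\geqslant0$, $\Pr(|\ell'(\Theta^\star_{ij};A_{ij})|>t)\leqslant2\exp(-(t/K)^s)$. Conditions on the link function: (L1) $\mu$ is continuously differentiable, and for any constant $b>0$ there are constants $\kappa_4(b),\kappa_5(b)>0$ with $\kappa_4(b)\leqslant\mu'(\theta)\leqslant\kappa_5(b)$ for all $\theta\in[-b,b]$. (L2) For any $t\geqslant0$, $\Pr(|A_{ij}-\mu(\Theta^\star_{ij})|>t)\leqslant2\exp(-(t/K)^s)$ for fixed constants $K,s>0$ (without loss of generality the same as in (E2)). Conditions on tuning parameters: (P1) $n^{1/2}\ll\tau_n\ll n^{\frac12+\frac1{k+3}}$. (P2) $\tau_nn^{\frac32-\frac1{k+3}}\ll\gamma_n\ll n^2$. *)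

(* Defs.v *)
From mathcomp Require Import all_boot all_order all_algebra.
From mathcomp Require Import all_classical all_reals all_analysis.

Set Implicit Arguments.
Unset Strict Implicit.
Unset Printing Implicit Defensive.

Import Order.TTheory GRing.Theory Num.Theory.
Import numFieldNormedType.Exports.

Local Open Scope classical_set_scope.
Local Open Scope ring_scope.

(** * Matrices *)

Section matrices.
Context {R : realType}.

Definition l2norm n (v : 'cV[R]_n) : R := Num.sqrt (\sum_i v i 0 ^+ 2).

Definition linfnorm n (v : 'cV[R]_n) : R := \big[Num.max/0]_i `|v i 0|.

Definition frob m n (M : 'M[R]_(m, n)) : R :=
  Num.sqrt (\sum_i \sum_j M i j ^+ 2).

Definition norm2inf m n (M : 'M[R]_(m, n)) : R :=
  sup [set linfnorm (M *m v) | v in [set v : 'cV[R]_n | l2norm v = 1]].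

Definition orthogonal_mx n (Q : 'M[R]_n) : Prop := Q^T *m Q = 1%:M.

(* [s] need not be sorted; none of the uses below depends on the order. *)
Definition is_svd n (M U : 'M[R]_n) (s : 'rV[R]_n) (V : 'M[R]_n) : Prop :=
  [/\ orthogonal_mx U, orthogonal_mx V, forall i, 0 <= s 0 i
    & M = \sum_i s 0 i *: (col i U *m (col i V)^T)].

Definition sigma_min n (M : 'M[R]_n) : R :=
  inf [set x | exists U s V, is_svd M U s V /\ exists i, x = s 0 i].

Definition all_ones n : 'cV[R]_n := const_mx 1.

(* For [Yhat = [Zhat, ahat]] and [Y = [Z, a]]; the infimum over the compact
   set of orthogonal matrices is a minimum. *)
Definition dist2 n k (Yhat Y : 'M[R]_(n, k + 1)) : R :=
  inf [set frob (lsubmx Yhat - lsubmx Y *m Q) ^+ 2 | Q in @orthogonal_mx k]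
  + l2norm (rsubmx Yhat - rsubmx Y) ^+ 2.

End matrices.

(** * Asymptotics *)

(* Division is total ([x / 0 = 0]), so eventual positivity of the
   denominator has to be required explicitly. *)
Definition asymp_ll {R : realType} (g h : nat -> R) : Prop :=
  (\forall n \near \oo, 0 < h n) /\ (g n / h n @[n --> \oo] --> (0 : R)).

(** * Latent space model *)

Section model.
Context {R : realType}.

(* [p x theta] is a density with respect to Lebesgue measure, or a mass
   function, i.e. a density with respect to counting measure. *)
Definition base_measure (discrete : bool) :
    {measure set (measurableTypeR R) -> \bar R} :=
  if discrete then [the measure _ _ of @counting (measurableTypeR R) R]
  else [the measure _ _ of @lebesgue_measure R].

Variables (discrete : bool) (p : R -> R -> R).
Let nu := base_measure discrete.

(* The integrability clause makes the mean, hence the link function,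
   well defined. *)
Definition edge_family : Prop := forall theta : R,
  [/\ measurable_fun [set: measurableTypeR R] (fun x => p x theta),
      forall x, 0 <= p x theta,
      (\int[nu]_x (p x theta)%:E = 1)%E
    & nu.-integrable [set: measurableTypeR R] (fun x => (x * p x theta)%:E)].

Definition link (theta : R) : R := \int[nu]_x (x * p x theta).

Definition loglik (x : R) : R -> R := fun theta => ln (p x theta).

Definition mutually_independent d (T : measurableType d)
    (P : probability T R) (I : finType) (D : {set I}) (X : I -> T -> R) : Prop :=
  forall (J : {set I}) (B : I -> set (measurableTypeR R)),
    J \subset D -> (forall i, measurable (B i)) ->
    P (\bigcap_(i in [set` J]) (X i @^-1` B i))
      = (\prod_(i in J) P (X i @^-1` B i))%E.

Definition Theta n k (Z : 'M[R]_(n, k)) (alpha : 'cV[R]_n) : 'M[R]_n :=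
  \matrix_(i, j) (alpha i 0 + alpha j 0 + \sum_l Z i l * Z j l).

Definition latent_space_model n k (Z : 'M[R]_(n, k)) (alpha : 'cV[R]_n)
    d (T : measurableType d) (P : probability T R) (A : T -> 'M[R]_n) : Prop :=
  [/\ (forall i j, measurable_fun [set: T]
         (fun w => A w i j : measurableTypeR R)),
      (forall w, (A w)^T = A w /\ forall i, A w i i = 0),
      (forall (i j : 'I_n) (B : set (measurableTypeR R)),
         (i < j)%N -> measurable B ->
         P [set w | B (A w i j)]
           = (\int[nu]_(x in B) (p x (Theta Z alpha i j))%:E)%E)
    & mutually_independent P [set e : 'I_n * 'I_n | (e.1 < e.2)%N]
        (fun e w => A w e.1 e.2)].

End model.

(** * Conditions *)

Section conditions.
Context {R : realType}.

Definition cond_T1 n k (Z : 'M[R]_(n, k)) : Prop :=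
  (all_ones n)^T *m Z = 0 /\ is_diag_mx (Z^T *m Z).

Definition cond_T2 (M1 : R) n k (Z : 'M[R]_(n, k)) (alpha : 'cV[R]_n) : Prop :=
  norm2inf Z <= M1 /\ linfnorm alpha <= M1.

Definition cond_T3 (M2 : R) n k (Z : 'M[R]_(n, k)) : Prop :=
  M2 <= sigma_min (n%:R^-1 *: (Z^T *m Z)).

(* [derive1n m f] is the [m]-th derivative; [supp] is the common support. *)
Definition cond_E1 (p : R -> R -> R) (supp : set R) : Prop :=
  (forall x, supp x -> forall m, (m < 3)%N ->
     forall theta, derivable (derive1n m (loglik p x)) theta 1) /\
  forall b : R, 0 < b -> exists kappa1 kappa2 kappa3 : R,
    [/\ 0 < kappa1, 0 < kappa2, 0 < kappa3
      & forall theta x, theta \in `[- b, b] -> supp x ->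
        [/\ kappa1 <= - derive1n 2 (loglik p x) theta,
            - derive1n 2 (loglik p x) theta <= kappa2
          & `|derive1n 3 (loglik p x) theta| <= kappa3]].

Definition weibull_tail (K s : R) d (T : measurableType d)
    (P : probability T R) (X : T -> R) : Prop :=
  forall t : R, 0 <= t ->
    (P [set w | (t < `|X w|)%R] <= (2 * expR (- ((t / K) `^ s)))%:E)%E.

Definition cond_E2 (p : R -> R -> R) (K s : R) n k
    (Z : 'M[R]_(n, k)) (alpha : 'cV[R]_n)
    d (T : measurableType d) (P : probability T R) (A : T -> 'M[R]_n) : Prop :=
  forall i j : 'I_n, (i < j)%N ->
    weibull_tail K s P
      (fun w => derive1 (loglik p (A w i j)) (Theta Z alpha i j)).

Definition cond_L1 (mu : R -> R) : Prop :=
  [/\ forall theta, derivable mu theta 1, continuous (derive1 mu)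
    & forall b : R, 0 < b -> exists kappa4 kappa5 : R,
        [/\ 0 < kappa4, 0 < kappa5
          & forall theta, theta \in `[- b, b] ->
            kappa4 <= derive1 mu theta <= kappa5]].

Definition cond_L2 (mu : R -> R) (K s : R) n k
    (Z : 'M[R]_(n, k)) (alpha : 'cV[R]_n)
    d (T : measurableType d) (P : probability T R) (A : T -> 'M[R]_n) : Prop :=
  forall i j : 'I_n, (i < j)%N ->
    weibull_tail K s P (fun w => A w i j - mu (Theta Z alpha i j)).

Definition cond_P1 (k : nat) (tau : nat -> R) : Prop :=
  @asymp_ll R (fun n => n%:R `^ 2^-1) tau /\
  @asymp_ll R tau (fun n => n%:R `^ (2^-1 + (k + 3)%:R^-1)).

Definition cond_P2 (k : nat) (tau : nat -> R) (gamma : nat -> nat) : Prop :=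
  @asymp_ll R (fun n => tau n * n%:R `^ (3 / 2 - (k + 3)%:R^-1))
    (fun n => (gamma n)%:R) /\
  @asymp_ll R (fun n => (gamma n)%:R) (fun n => n%:R ^+ 2).

End conditions.

(** * Range-adaptive singular value thresholding *)

Section rasvt.
Context {R : realType}.

(* [l]-th smallest entry; indices start at 1, as in E_(1) <= E_(2) <= ... *)
Definition order_stat n (E : 'M[R]_n) (l : nat) : R :=
  nth 0 (sort <=%O [seq E e.1 e.2 | e : 'I_n * 'I_n]) l.-1.

Definition svd_threshold n (A : 'M[R]_n) (tau : R) (Et : 'M[R]_n) : Prop :=
  exists U s V, is_svd A U s V /\
    Et = \sum_(i | tau < s 0 i) s 0 i *: (col i U *m (col i V)^T).

Definition admissible_indices (mu : R -> R) n (E : 'M[R]_n) (l1 l2 : nat) : Prop :=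
  [/\ (1 <= l1)%N, (l1 < l2)%N, (l2 <= n ^ 2)%N
    & `[order_stat E l1, order_stat E l2] `<=` range mu].

Definition extreme_indices (mu : R -> R) n (E : 'M[R]_n) (l1 l2 : nat) : Prop :=
  admissible_indices mu E l1 l2 /\
  forall l1' l2', admissible_indices mu E l1' l2' -> (l1 <= l1')%N /\ (l2' <= l2)%N.

(* Projection onto the intersection of the two intervals, whose bounds are
   [lo] and [hi]; it is defined only when this intersection is nonempty. *)
Definition range_projection (mu : R -> R) (gamma : nat) n
    (Et Er : 'M[R]_n) : Prop :=
  exists l1 l2, extreme_indices mu Et l1 l2 /\
  let lo := Num.max (order_stat Et gamma) (order_stat Et l1) in
  let hi := Num.min (order_stat Et (n ^ 2 - gamma)) (order_stat Et l2) in
  [/\ (0 < gamma < n ^ 2)%N, lo <= hi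
    & Er = map_mx (fun e => Num.max lo (Num.min hi e)) Et].

Definition top_psd_sqrt n k (B : 'M[R]_n) (Z : 'M[R]_(n, k)) : Prop :=
  exists (q : 'M[R]_n) (lam : 'rV[R]_n) (kn : (k <= n)%N),
  [/\ orthogonal_mx q,
      (forall i j : 'I_n, (i <= j)%N -> lam 0 j <= lam 0 i),
      (forall i, B *m col i q = lam 0 i *: col i q)
    & Z = \matrix_(i, j) (Num.sqrt (Num.max (lam 0 (widen_ord kn j)) 0)
                          * q i (widen_ord kn j))].

(* [rasvt mu A tau gamma Y]: [Y = [Z, alpha]] is a possible output.  This is a
   relation because singular vectors and eigenvectors are not unique, and
   because the second step may be undefined for exceptional inputs. *)
Definition rasvt (mu : R -> R) n k (A : 'M[R]_n) (tau : R) (gamma : nat)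
    (Y : 'M[R]_(n, k + 1)) : Prop :=
  exists (Et Er Th : 'M[R]_n) (alpha : 'cV[R]_n) (Z : 'M[R]_(n, k)),
  [/\ [/\ svd_threshold A tau Et,
          range_projection mu gamma Et Er
        & forall i j, mu (Th i j) = Er i j],
      alpha = invmx (n%:R%:M + all_ones n *m (all_ones n)^T)
                *m (Th *m all_ones n),
      top_psd_sqrt (Th - alpha *m (all_ones n)^T - all_ones n *m alpha^T) Z
    & Y = row_mx Z alpha].

End rasvt.

(* Main.v *)
(* Let M = mu(Theta) be the matrix of means (diagonal included) and tau, gamma the
   tuning parameters.

   Noise: on an event of probability 1 - O(n^-eps), ||A - M|| <= C sqrt n.  Choose
   an integer B with (2B)^20 <= n <= (4B)^20.  Truncating the noise at B fails with
   probability exponentially small in a power of n, and rounding to the grid (1/n)Z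
   makes the sample space a finite product.  There, bound the bilinear form on the
   lattice of mesh 1/(4 sqrt n) in the unit ball: vectors with few large
   coordinates are treated by the exponential moment of ||A v||^2, the others by
   Bernstein's inequality, against a count of the lattice points involved.

   Thresholding: the rows of M are Lipschitz functions of the (z_i, alpha_i), so
   replacing rows by representatives over cells of side n^(-1/(k+3)) bounds the
   nuclear norm of M by C n^(3/2 - 1/(k+3)).  By duality with the operator norm the
   thresholded matrix is at squared Frobenius distance at most 3 tau times that
   bound, which is o(gamma), from M.  Hence fewer than gamma of its entries are far
   from the interval spanned by the entries of M, so the projection is well defined
   onto a bounded interval, and the projected matrix is at squared Frobenius
   distance O(gamma) from M; applying mu^-1, so is the estimate of Theta.

   Spectral step: a perturbation of size O(gamma) = o(n^2) of Theta moves the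
   estimates of alpha and Z by O(gamma / n), since Z^T Z has smallest eigenvalue of
   order n. *)
Require Import Defs.
From mathcomp Require Import all_boot all_order all_algebra.
From mathcomp Require Import all_classical all_reals all_analysis.
From mathcomp Require Import measurable_realfun ring lra zify.
From mathcomp Require all_fingroup complex.

Set Implicit Arguments.
Unset Strict Implicit.
Unset Printing Implicit Defensive.

Import Order.TTheory GRing.Theory Num.Theory.
Import numFieldNormedType.Exports.

Local Open Scope classical_set_scope.
Local Open Scope ring_scope.

(** * Frobenius and operator norms *)

(** The entries have only Weibull tails, so after truncation Bernstein's inequality pays for the
    largest product of coordinates of the two test vectors. A union over all [exp (18 n)] pairs of
    lattice points is affordable only when that product is small; vectors with large coordinates are
    sparse, hence few. With entries bounded by [T] and [sqrt n] of order [T^10], cutting coordinates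
    at [T^-4] and [T^-8] makes the entropy of each class at most of the order of the exponent that
    its exponential moment allows; the exponent 20 comes from there.

    The power [1/(k+3)] equates two costs: rounding rows to mesh [1/x] costs [n sqrt n / x], while
    [x^(k+1)] cells cost [n sqrt (x^(k+1))].

    The spectral step must not lose a factor [n] although [n - k] eigenvalues are discarded. Each of
    them is bounded by the perturbation applied to its own eigenvector, so their squares add up to a
    Frobenius norm.

    The final event is defined through the finitely valued rounded matrix, hence measurable; on it
    the bound holds for every admissible choice of singular vectors and eigenvectors, and symmetry
    of [A] provides one such choice. *)

Section frobenius.
Context {R : realType}.

Lemma norm_le_sqr (x c : R) : 0 <= c -> x ^+ 2 <= c ^+ 2 -> `|x| <= c.
Proof. by move=> c0; rewrite -[x ^+ 2]real_normK ?num_real // ler_sqr ?nnegrE. Qed.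

(* Frobenius inner product and squared Frobenius norm; [opb c X] below says that
   the operator norm of [X] is at most [c]. *)
Definition ip m n (A B : 'M[R]_(m, n)) : R := \tr (A^T *m B).
Definition nsq m n (A : 'M[R]_(m, n)) : R := ip A A.

Lemma ipE m n (A B : 'M[R]_(m, n)) : ip A B = \sum_i \sum_j A i j * B i j.
Proof.
rewrite /ip /mxtrace exchange_big; apply: eq_bigr => j _.
by rewrite mxE; apply: eq_bigr => i _; rewrite mxE.
Qed.

Lemma nsqE m n (A : 'M[R]_(m, n)) : nsq A = \sum_i \sum_j A i j ^+ 2.
Proof. by rewrite /nsq ipE; under eq_bigr do under eq_bigr do rewrite -expr2. Qed.

Lemma nsq_cV n (v : 'cV[R]_n) : nsq v = \sum_i v i 0 ^+ 2.
Proof. by rewrite nsqE; apply: eq_bigr => i _; rewrite big_ord1. Qed.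

Lemma nsq_ge0 m n (A : 'M[R]_(m, n)) : 0 <= nsq A.
Proof. by rewrite nsqE; do 2!(apply: sumr_ge0 => ? _); rewrite sqr_ge0. Qed.

Lemma entry_nsq m n (A : 'M[R]_(m, n)) i j : A i j ^+ 2 <= nsq A.
Proof.
rewrite nsqE (bigD1 i) //= (bigD1 j) //= -addrA lerDl addr_ge0 //.
  by apply: sumr_ge0 => ? _; rewrite sqr_ge0.
by do 2!(apply: sumr_ge0 => ? _); rewrite sqr_ge0.
Qed.

Lemma nsq_eq0 m n (A : 'M[R]_(m, n)) : nsq A <= 0 -> A = 0.
Proof.
move=> h; apply/matrixP => i j; rewrite mxE; apply/eqP.
by rewrite -sqrf_eq0 eq_le sqr_ge0 (le_trans (entry_nsq _ _ _) h).
Qed.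

Lemma ipC m n (A B : 'M[R]_(m, n)) : ip A B = ip B A.
Proof. by rewrite !ipE; under eq_bigr do under eq_bigr do rewrite mulrC. Qed.

Lemma ipDr m n (A B C : 'M[R]_(m, n)) : ip A (B + C) = ip A B + ip A C.
Proof. by rewrite /ip mulmxDr linearD. Qed.

Lemma ipDl m n (A B C : 'M[R]_(m, n)) : ip (A + B) C = ip A C + ip B C.
Proof. by rewrite ipC ipDr !(ipC C). Qed.

Lemma ipZr m n a (A B : 'M[R]_(m, n)) : ip A (a *: B) = a * ip A B.
Proof. by rewrite /ip -scalemxAr linearZ. Qed.

Lemma ipZl m n a (A B : 'M[R]_(m, n)) : ip (a *: A) B = a * ip A B.
Proof. by rewrite ipC ipZr ipC. Qed.

Lemma ipNr m n (A B : 'M[R]_(m, n)) : ip A (- B) = - ip A B.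
Proof. by rewrite -scaleN1r ipZr mulN1r. Qed.

Lemma ipNl m n (A B : 'M[R]_(m, n)) : ip (- A) B = - ip A B.
Proof. by rewrite ipC ipNr ipC. Qed.

Lemma ip0r m n (A : 'M[R]_(m, n)) : ip A 0 = 0.
Proof. by rewrite /ip mulmx0 linear0. Qed.

Lemma ip_mull m n p (X : 'M[R]_(m, n)) (A : 'M[R]_(n, p)) (B : 'M[R]_(m, p)) :
  ip (X *m A) B = ip A (X^T *m B).
Proof. by rewrite /ip trmx_mul mulmxA. Qed.

Lemma ip_mulr m n p (X : 'M[R]_(n, p)) (A : 'M[R]_(m, n)) (B : 'M[R]_(m, p)) :
  ip (A *m X) B = ip A (B *m X^T).
Proof. by rewrite /ip trmx_mul -mulmxA mxtrace_mulC mulmxA. Qed.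

Lemma ip_trmx m n (A B : 'M[R]_(m, n)) : ip A^T B^T = ip A B.
Proof. by rewrite /ip trmxK -mxtrace_tr trmx_mul trmxK mxtrace_mulC. Qed.

Lemma nsq_trmx m n (A : 'M[R]_(m, n)) : nsq A^T = nsq A.
Proof. exact: ip_trmx. Qed.

Lemma nsqDE m n (A B : 'M[R]_(m, n)) :
  nsq (A + B) = nsq A + 2 * ip A B + nsq B.
Proof. by rewrite /nsq ipDl !ipDr (ipC B A); ring. Qed.

Lemma nsqZ m n a (A : 'M[R]_(m, n)) : nsq (a *: A) = a ^+ 2 * nsq A.
Proof. by rewrite /nsq ipZl ipZr; ring. Qed.

Lemma nsqN m n (A : 'M[R]_(m, n)) : nsq (- A) = nsq A.
Proof. by rewrite /nsq ipNl ipNr opprK. Qed.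

Lemma nsq0 m n : nsq (0 : 'M[R]_(m, n)) = 0.
Proof. by rewrite /nsq ip0r. Qed.

(** Nonnegativity of [nsq (nsq B *: A - ip A B *: B)] is this inequality multiplied by [nsq B]. *)
Lemma ip_sqr_le m n (A B : 'M[R]_(m, n)) : ip A B ^+ 2 <= nsq A * nsq B.
Proof.
have [B0|B0] := leP (nsq B) 0.
  by rewrite (nsq_eq0 B0) ip0r expr0n /= nsq0 mulr0.
have := nsq_ge0 (nsq B *: A + (- ip A B) *: B).
rewrite nsqDE !nsqZ ipZl ipZr => h.
have {}h : 0 <= nsq B * (nsq A * nsq B - ip A B ^+ 2) by apply: le_trans h _; lra.
by rewrite pmulr_rge0 // subr_ge0 in h.
Qed.

Lemma ip_le_mul m n (A B : 'M[R]_(m, n)) (a b : R) : 0 <= a -> 0 <= b ->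
  nsq A <= a ^+ 2 -> nsq B <= b ^+ 2 -> ip A B <= a * b.
Proof.
move=> a0 b0 hA hB; apply: le_trans (ler_norm _) _.
rewrite -ler_sqr ?nnegrE ?mulr_ge0 // real_normK ?num_real //.
by rewrite (le_trans (ip_sqr_le _ _)) // exprMn ler_pM ?nsq_ge0.
Qed.

Lemma nsqD_le m n (A B : 'M[R]_(m, n)) : nsq (A + B) <= 2 * nsq A + 2 * nsq B.
Proof.
have := nsq_ge0 (A - B); rewrite nsqDE ipNr nsqN nsqDE; lra.
Qed.

Lemma nsqD_mul m n (A B : 'M[R]_(m, n)) (a b : R) : 0 <= a -> 0 <= b ->
  nsq A <= a ^+ 2 -> nsq B <= b ^+ 2 -> nsq (A + B) <= (a + b) ^+ 2.
Proof.
move=> a0 b0 hA hB; by move: (ip_le_mul a0 b0 hA hB); rewrite nsqDE sqrrD; lra.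
Qed.

Lemma frob_sqr m n (A : 'M[R]_(m, n)) : frob A ^+ 2 = nsq A.
Proof. by rewrite /frob sqr_sqrtr -nsqE // nsq_ge0. Qed.

Lemma l2norm_sqr n (v : 'cV[R]_n) : l2norm v ^+ 2 = nsq v.
Proof. by rewrite /l2norm sqr_sqrtr -nsq_cV // nsq_ge0. Qed.

Lemma nsq_col m n (A : 'M[R]_(m, n)) : nsq A = \sum_j nsq (col j A).
Proof.
rewrite nsqE exchange_big; apply: eq_bigr => j _; rewrite nsq_cV.
by apply: eq_bigr => i _; rewrite mxE.
Qed.

Definition opb m n (c : R) (X : 'M[R]_(m, n)) : Prop :=
  forall v : 'cV[R]_n, nsq (X *m v) <= c ^+ 2 * nsq v.

Lemma opb_mul m n p c (X : 'M[R]_(m, n)) (A : 'M[R]_(n, p)) : opb c X ->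
  nsq (X *m A) <= c ^+ 2 * nsq A.
Proof.
move=> h; rewrite nsq_col (nsq_col A) mulr_sumr; apply: ler_sum => j _.
by rewrite colE -mulmxA -colE.
Qed.

(** For [w = X^T v], [nsq w] is the inner product of [v] and [X w]; Cauchy-Schwarz and the bound on
    [X w] leave one factor [nsq w] to cancel, so no singular values are needed. *)
Lemma opb_trmx m n c (X : 'M[R]_(m, n)) : opb c X -> opb c X^T.
Proof.
move=> h v; have [v0|v0] := leP (nsq (X^T *m v)) 0.
  by apply: le_trans v0 _; rewrite mulr_ge0 ?sqr_ge0 ?nsq_ge0.
set w := X^T *m v in v0 *.
have e : nsq w = ip v (X *m w) by rewrite {1}/nsq {1}/w ip_mull trmxK.
have := ip_sqr_le v (X *m w); rewrite -e => h1.
have {}h1 : nsq w * nsq w <= nsq w * (c ^+ 2 * nsq v).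
  rewrite -expr2 (le_trans h1) // (le_trans (ler_wpM2l (nsq_ge0 _) (h w))) //.
  by rewrite le_eqVlt; apply/orP; left; apply/eqP; ring.
by rewrite ler_pM2l in h1.
Qed.

Lemma opbD m n a b (X Y : 'M[R]_(m, n)) : 0 <= a -> 0 <= b ->
  opb a X -> opb b Y -> opb (a + b) (X + Y).
Proof.
move=> a0 b0 hX hY v; rewrite mulmxDl.
have e x : x ^+ 2 * nsq v = (x * Num.sqrt (nsq v)) ^+ 2.
  by rewrite exprMn sqr_sqrtr ?nsq_ge0.
rewrite e mulrDl nsqD_mul ?mulr_ge0 ?sqrtr_ge0 // -e //.
Qed.

Lemma opbN m n a (X : 'M[R]_(m, n)) : opb a X -> opb a (- X).
Proof. by move=> h v; rewrite mulNmx nsqN. Qed.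

Lemma opb_le m n a b (X : 'M[R]_(m, n)) : 0 <= a -> a <= b -> opb a X -> opb b X.
Proof.
move=> a0 ab h v; apply: le_trans (h v) _; rewrite ler_wpM2r ?nsq_ge0 //.
by rewrite ler_sqr ?nnegrE ?(le_trans a0).
Qed.

Lemma opb_nsq m n c (X : 'M[R]_(m, n)) : nsq X <= c ^+ 2 -> opb c X.
Proof.
move=> h v; apply: (@le_trans _ _ (nsq X * nsq v)); last first.
  by rewrite ler_wpM2r ?nsq_ge0.
rewrite nsq_cV nsqE mulr_suml; apply: ler_sum => i _; rewrite mxE.
have := ip_sqr_le (\col_j X i j) v; rewrite ipE nsq_cV.
under eq_bigr do rewrite big_ord1 mxE.
by under [X in _ <= X * _ -> _]eq_bigr do rewrite mxE.
Qed.

Lemma nsq_mulmx_le m n (X : 'M[R]_(m, n)) (v : 'cV[R]_n) :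
  nsq (X *m v) <= nsq X * nsq v.
Proof.
have h := @opb_nsq m n (Num.sqrt (nsq X)) X; rewrite sqr_sqrtr ?nsq_ge0 // in h.
by have := h (lexx _) v; rewrite sqr_sqrtr ?nsq_ge0.
Qed.

Lemma nsq_entry m n (e : R) (X : 'M[R]_(m, n)) : (forall i j, `|X i j| <= e) ->
  nsq X <= m%:R * n%:R * e ^+ 2.
Proof.
move=> h; rewrite nsqE (@le_trans _ _ (\sum_(i < m) \sum_(j < n) e ^+ 2)) //.
  apply: ler_sum => i _; apply: ler_sum => j _.
  rewrite -real_normK ?num_real // ler_sqr ?nnegrE //; exact: le_trans (h i j).
by rewrite !sumr_const !card_ord -mulrnA -(mulr_natl (e ^+ 2)) natrM (mulrC n%:R).
Qed.

Lemma opb_entry n (e : R) (X : 'M[R]_n) : (forall i j, `|X i j| <= e) ->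
  opb (n%:R * e) X.
Proof. by move=> h; apply: opb_nsq; rewrite exprMn expr2 nsq_entry. Qed.

Lemma nsq_orthl n p (Q : 'M[R]_n) (A : 'M[R]_(n, p)) : orthogonal_mx Q ->
  nsq (Q *m A) = nsq A.
Proof. by move=> h; rewrite /nsq ip_mull mulmxA h mul1mx. Qed.

Lemma orthogonal_mxT n (Q : 'M[R]_n) : orthogonal_mx Q -> orthogonal_mx Q^T.
Proof. by rewrite /orthogonal_mx trmxK => /mulmx1C. Qed.

Lemma orthogonal_mulmxT n (Q : 'M[R]_n) : orthogonal_mx Q -> Q *m Q^T = 1%:M.
Proof. by move/mulmx1C. Qed.

Lemma nsq_orthr n p (Q : 'M[R]_n) (A : 'M[R]_(p, n)) : orthogonal_mx Q ->
  nsq (A *m Q) = nsq A.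
Proof. by move=> h; rewrite /nsq ip_mulr -mulmxA orthogonal_mulmxT // mulmx1. Qed.

Lemma opb_orthlr n (U V X : 'M[R]_n) c : orthogonal_mx U -> orthogonal_mx V ->
  opb c X -> opb c (U *m X *m V).
Proof.
by move=> hU hV h v; rewrite -!mulmxA nsq_orthl // (le_trans (h _)) // nsq_orthl.
Qed.

Lemma opb_bilinear m n (c : R) (X : 'M[R]_(m, n)) : 0 <= c ->
  (forall (u : 'cV[R]_m) (v : 'cV[R]_n), nsq u <= 1 -> nsq v <= 1 -> ip u (X *m v) <= c) -> opb c X.
Proof.
move=> c0 h v.
have [v0|v0] := leP (nsq v) 0.
  by rewrite (nsq_eq0 v0) mulmx0 !nsq0 mulr0.
have [w0|w0] := leP (nsq (X *m v)) 0.
  by apply: le_trans w0 _; rewrite mulr_ge0 ?sqr_ge0 ?nsq_ge0.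
set w := X *m v in w0 *.
have sv : 0 < Num.sqrt (nsq v) by rewrite sqrtr_gt0.
have sw : 0 < Num.sqrt (nsq w) by rewrite sqrtr_gt0.
have := h ((Num.sqrt (nsq w))^-1 *: w) ((Num.sqrt (nsq v))^-1 *: v).
rewrite !nsqZ !exprVn !sqr_sqrtr ?nsq_ge0 // !mulVf ?gt_eqF // => /(_ (lexx _) (lexx _)).
rewrite -scalemxAr ipZl ipZr -/w -/(nsq w) mulrCA ler_pdivrMl // => h1.
have e : nsq w = Num.sqrt (nsq w) * Num.sqrt (nsq w) by rewrite -expr2 sqr_sqrtr ?nsq_ge0.
rewrite {2}e mulrA mulVf ?gt_eqF // mul1r in h1.
have -> : nsq v = Num.sqrt (nsq v) ^+ 2 by rewrite sqr_sqrtr ?nsq_ge0.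
rewrite e -expr2 -exprMn ler_sqr ?nnegrE ?mulr_ge0 ?sqrtr_ge0 //.
by rewrite mulrC.
Qed.

End frobenius.

(** * Singular value thresholding *)

Section threshold.
Context {R : realType}.

(* Duality form of: the nuclear norm of [M] is at most [N]. *)
Definition nuc_le n (N : R) (M : 'M[R]_n) : Prop :=
  forall (c : R) (X : 'M[R]_n), 0 <= c -> opb c X -> ip X M <= c * N.

Lemma nuc_le_orth n N (M U V : 'M[R]_n) : orthogonal_mx U -> orthogonal_mx V ->
  nuc_le N M -> nuc_le N (U *m M *m V).
Proof.
move=> hU hV h c X c0 hX; rewrite ipC ip_mulr ip_mull ipC mulmxA.
by apply: h => //; apply: opb_orthlr => //; apply: orthogonal_mxT.
Qed.

(** Deselected terms become zeros on the diagonal, so a matrix and its thresholding share the same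
    outer factors. *)
Lemma is_svdE n (U V : 'M[R]_n) (s : 'rV[R]_n) (P : pred 'I_n) :
  \sum_(i | P i) s 0 i *: (col i U *m (col i V)^T)
  = U *m diag_mx (\row_i (if P i then s 0 i else 0)) *m V^T.
Proof.
apply/matrixP => i j; rewrite summxE mxE big_mkcond /=; apply: eq_bigr => l _.
rewrite mul_mx_diag !mxE; case: ifP => _; last by rewrite mulr0 mul0r.
by rewrite big_ord1 !mxE; ring.
Qed.

Lemma nuc_le_ge0 n N (M : 'M[R]_n) : nuc_le N M -> 0 <= N.
Proof.
move=> /(_ 1 0 ler01); rewrite mul1r /ip trmx0 mul0mx linear0; apply => v.
by rewrite mul0mx nsq0 expr1n mul1r nsq_ge0.
Qed.

Lemma opb_row n c (X : 'M[R]_n) i : opb c X -> \sum_j X i j ^+ 2 <= c ^+ 2.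
Proof.
move=> /opb_trmx /(_ (delta_mx i 0)).
rewrite -colE nsq_cV (_ : nsq _ = 1) ?mulr1; last first.
  rewrite nsq_cV (bigD1 i) //= !mxE !eqxx big1 ?addr0 ?expr1n // => j ji.
  by rewrite mxE (negPf ji) expr0n.
by move=> h; apply: le_trans h; apply: ler_sum => j _; rewrite !mxE.
Qed.

(* In the singular bases, [Et] is diagonal and the row [i] of [Et - M] is a row
   of the noise if [tau < s_i], and a row of [- M] otherwise. *)
Lemma svd_threshold_err n (A M Et : 'M[R]_n) (tau N : R) : 0 < tau ->
  svd_threshold A tau Et -> opb (tau / 2) (A - M) -> nuc_le N M ->
  nsq (Et - M) <= 3 * N * tau.
Proof.
move=> tau0 [U [s [V [[hU hV s0 eA] ->]]]] hW hM.
have hUT := orthogonal_mxT hU; have hVT := orthogonal_mxT hV.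
pose M' := U^T *m M *m V; pose W' := U^T *m (A - M) *m V.
have N0 := nuc_le_ge0 hM.
have hM' : nuc_le N M' by apply: nuc_le_orth.
have hW' : opb (tau / 2) W' by apply: opb_orthlr.
have eM : M = U *m M' *m V^T.
  rewrite /M' !mulmxA orthogonal_mulmxT // mul1mx -mulmxA.
  by rewrite orthogonal_mulmxT // mulmx1.
rewrite (@is_svdE _ _ _ _ (fun i => tau < s 0 i)) eM -mulmxBl -mulmxBr.
rewrite nsq_orthr // nsq_orthl //.
have eD : diag_mx s = M' + W'.
  rewrite -mulmxDl -mulmxDr addrC subrK eA is_svdE.
  rewrite !mulmxA (_ : U^T *m U = 1%:M) // mul1mx -mulmxA (_ : V^T *m V = 1%:M) //.
  by rewrite mulmx1; congr diag_mx; apply/rowP => i; rewrite mxE.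
have eij i j : s 0 i *+ (i == j) = M' i j + W' i j.
  by have := congr1 (fun Y : 'M[R]_n => Y i j) eD; rewrite !mxE.
clearbody M' W'; pose S := [set i | tau < s 0 i]%SET.
(* The rows of [M'] below the threshold. There [M' = diag s - W'], so the operator norm is at most
   [tau + tau / 2], and pairing [X] with [M'] itself bounds its squared norm by a multiple of
   [N * tau]. *)
pose X := \matrix_(i, j) (if i \in S then 0 else M' i j).
have hX : opb (3 / 2 * tau) X.
  have -> : X = diag_mx (\row_i (if i \in S then 0 else s 0 i))
     + (- (diag_mx (\row_i (if i \in S then 0 else 1)) *m W')).
    apply/matrixP => i j; rewrite mul_diag_mx !mxE; case: ifP => iS.
      by rewrite mul0rn mul0r subrr.
    by rewrite eij; ring.
  have -> : 3 / 2 * tau = tau + tau / 2 by clear; field.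
  apply: opbD => //; rewrite ?divr_ge0 ?ltW //.
    move=> v; rewrite mul_diag_mx !nsq_cV mulr_sumr; apply: ler_sum => i _.
    rewrite !mxE exprMn ler_wpM2r ?sqr_ge0 //; case: ifPn => [_|].
      by rewrite expr0n /= sqr_ge0.
    by rewrite inE -leNgt => h; rewrite ler_sqr ?nnegrE // ltW.
  apply: opbN => v; rewrite -mulmxA; apply: le_trans (hW' v).
  rewrite mul_diag_mx !nsq_cV; apply: ler_sum => i _.
  by rewrite !mxE; case: ifP; rewrite ?mul0r ?mul1r // expr0n /= sqr_ge0.
have hT : opb 1 (diag_mx (\row_i (i \in S)%:R) : 'M[R]_n).
  move=> v; rewrite mul_diag_mx !nsq_cV mulr_sumr; apply: ler_sum => i _.
  rewrite !mxE expr1n mul1r; case: (i \in S); first by rewrite mul1r.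
  by rewrite mul0r expr0n /= sqr_ge0.
(* Testing the nuclear bound against the coordinate projector on [S] gives
   [sum_(i in S) M'_ii <= N], while [M'_ii >= s_i - tau / 2 > tau / 2] there: few singular values
   survive. *)
have cS : #|S|%:R * tau <= 2 * N.
  have h1 := hM' _ _ ler01 hT.
  have e1 : ip (diag_mx (\row_i (i \in S)%:R)) M' = \sum_(i in S) M' i i.
    rewrite ipE [RHS]big_mkcond; apply: eq_bigr => i _.
    rewrite (bigD1 i) //= big1 ?addr0; last first.
      by move=> j ji; rewrite !mxE eq_sym (negPf ji) mul0r.
    by rewrite !mxE eqxx mulr1n; case: (i \in S); rewrite ?mul1r ?mul0r.
  have h2 : \sum_(i in S) tau <= \sum_(i in S) (M' i i + tau / 2).
    apply: ler_sum => i; rewrite inE => hi.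
    have := eij i i; rewrite eqxx mulr1n => e.
    apply: le_trans (ltW hi) _; rewrite e lerD2l.
    have := opb_row i hW'; rewrite (bigD1 i) //= => h.
    have {}h : W' i i ^+ 2 <= (tau / 2) ^+ 2.
      apply: le_trans h; rewrite lerDl; apply: sumr_ge0 => j _.
      by rewrite sqr_ge0.
    apply: le_trans (ler_norm _) _.
    by apply: norm_le_sqr => //; rewrite divr_ge0 ?ltW.
  move: h1 h2; rewrite mul1r big_split /= -e1 !sumr_const -(mulr_natl tau) -(mulr_natl (tau / 2)).
  by move: (ip _ _) (#|S|%:R : R) => p c; clear; lra.
have h3 : \sum_(i in S) \sum_j W' i j ^+ 2 <= #|S|%:R * (tau / 2) ^+ 2.
  rewrite mulr_natl -sumr_const; apply: ler_sum => i _; exact: opb_row.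
have h4 : ip X M' <= 3 / 2 * tau * N by apply: hM' => //; clear -tau0; lra.
have e4 : nsq (diag_mx (\row_i (if tau < s 0 i then s 0 i else 0)) - M')
   = \sum_(i in S) \sum_j W' i j ^+ 2 + ip X M'.
  rewrite nsqE ipE [X in _ = X + _]big_mkcond -big_split /=; apply: eq_bigr => i _.
  case: ifPn; rewrite inE => hi.
    rewrite [X in _ = _ + X]big1 ?addr0; last by move=> j _; rewrite !mxE inE hi mul0r.
    apply: eq_bigr => j _.
    by congr (_ ^+ 2); rewrite !mxE hi eij; ring.
  by rewrite add0r; apply: eq_bigr => j _; rewrite !mxE inE (negPf hi) mul0rn; ring.
rewrite e4; apply: le_trans (lerD h3 h4) _.
have : #|S|%:R * (tau / 2) ^+ 2 <= 2 * N * (tau / 4).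
  have -> : #|S|%:R * (tau / 2) ^+ 2 = #|S|%:R * tau * (tau / 4) by field.
  by rewrite ler_wpM2r // divr_ge0 // ltW.
have := mulr_ge0 N0 (ltW tau0); move: (#|S|%:R * _) => x.
by clear; lra.
Qed.

(* Replacing every row by that of a representative of its cell costs [d] per
   entry; the resulting matrix has at most [#|F|] distinct rows. *)
Lemma nuc_le_cells n (F : finType) (f : 'I_n -> F) (M : 'M[R]_n) (b d : R) :
  0 <= d -> 0 <= b -> (forall i j, `|M i j| <= b) ->
  (forall i i' j, f i = f i' -> `|M i j - M i' j| <= d) ->
  nuc_le (n%:R * Num.sqrt n%:R * d + b * n%:R * Num.sqrt #|F|%:R) M.
Proof.
move=> d0 b0 hb hd c X c0 hX.
have [n0|n_gt0] := posnP n.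
  rewrite /ip /mxtrace big1; last first.
    by move=> i _; have := ltn_ord i; rewrite [X in (_ < X)%N -> _]n0.
  by rewrite mulr_ge0 // addr_ge0 // !mulr_ge0 ?sqrtr_ge0.
have F_gt0 : (0 < #|F|)%N by apply/card_gt0P; exists (f (Ordinal n_gt0)).
(* The choice depends on [f i] only, so all rows of a cell share one representative. *)
pose rho i := if [pick i' | f i' == f i] is Some i' then i' else i.
have fr i : f (rho i) = f i by rewrite /rho; case: pickP => // i' /eqP.
have rE i i' : f i = f i' -> rho i = rho i'.
  move=> e; rewrite /rho e; case: pickP => // /(_ i').
  by rewrite eqxx.
pose M1 := \matrix_(i, j) M (rho i) j.
have sn : 0 < Num.sqrt (n%:R : R) by rewrite sqrtr_gt0 ltr0n.
have sF : 0 < Num.sqrt (#|F|%:R : R) by rewrite sqrtr_gt0 ltr0n.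
have en : Num.sqrt (n%:R : R) ^+ 2 = n%:R by rewrite sqr_sqrtr ?ler0n.
have eF : Num.sqrt (#|F|%:R : R) ^+ 2 = #|F|%:R by rewrite sqr_sqrtr ?ler0n.
have h1 : ip X (M - M1) <= (c * Num.sqrt n%:R) * (n%:R * d).
  apply: ip_le_mul; rewrite ?mulr_ge0 ?sqrtr_ge0 //.
    have := opb_mul 1%:M hX; rewrite mulmx1 exprMn en.
    rewrite [nsq 1%:M]/nsq /ip mulmx1 mxtrace_tr mxtrace1.
    exact.
  rewrite exprMn expr2; apply: nsq_entry => i j; rewrite !mxE.
  exact: hd.
pose one g : 'cV[R]_n := \col_i (f i == g)%:R.
have hone g : nsq (one g) = \sum_i (f i == g)%:R.
  rewrite nsq_cV; apply: eq_bigr => i _; rewrite mxE.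
  by case: (f i == g); rewrite ?expr1n // expr0n.
(* The rows of [M1] in a cell [g] coincide, so the cell contributes the pairing of [X^T 1_g] with
   one row, of norm at most [b sqrt n]. *)
have h2 : ip X M1 <= \sum_g (c * Num.sqrt (nsq (one g))) * (b * Num.sqrt n%:R).
  have -> : ip X M1 = \sum_g \sum_(i | f i == g) \sum_j X i j * M (rho i) j.
    rewrite ipE (partition_big f predT) //=; apply: eq_bigr => g _.
    by apply: eq_bigr => i _; apply: eq_bigr => j _; rewrite mxE.
  apply: ler_sum => g _.
  case: (pickP (fun i => f i == g)) => [r /eqP fr0|no]; last first.
    by rewrite big_pred0 // !mulr_ge0 ?sqrtr_ge0.
  have -> : \sum_(i | f i == g) \sum_j X i j * M (rho i) j
      = ip (X^T *m one g) (row (rho r) M)^T.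
    rewrite ipE exchange_big /=; apply: eq_bigr => j _.
    rewrite big_ord1 !mxE mulr_suml big_mkcond /=; apply: eq_bigr => i _.
    rewrite !mxE; case: eqP => [fi|_]; last by rewrite mulr0 mul0r.
    by rewrite mulr1 (rE i r) // fr0.
  apply: ip_le_mul; rewrite ?mulr_ge0 ?sqrtr_ge0 //.
    by rewrite exprMn sqr_sqrtr ?nsq_ge0 //; apply: opb_trmx.
  rewrite nsq_trmx exprMn en mulrC -[n%:R]mul1r.
  by apply: nsq_entry => i j; rewrite mxE.
(* Cauchy-Schwarz over the cells, obtained by summing [(sqrt #|F| sqrt (nsq (one g)) - sqrt n)^2 >=
   0]; the cell sizes add up to [n]. *)
have h3 : \sum_g Num.sqrt (nsq (one g)) <= Num.sqrt #|F|%:R * Num.sqrt n%:R.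
  have sum1 : \sum_g nsq (one g) = n%:R.
    rewrite (eq_bigr (fun g => \sum_i (f i == g)%:R)) // exchange_big /=.
    rewrite (eq_bigr (fun=> 1)) ?sumr_const ?card_ord // => i _.
    by rewrite (bigD1 (f i)) //= eqxx big1 ?addr0 // => g /negPf; rewrite eq_sym => ->.
  have h g : 2 * (Num.sqrt #|F|%:R * Num.sqrt n%:R) * Num.sqrt (nsq (one g))
      <= #|F|%:R * nsq (one g) + n%:R.
    have := sqr_ge0 (Num.sqrt #|F|%:R * Num.sqrt (nsq (one g)) - Num.sqrt n%:R).
    have -> : #|F|%:R * nsq (one g) + n%:R = Num.sqrt #|F|%:R ^+ 2
        * Num.sqrt (nsq (one g)) ^+ 2 + Num.sqrt n%:R ^+ 2.
      by rewrite eF en sqr_sqrtr ?nsq_ge0.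
    by move: (Num.sqrt _) (Num.sqrt _) (Num.sqrt _) => x y z; clear; lra.
  have {h} : \sum_g 2 * (Num.sqrt #|F|%:R * Num.sqrt n%:R) * Num.sqrt (nsq (one g))
      <= \sum_g (#|F|%:R * nsq (one g) + n%:R) by apply: ler_sum => g _.
  rewrite big_split /= -!mulr_sumr sum1 sumr_const -(mulr_natl n%:R) -{2 3}eF -{2 3}en.
  have p : 0 < 2 * (Num.sqrt (#|F|%:R : R) * Num.sqrt (n%:R : R)) by rewrite !mulr_gt0.
  move=> h; rewrite -(ler_pM2l p); move: h.
  move: (\sum_g _) (Num.sqrt _) (Num.sqrt _) => S x y; clear; lra.
rewrite -(subrK M1 M) ipDr; apply: le_trans (lerD h1 h2) _.
have -> : \sum_g c * Num.sqrt (nsq (one g)) * (b * Num.sqrt n%:R)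
    = c * b * Num.sqrt n%:R * \sum_g Num.sqrt (nsq (one g)).
  by rewrite mulr_sumr; apply: eq_bigr => g _; ring.
have {}h3 := ler_wpM2l (mulr_ge0 (mulr_ge0 c0 b0) (ltW sn)) h3.
apply: le_trans (lerD (lexx _) h3) _.
have e x y : c * b * x * (y * x) = c * b * x ^+ 2 * y by ring.
by rewrite e en le_eqVlt; apply/orP; left; apply/eqP; ring.
Qed.

End threshold.

(** * Spectral theorem *)

Section spectral.
Import all_fingroup complex.
Context {R : realType}.

(** Over the complex numbers the spectral theorem provides an eigenvalue that is real; it is a root
    of the characteristic polynomial over [R], hence has a real eigenvector. *)
Lemma symmetric_eigen n (A : 'M[R]_n.+1) : A^T = A ->
  exists (r : R) (v : 'cV[R]_n.+1), nsq v = 1 /\ A *m v = r *: v.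
Proof.
move=> symA; pose AC := map_mx (real_complex R) A.
have hC : AC \is hermsymmx.
  apply: realsym_hermsym.
    apply/is_hermitianmxP; rewrite expr0 scale1r map_mx_id //.
    by apply/matrixP => i j; rewrite !mxE -[in LHS]symA mxE.
  by apply/mxOverP => i j; rewrite mxE complex_real.
have := hermitian_spectral_diag_real hC; have := spectral_unit AC.
have /orthomx_spectralP := hermitian_normalmx hC.
set P := spectralmx AC; set sp := spectral_diag AC => eA uP real_sp.
pose z := sp 0 ord0.
have [r er] : exists r : R, z = real_complex R r.
  have /mxOverP/(_ 0 ord0) := real_sp; rewrite -/z => rz.
  by exists (complex.Re z); rewrite RRe_real.
have : eigenvalue AC z.
  apply/eigenvalueP; exists (row ord0 P).
    rewrite -row_mul eA -mulmxA mulKVmx // row_mul.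
    by rewrite row_diag_mx -scalemxAl -rowE.
  apply/eqP; rewrite rowE -[RHS](mul0mx _ P) => /(row_free_inj (_ : row_free P)) r0.
  have /rowP/(_ ord0) : (delta_mx 0 ord0 : 'rV[R[i]]_n.+1) = 0.
    by apply: r0; rewrite row_free_unit.
  by rewrite !mxE !eqxx => /eqP; rewrite oner_eq0.
rewrite eigenvalue_root_char er -map_char_poly fmorph_root -eigenvalue_root_char.
move=> /eigenvalueP[u eu u0].
have u0' : 0 < nsq u.
  rewrite lt_neqAle nsq_ge0 andbT eq_sym; apply: contraNneq u0 => h.
  by apply/eqP/nsq_eq0; rewrite h.
exists r, ((Num.sqrt (nsq u))^-1 *: u^T).
rewrite nsqZ nsq_trmx exprVn sqr_sqrtr ?nsq_ge0 // mulVf ?gt_eqF //; split => //.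
by rewrite -scalemxAr -{1}symA -trmx_mul eu linearZ /= scalerA mulrC -scalerA.
Qed.

(** Householder reflection along [v - e], which exchanges [v] and the first basis vector. *)
Lemma orthogonal_extend n (v : 'cV[R]_n.+1) : nsq v = 1 ->
  exists Q : 'M[R]_n.+1, orthogonal_mx Q /\ Q *m delta_mx 0 0 = v.
Proof.
move=> nv; pose e : 'cV[R]_n.+1 := delta_mx 0 0.
have [->|ve] := eqVneq v e.
  by exists 1%:M; rewrite /orthogonal_mx trmx1 !mul1mx.
pose w := v - e; pose a := 2 / nsq w.
have w0 : 0 < nsq w.
  rewrite lt_neqAle nsq_ge0 andbT eq_sym; apply: contraNneq ve => h.
  have /nsq_eq0 w0 : nsq w <= 0 by rewrite h.
  by rewrite -subr_eq0 -/w w0.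
have ww : w^T *m w = (nsq w)%:M by rewrite [LHS]mx11_scalar /nsq /ip trace_mx11.
have ee : nsq e = 1.
  rewrite nsq_cV (bigD1 0) //= mxE eqxx expr1n big1 ?addr0 // => i i0.
  by rewrite mxE (negPf i0) expr0n.
have we : w^T *m e = (- (nsq w) / 2)%:M.
  rewrite [LHS]mx11_scalar -trace_mx11 -/(ip w e).
  by rewrite /w nsqDE ipDl ipNl nsqN -/(nsq e) nv ee ipNr; congr (_%:M); field.
exists (1%:M - a *: (w *m w^T)); split.
  have tQ (H : 'M[R]_n.+1) : H^T = H -> (1%:M - a *: H)^T = 1%:M - a *: H.
    by move=> sH; apply/matrixP => i j; rewrite -[in RHS]sH !mxE eq_sym.
  rewrite /orthogonal_mx tQ; last by rewrite trmx_mul trmxK.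
  have key : w *m w^T *m (w *m w^T) = nsq w *: (w *m w^T).
    by rewrite mulmxA -(mulmxA w) ww mul_mx_scalar scalemxAl.
  rewrite mulmxBl mul1mx mulmxBr mulmx1 -scalemxAl -scalemxAr key !scalerA.
  rewrite (_ : a * a * nsq w = a + a); last by rewrite /a; field; rewrite gt_eqF.
  by rewrite scalerDl opprD opprK addKr subrK.
rewrite mulmxBl mul1mx -/e -scalemxAl -mulmxA we mul_mx_scalar scalerA.
rewrite /a (_ : 2 / nsq w * (- nsq w / 2) = -1); last by field; rewrite gt_eqF.
by rewrite scaleN1r opprK /w addrC subrK.
Qed.

(** Deflation: once an eigenvector is rotated onto the first axis, symmetry makes the matrix block
    diagonal. *)
Lemma symmetric_diagonalizable n (A : 'M[R]_n) : A^T = A ->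
  exists (q : 'M[R]_n) (lam : 'rV[R]_n),
    orthogonal_mx q /\ q^T *m A *m q = diag_mx lam.
Proof.
elim: n A => [|n IHn] A symA.
  by exists 1%:M, 0; split; apply/matrixP => -[].
have [r [v [nv ev]]] := symmetric_eigen symA.
have [Q [oQ eQ]] := orthogonal_extend nv.
pose B : 'M[R]_(1 + n) := Q^T *m A *m Q.
have symB : B^T = B by rewrite /B !trmx_mul trmxK symA mulmxA.
have Be : B *m delta_mx 0 0 = r *: (delta_mx 0 0 : 'cV[R]_n.+1).
  by rewrite /B -!mulmxA eQ ev -scalemxAr -eQ mulmxA oQ mul1mx.
have B0 i : B i 0 = r *+ (i == 0).
  have := congr1 (fun x : 'cV[R]_n.+1 => x i 0) Be.
  by rewrite -colE !mxE andbT => ->; rewrite mulr_natr.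
have eB : B = block_mx r%:M 0 0 (drsubmx B).
  move: symB B0; move: (B) => C symC C0.
  rewrite -{1}(submxK C); congr block_mx.
    by apply/matrixP => i j; rewrite !mxE !ord1 lshift0 C0.
    apply/matrixP => i j.
    have := congr1 (fun X : 'M[R]_n.+1 => X (lshift n i) (rshift 1 j)) symC.
    by rewrite !mxE !ord1 lshift0 => <-; rewrite C0.
  by apply/matrixP => i j; rewrite !mxE !ord1 lshift0 C0.
have [|q' [lam' [oq' eq']]] := IHn (drsubmx B).
  by rewrite trmx_drsub symB.
pose q1 : 'M[R]_(1 + n) := block_mx 1%:M 0 0 q'.
have q1T : q1^T = block_mx 1%:M 0 0 q'^T.
  by rewrite tr_block_mx !trmx0 trmx1.
have o1 : q1^T *m q1 = 1%:M.
  rewrite q1T mulmx_block !mul0mx !mulmx0 mul1mx !addr0 add0r.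
  by rewrite (oq' : q'^T *m q' = 1%:M) -scalar_mx_block.
have d1 : q1^T *m B *m q1 = diag_mx (row_mx r%:M lam').
  rewrite q1T eB !mulmx_block !mul0mx !mulmx0 !mul1mx !addr0 !add0r.
  rewrite !mul0mx ?mulmx0 ?addr0 ?add0r mulmx1 eq' diag_mx_row.
  by congr block_mx; apply/matrixP => i j; rewrite !mxE !ord1.
exists (Q *m q1), (row_mx r%:M lam'); split.
  by rewrite /orthogonal_mx trmx_mul mulmxA -(mulmxA _ Q^T) oQ mulmx1.
by rewrite -d1 /B trmx_mul !mulmxA.
Qed.

Lemma symmetric_spectral n (A : 'M[R]_n) : A^T = A ->
  exists (q : 'M[R]_n) (lam : 'rV[R]_n),
  [/\ orthogonal_mx q, forall i j : 'I_n, (i <= j)%N -> lam 0 j <= lam 0 i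
    & forall i, A *m col i q = lam 0 i *: col i q].
Proof.
move=> /symmetric_diagonalizable[q [lam [oq eq]]].
have eAq : A *m q = q *m diag_mx lam.
  by rewrite -eq !mulmxA orthogonal_mulmxT // mul1mx.
pose t := [tuple lam 0 i | i < n].
have szs : size (sort >=%O t) == n by rewrite size_sort size_tuple.
have /tuple_permP[p ep] : perm_eq (Tuple szs) t by rewrite /= perm_sort.
have es (i : 'I_n) : nth 0 (sort >=%O t) i = lam 0 (p i).
  have -> : sort >=%O t = Tuple szs :> seq R by [].
  rewrite ep (nth_map i) ?size_enum_ord // nth_ord_enum.
  by rewrite tnth_mktuple.
exists (\matrix_(i, j) q i (p j)), (\row_i lam 0 (p i)); split.
- apply/matrixP => i j; have := congr1 (fun X : 'M[R]_n => X (p i) (p j)) oq.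
  rewrite !mxE (inj_eq perm_inj) => <-; apply: eq_bigr => l _.
  by rewrite !mxE.
- move=> i j ij; rewrite !mxE -!es.
  have st : sorted >=%O (sort >=%O t) by apply: sort_sorted => x y; apply: le_total.
  apply: (sorted_leq_nth _ _ 0 st) => //.
  - by move=> x y z /= xy yz; apply: le_trans yz xy.
  - by move=> x /=.
  - by rewrite inE size_sort size_tuple.
  - by rewrite inE size_sort size_tuple.
- move=> i; rewrite (_ : col i _ = col (p i) q); last by apply/colP => j; rewrite !mxE.
  rewrite mxE colE mulmxA eAq -!colE mul_mx_diag.
  by apply/colP => j; rewrite !mxE mulrC.
Qed.

End spectral.

(** * Perturbation of the truncated square root *)

Section perturbation.
Context {R : realType}.

(** Supplies the test vectors of the two min-max arguments below. *)
Lemma nontrivial_kernel m n (C : 'M[R]_(m, n)) : (m < n)%N ->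
  exists2 y : 'cV[R]_n, y != 0 & C *m y = 0.
Proof.
move=> mn; have : kermx C^T != 0.
  rewrite -mxrank_eq0 mxrank_ker -lt0n subn_gt0.
  exact: leq_ltn_trans (rank_leq_col _) mn.
move=> /matrix0Pn[i [j kij]]; exists (row i (kermx C^T))^T.
  by apply/matrix0Pn; exists j, 0; move: kij; rewrite !mxE.
by rewrite -[LHS]trmxK trmx_mul trmxK -row_mul mulmx_ker row0 trmx0.
Qed.

Lemma nsq_gt0 m n (A : 'M[R]_(m, n)) : A != 0 -> 0 < nsq A.
Proof.
move=> A0; rewrite lt_neqAle nsq_ge0 andbT eq_sym; apply: contraNneq A0 => h.
by apply/eqP/nsq_eq0; rewrite h.
Qed.

Lemma ip_col m n (A B : 'M[R]_(m, n)) : ip A B = \sum_j ip (col j A) (col j B).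
Proof.
rewrite ipE exchange_big; apply: eq_bigr => j _; rewrite ipE.
by apply: eq_bigr => i _; rewrite big_ord1 !mxE.
Qed.

Lemma nsq_delta n (i : 'I_n) : nsq (delta_mx i 0 : 'cV[R]_n) = 1.
Proof.
rewrite nsq_cV (bigD1 i) //= !mxE !eqxx big1 ?addr0 ?expr1n // => j ji.
by rewrite mxE (negPf ji) expr0n.
Qed.

Lemma nsq_col_orth n (q : 'M[R]_n) i : orthogonal_mx q -> nsq (col i q) = 1.
Proof. by move=> oq; rewrite colE nsq_orthl // nsq_delta. Qed.

Lemma nsq_diag m p (d : 'rV[R]_m) (A : 'M[R]_(m, p)) :
  nsq (diag_mx d *m A) = \sum_i d 0 i ^+ 2 * \sum_j A i j ^+ 2.
Proof.
rewrite mul_diag_mx nsqE; apply: eq_bigr => i _; rewrite mulr_sumr.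
by apply: eq_bigr => j _; rewrite !mxE exprMn.
Qed.

Lemma ip_diag m p (d : 'rV[R]_m) (A : 'M[R]_(m, p)) :
  ip A (diag_mx d *m A) = \sum_i d 0 i * \sum_j A i j ^+ 2.
Proof.
rewrite mul_diag_mx ipE; apply: eq_bigr => i _; rewrite mulr_sumr.
by apply: eq_bigr => j _; rewrite !mxE; ring.
Qed.

Lemma ip_quad_le n (x : 'cV[R]_n) (E : 'M[R]_n) (e : R) : 0 <= e ->
  nsq E <= e ^+ 2 -> `|ip x (E *m x)| <= e * nsq x.
Proof.
move=> e0 hE; apply: norm_le_sqr; rewrite ?mulr_ge0 ?nsq_ge0 //.
apply: le_trans (ip_sqr_le _ _) _.
have -> : (e * nsq x) ^+ 2 = nsq x * (e ^+ 2 * nsq x) by ring.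
by apply: ler_wpM2l; rewrite ?nsq_ge0 //; apply: opb_nsq.
Qed.

Section diagonal_gram.
Context n k (Z : 'M[R]_(n, k)) (d : 'rV[R]_k) (m : R).
Hypotheses (gramZ : Z^T *m Z = diag_mx d) (m_gt0 : 0 < m).
Hypothesis d_ge : forall l, m <= d 0 l.

Let d_gt0 l : 0 < d 0 l. Proof. exact: lt_le_trans (d_ge l). Qed.

Lemma nsq_gram p (Y : 'M[R]_(k, p)) :
  nsq (Z *m Y) = \sum_l d 0 l * \sum_j Y l j ^+ 2.
Proof. by rewrite /nsq ip_mull mulmxA gramZ ip_diag. Qed.

Lemma nsq_gram_ge p (Y : 'M[R]_(k, p)) : m * nsq Y <= nsq (Z *m Y).
Proof.
rewrite nsq_gram nsqE mulr_sumr; apply: ler_sum => l _.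
by rewrite ler_wpM2r // sumr_ge0 // => j _; rewrite sqr_ge0.
Qed.

Lemma nsq_trmul_range (y : 'cV[R]_k) : m * nsq (Z *m y) <= nsq (Z^T *m (Z *m y)).
Proof.
rewrite mulmxA gramZ nsq_diag nsq_gram mulr_sumr; apply: ler_sum => l _.
rewrite mulrA ler_wpM2r ?sumr_ge0 // => [j _|]; first by rewrite sqr_ge0.
by rewrite expr2 ler_wpM2r // ltW.
Qed.

(** [Z h] is the orthogonal projection of [v] onto the range of [Z], and the left side is its
    squared norm. *)
Lemma bessel (v : 'cV[R]_n) : \sum_l (Z^T *m v) l 0 ^+ 2 / d 0 l <= nsq v.
Proof.
pose h : 'cV[R]_k := \col_l ((Z^T *m v) l 0 / d 0 l).
have e1 : ip v (Z *m h) = \sum_l (Z^T *m v) l 0 ^+ 2 / d 0 l.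
  rewrite ipC ip_mull ipE; apply: eq_bigr => l _; rewrite big_ord1.
  by rewrite [h _ _]mxE expr2 mulrAC.
have e2 : nsq (Z *m h) = \sum_l (Z^T *m v) l 0 ^+ 2 / d 0 l.
  rewrite nsq_gram; apply: eq_bigr => l _; rewrite big_ord1 [h _ _]mxE.
  by field; rewrite gt_eqF.
by have := nsq_ge0 (v - Z *m h); rewrite nsqDE ipNr nsqN e1 e2; lra.
Qed.

(* With [X^T Xh] symmetric positive semidefinite, [G := Xh - X] satisfies
   [||Xh Xh^T - X X^T||^2 >= 4/5 tr (X^T X G^T G)]. *)
Lemma procrustes (Zh : 'M[R]_(n, k)) (Q : 'M[R]_k) : orthogonal_mx Q ->
  (Q^T *m (Z^T *m Zh))^T = Q^T *m (Z^T *m Zh) ->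
  (forall y : 'cV[R]_k, 0 <= ip y (Q^T *m (Z^T *m Zh) *m y)) ->
  m * nsq (Zh - Z *m Q) <= 5 / 4 * nsq (Zh *m Zh^T - Z *m Z^T).
Proof.
move=> oQ; set P := Q^T *m _ => symP psdP.
pose X := Z *m Q; pose G := Zh - X.
have eX : X *m X^T = Z *m Z^T.
  by rewrite /X trmx_mul mulmxA -(mulmxA Z) orthogonal_mulmxT // mulmx1.
have eP : P = X^T *m Zh by rewrite /P /X trmx_mul mulmxA.
have eZh : Zh = X + G by rewrite /G addrC subrK.
pose a := G^T *m G; pose b := X^T *m X; pose t := X^T *m G.
have et : t = P - b by rewrite eP eZh mulmxDr addrC addKr.
have syma : a^T = a by rewrite trmx_mul trmxK.
have symb : b^T = b by rewrite trmx_mul trmxK.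
have symt : t^T = t by rewrite et linearB /= symP symb.
have tG : G^T *m X = t by rewrite -symt trmx_mul trmxK.
have eE : Zh *m Zh^T - Z *m Z^T = X *m G^T + G *m X^T + G *m G^T.
  rewrite -eX eZh linearD /= mulmxDl !mulmxDr.
  by rewrite addrC !addrA addNr add0r.
have n1 : nsq (X *m G^T) = \tr (b *m a).
  by rewrite /nsq /ip trmx_mul trmxK -mulmxA mxtrace_mulC -!mulmxA mulmxA.
have n2 : nsq (G *m X^T) = \tr (b *m a).
  by rewrite -nsq_trmx trmx_mul trmxK n1.
have n3 : nsq (G *m G^T) = \tr (a *m a).
  by rewrite /nsq /ip trmx_mul trmxK -mulmxA mxtrace_mulC -!mulmxA mulmxA.
have n4 : ip (X *m G^T) (G *m X^T) = \tr (t *m t).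
  by rewrite /ip trmx_mul trmxK -mulmxA mxtrace_mulC -!mulmxA mulmxA.
have n5 : ip (X *m G^T) (G *m G^T) = \tr (t *m a).
  by rewrite /ip trmx_mul trmxK -mulmxA mxtrace_mulC -!mulmxA mulmxA.
have n6 : ip (G *m X^T) (G *m G^T) = \tr (t *m a).
  rewrite /ip trmx_mul trmxK -mulmxA mxtrace_mulC -!mulmxA mulmxA tG.
  by rewrite [LHS]mxtrace_mulC -mulmxA.
(* The squared norm to bound is [2 tr(ba) + 2 tr(tt) + 4 tr(ta) + tr(aa)]. The weight 7/5 keeps
   [2 - 49/25 >= 0] in front of [tr(tt)] and leaves [6/5 tr(ta)], which [n8] bounds below by
   [- 6/5 tr(ba)]; hence the factor 4/5. *)
have n7 : 0 <= \tr (a *m a) + 14 / 5 * \tr (t *m a) + 49 / 25 * \tr (t *m t).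
  have := nsq_ge0 (a + (7 / 5) *: t); rewrite nsqDE nsqZ ipZr /nsq /ip syma symt.
  by rewrite (mxtrace_mulC a t); lra.
(* Since [t = P - b], the sum is [tr(P a)], nonnegative because [P] is positive semidefinite. *)
have n8 : 0 <= \tr (t *m a) + \tr (b *m a).
  rewrite et mulmxBl linearB /= subrK /a mulmxA mxtrace_mulC.
  have -> : \tr (G *m (P *m G^T)) = ip G^T (P *m G^T) by rewrite /ip trmxK.
  rewrite ip_col; apply: sumr_ge0 => j _.
  by rewrite [col j (P *m _)]colE -mulmxA -colE.
have n9 : m * nsq G <= \tr (b *m a).
  rewrite -n1 /X -mulmxA -(nsq_trmx G) -(nsq_orthl _ oQ).
  exact: nsq_gram_ge.
have n10 : 0 <= \tr (t *m t) by rewrite -{1}symt; apply: nsq_ge0.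
rewrite -/X -/G eE (nsqDE (_ + _)) (nsqDE (X *m _)) ipDl n1 n2 n3 n4 n5 n6.
by move: n7 n8 n9 n10; move: (\tr _) (\tr _) (\tr _) (\tr _) (m * _); clear => *; lra.
Qed.

Section eigen.
Context (B q : 'M[R]_n) (lam : 'rV[R]_n) (eta : R).
Hypothesis q_orth : orthogonal_mx q.
Hypothesis lam_sorted : forall i j : 'I_n, (i <= j)%N -> lam 0 j <= lam 0 i.
Hypothesis eigB : forall i, B *m col i q = lam 0 i *: col i q.
Hypotheses (eta_ge0 : 0 <= eta) (eta_le : eta <= m / 4).
Hypothesis hB : nsq (B - Z *m Z^T) <= eta ^+ 2.

Lemma eigen_mulmx : B *m q = q *m diag_mx lam.
Proof.
apply/matrixP => i j; have := congr1 (fun x : 'cV[R]_n => x i 0) (eigB j).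
rewrite colE mulmxA -colE mxE => ->.
by rewrite mul_mx_diag !mxE mulrC (bigD1 j) //= !mxE !eqxx mulr1 big1
  ?addr0 // => l lj; rewrite !mxE (negPf lj) mulr0.
Qed.

Lemma eigenE : B = q *m diag_mx lam *m q^T.
Proof. by rewrite -eigen_mulmx -mulmxA orthogonal_mulmxT // mulmx1. Qed.

Lemma ip_eigen (x : 'cV[R]_n) :
  ip x (B *m x) = \sum_j lam 0 j * (q^T *m x) j 0 ^+ 2.
Proof.
rewrite eigenE -!mulmxA -[q in LHS]trmxK -ip_mull trmxK ip_diag.
by apply: eq_bigr => j _; rewrite big_ord1.
Qed.

Lemma nsq_coord (x : 'cV[R]_n) : nsq x = \sum_j (q^T *m x) j 0 ^+ 2.
Proof. by rewrite -nsq_cV nsq_orthl //; apply: orthogonal_mxT. Qed.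

Lemma quad_split (x : 'cV[R]_n) :
  `|ip x (B *m x) - nsq (Z^T *m x)| <= eta * nsq x.
Proof.
have -> : ip x (B *m x) - nsq (Z^T *m x) = ip x ((B - Z *m Z^T) *m x).
  by rewrite mulmxBl ipDr ipNr -mulmxA -[Z in RHS]trmxK -ip_mull trmxK.
exact: ip_quad_le.
Qed.

(** Min-max: as [i < k], the range of [Z] contains a nonzero vector orthogonal to the first [i]
    eigenvectors. There the quadratic form of [B] is at most [lam i] and at least [m - eta], per
    unit of squared norm. *)
Lemma top_eigen_ge (i : 'I_n) : (i < k)%N -> m - eta <= lam 0 i.
Proof.
move=> ik; pose C : 'M[R]_(i, k) :=
  \matrix_(j, l) (q^T *m Z) (widen_ord (ltnW (ltn_ord i)) j) l.
have [y y0 Cy] := nontrivial_kernel C ik.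
set x := Z *m y.
have c0 (j : 'I_n) : (j < i)%N -> (q^T *m x) j 0 = 0.
  move=> ji; have h : (C *m y) (Ordinal ji) 0 = 0 by rewrite Cy mxE.
  rewrite mxE in h; rewrite /x mulmxA mxE -[RHS]h; apply: eq_bigr => l _.
  by rewrite [C _ _]mxE; congr ((_ : 'M[R]_(n, k)) _ _ * _); apply: val_inj.
have x0 : 0 < nsq x.
  by apply: lt_le_trans (nsq_gram_ge y); rewrite mulr_gt0 ?nsq_gt0.
have h1 : ip x (B *m x) <= lam 0 i * nsq x.
  rewrite ip_eigen nsq_coord mulr_sumr; apply: ler_sum => j _.
  have [ji|ij] := ltnP j i; first by rewrite c0 // expr0n /= !mulr0.
  by rewrite ler_wpM2r ?sqr_ge0 ?lam_sorted.
have h2 : m * nsq x <= nsq (Z^T *m x) := nsq_trmul_range y.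
have := quad_split x; rewrite ler_norml => /andP[h3 _].
have : (m - eta) * nsq x <= lam 0 i * nsq x by rewrite mulrBl; lra.
by rewrite ler_pM2r.
Qed.

(** The lower side is the Rayleigh quotient at [q_i], since [Z Z^T] is positive semidefinite. For
    the upper side, the span of the first [i + 1 > k] eigenvectors contains a nonzero vector killed
    by [Z^T]. *)
Lemma low_eigen_le (i : 'I_n) : (k <= i)%N -> `|lam 0 i| <= eta.
Proof.
move=> ki; rewrite ler_norml; apply/andP; split.
  have := quad_split (col i q); rewrite eigB ipZr -/(nsq _).
  rewrite nsq_col_orth //.
  rewrite !mulr1 ler_norml => /andP[h _]; have := nsq_ge0 (Z^T *m col i q); lra.
pose C : 'M[R]_(k, i.+1) :=
  \matrix_(l, j) (Z^T *m q) l (widen_ord (ltn_ord i) j).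
have [y y0 Cy] := nontrivial_kernel C ki.
pose c : 'cV[R]_n := \col_j (if insub (val j) is Some j' then y j' 0 else 0).
have cE (j : 'I_i.+1) : c (widen_ord (ltn_ord i) j) 0 = y j 0.
  rewrite mxE /= (insubT (fun l => l < i.+1)%N (ltn_ord j)) /=; congr (y _ 0).
  exact: val_inj.
have c0 (j : 'I_n) : (i < j)%N -> c j 0 = 0.
  by move=> ij; rewrite mxE insubF // ltnS leqNgt ij.
have cn0 : 0 < nsq c.
  apply: nsq_gt0; move/matrix0Pn: y0 => [j [l]]; rewrite ord1 => yj.
  apply/matrix0Pn; exists (widen_ord (ltn_ord i) j), 0.
  by rewrite cE.
set x := q *m c; have qx : q^T *m x = c by rewrite mulmxA q_orth mul1mx.
have h1 : lam 0 i * nsq x <= ip x (B *m x).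
  rewrite ip_eigen nsq_coord mulr_sumr qx; apply: ler_sum => j _.
  have [ji|ij] := leqP j i; last by rewrite c0 // expr0n /= !mulr0.
  by rewrite ler_wpM2r ?sqr_ge0 ?lam_sorted.
have h2 : Z^T *m x = 0.
  apply/matrixP => l l'; rewrite ord1.
  have h : (C *m y) l 0 = 0 by rewrite Cy mxE.
  rewrite mxE in h; rewrite [RHS]mxE -[RHS]h /x mulmxA mxE.
  rewrite (bigID (fun j : 'I_n => (j < i.+1)%N)) /= [X in _ + X]big1 ?addr0; last first.
    by move=> j; rewrite -leqNgt => /c0->; rewrite mulr0.
  rewrite (eq_bigr (fun j => (Z^T *m q) l (widen_ord (ltn_ord i) j)
     * c (widen_ord (ltn_ord i) j) 0)).
    by rewrite (big_ord_narrow (ltn_ord i)).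
  by move=> j _; rewrite cE [C _ _]mxE.
have := quad_split x; rewrite h2 nsq0 subr0 ler_norml => /andP[_ h3].
have x0 : 0 < nsq x by rewrite nsq_coord qx -nsq_cV.
by rewrite -(ler_pM2r x0); apply: le_trans h3.
Qed.

(* Projecting [(B - Z Z^T) q_i = lam_i q_i - Z g] onto the range of [Z] shows
   that [Z g] is dominated by [(B - Z Z^T) q_i]. *)
Lemma low_eigen_sqr_le (i : 'I_n) : (k <= i)%N ->
  lam 0 i ^+ 2 <= 10 * nsq ((B - Z *m Z^T) *m col i q).
Proof.
move=> ki; set v := col i q; set w := (B - Z *m Z^T) *m v; pose g := Z^T *m v.
have ew : lam 0 i *: v = w + Z *m g.
  by rewrite /w mulmxBl -eigB /g mulmxA subrK.
have nv : nsq v = 1 by apply: nsq_col_orth.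
have lamle := low_eigen_le ki.
(* Coordinate [l] of [Z^T w] is [(lam_i - d_l) g_l], and [d_l - lam_i >= d_l / 2] because
   [lam_i <= m / 4]. The final constant is [10 = 2 + 2 * 4]. *)
have h1 : nsq (Z *m g) <= 4 * nsq w.
  apply: le_trans (_ : 4 * \sum_l (Z^T *m w) l 0 ^+ 2 / d 0 l <= _); last first.
    by rewrite ler_pM2l // bessel.
  rewrite nsq_gram mulr_sumr; apply: ler_sum => l _; rewrite big_ord1.
  have -> : (Z^T *m w) l 0 = (lam 0 i - d 0 l) * g l 0.
    have := congr1 (fun x => (Z^T *m x) l 0) ew.
    rewrite -scalemxAr mulmxDr mulmxA gramZ mul_diag_mx !mxE => h.
    by rewrite mulrBl h addrK.
  have dl := d_ge l; move: lamle; rewrite ler_norml => /andP[_ lamle].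
  have -> : 4 * (((lam 0 i - d 0 l) * g l 0) ^+ 2 / d 0 l)
     = (2 * (d 0 l - lam 0 i)) ^+ 2 / d 0 l * g l 0 ^+ 2 by field; rewrite gt_eqF.
  rewrite ler_wpM2r ?sqr_ge0 // ler_pdivlMr // -expr2.
  have dg := d_gt0 l; have eta0 := eta_ge0; have etal := eta_le.
  by rewrite ler_sqr ?nnegrE; lra.
have -> : lam 0 i ^+ 2 = nsq (lam 0 i *: v) by rewrite nsqZ nv mulr1.
rewrite ew; apply: le_trans (nsqD_le _ _) _; lra.
Qed.

Section truncated_root.
Context (kn : (k <= n)%N).
Let w (j : 'I_k) : 'I_n := widen_ord kn j.
Let Zt : 'M[R]_(n, k) := \matrix_(i, j) (Num.sqrt (Num.max (lam 0 (w j)) 0) * q i (w j)).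

Let lamw_ge j : m - eta <= lam 0 (w j).
Proof. by apply: (@top_eigen_ge (w j)); exact: (ltn_ord j). Qed.

Let lamw_gt0 j : 0 < lam 0 (w j).
Proof.
by apply: lt_le_trans (lamw_ge j); have := m_gt0; have := eta_le; have := eta_ge0; lra.
Qed.

Let maxw j : Num.max (lam 0 (w j)) 0 = lam 0 (w j).
Proof. by apply/max_idPl/ltW. Qed.

(** The first [k] eigenvalues are positive, so the truncation at zero in the square root is
    inactive. *)
Lemma truncated_root_mulmxT : Zt *m Zt^T =
  q *m diag_mx (\row_j (if (j < k)%N then lam 0 j else 0)) *m q^T.
Proof.
apply/matrixP => i j; rewrite !mxE.
rewrite [RHS](bigID (fun l : 'I_n => (l < k)%N)) /= [X in _ + X]big1 ?addr0; last first.
  by move=> l /negPf lk; rewrite mul_mx_diag !mxE lk mulr0 mul0r.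
rewrite (big_ord_narrow kn); apply: eq_bigr => l _.
rewrite mul_mx_diag !mxE /= ltn_ord maxw.
rewrite -{3}(sqr_sqrtr (ltW (lamw_gt0 l))); ring.
Qed.

(** Each discarded eigenvalue is charged to [F] applied to its own eigenvector. These images are the
    columns of [F q], whose squares add up to [nsq F]: no factor [n] appears. Then
    [22 = 2 * 10 + 2]. *)
Lemma truncated_root_err :
  nsq (Zt *m Zt^T - Z *m Z^T) <= 22 * nsq (B - Z *m Z^T).
Proof.
set F := B - Z *m Z^T; have h : nsq (Zt *m Zt^T - B) <= 10 * nsq F.
  rewrite truncated_root_mulmxT eigenE -mulmxBl -mulmxBr.
  rewrite nsq_orthr ?nsq_orthl //; last exact: orthogonal_mxT.
  rewrite -(nsq_orthr F q_orth) (nsq_col (F *m q)) mulr_sumr nsqE.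
  apply: ler_sum => i _; rewrite (bigD1 i) //= big1 ?addr0; last first.
    by move=> j ji; rewrite !mxE eq_sym (negPf ji) !mulr0n subr0 expr0n.
  rewrite !mxE eqxx !mulr1n; case: ltnP => ik.
    by rewrite subrr expr0n mulr_ge0 ?nsq_ge0.
  by rewrite sub0r sqrrN colE -mulmxA -colE; apply: low_eigen_sqr_le.
rewrite -(subrK B (Zt *m _)) -addrA -/F.
by apply: le_trans (nsqD_le _ _) _; lra.
Qed.

(** Delocalization: [lam q_i] is an entry of [B q], at most [sqrt n * c] by Cauchy-Schwarz, and
    [lam q_i^2 = (lam q_i)^2 / lam] with [lam >= m / 2]. For [m] of order [n] the bound is a
    constant. *)
Lemma truncated_root_entry (c : R) : 0 <= c -> (forall i j, `|B i j| <= c) ->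
  forall i j, Zt i j ^+ 2 <= 2 * c ^+ 2 * n%:R / m.
Proof.
move=> c0 hc i j; rewrite mxE maxw exprMn (sqr_sqrtr (ltW (lamw_gt0 j))).
have h1 : (lam 0 (w j) * q i (w j)) ^+ 2 <= n%:R * c ^+ 2.
  have -> : lam 0 (w j) * q i (w j) = (row i B *m col (w j) q) 0 0.
    have := congr1 (fun x : 'cV[R]_n => x i 0) (eigB (w j)); rewrite -row_mul !mxE.
    by move=> <-; apply: eq_bigr => l _; rewrite !mxE.
  have := ip_sqr_le (row i B)^T (col (w j) q).
  rewrite [ip _ _]/ip trmxK trace_mx11 nsq_trmx nsq_col_orth // mulr1.
  move=> h; apply: le_trans h _; rewrite -[n%:R]mul1r.
  by apply: nsq_entry => i' j'; rewrite mxE.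
have l0 := lamw_gt0 j.
have h2 : lam 0 (w j) * q i (w j) ^+ 2 <= n%:R * c ^+ 2 / lam 0 (w j).
  rewrite ler_pdivlMr //; apply: le_trans h1.
  by rewrite le_eqVlt; apply/orP; left; apply/eqP; ring.
apply: le_trans h2 _; rewrite ler_pdivrMr // mulrAC ler_pdivlMr //.
have h3 : m / 2 <= lam 0 (w j).
  by apply: le_trans (lamw_ge j); have := m_gt0; have := eta_le; have := eta_ge0; lra.
have h4 : 0 <= n%:R * c ^+ 2 by rewrite mulr_ge0 ?sqr_ge0.
have := ler_wpM2l h4 h3; lra.
Qed.

(** A nonzero vector in the span of the top eigenvectors has quadratic form at least [m - eta], but
    at most [eta] if [Z^T] kills it; this contradicts [eta <= m / 4]. It gives the polar
    decomposition of [Z^T Zt] an invertible argument. *)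
Lemma truncated_root_cross_inj (y : 'cV[R]_k) : Z^T *m Zt *m y = 0 -> y = 0.
Proof.
move=> Hy; apply/eqP; apply: contraT => y0; set x := Zt *m y.
pose c : 'cV[R]_n := q^T *m x.
have Zx : Z^T *m x = 0 by rewrite mulmxA.
have hc i : c i 0 = \sum_j (if i == w j then Num.sqrt (lam 0 (w j)) * y j 0 else 0).
  rewrite /c /x mulmxA mxE; apply: eq_bigr => j _; rewrite mxE.
  rewrite (eq_bigr (fun l => Num.sqrt (lam 0 (w j)) * (q^T i l * q l (w j)))); last first.
    by move=> l _; rewrite [Zt _ _]mxE maxw; ring.
  rewrite -mulr_sumr; have := congr1 (fun X : 'M[R]_n => X i (w j)) q_orth.
  by rewrite !mxE => ->; case: eqP; rewrite ?mulr1 // mulr0 mul0r.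
have c0 (i : 'I_n) : (k <= i)%N -> c i 0 = 0.
  move=> ki; rewrite hc big1 // => j _; case: eqP => // e.
  by move: ki; rewrite e /= leqNgt ltn_ord.
have cw j : c (w j) 0 = Num.sqrt (lam 0 (w j)) * y j 0.
  rewrite hc (bigD1 j) //= eqxx big1 ?addr0 // => l lj; case: eqP => // e.
  by case/eqP: lj; apply: val_inj; have := congr1 val e.
have nx : nsq x = \sum_i c i 0 ^+ 2 by rewrite nsq_coord.
have x0 : 0 < nsq x.
  rewrite nx -nsq_cV; apply: nsq_gt0; move/matrix0Pn: y0 => [j [l]].
  rewrite ord1 => yj; apply/matrix0Pn; exists (w j), 0.
  by rewrite cw mulf_neq0 // sqrtr_eq0 -ltNge.
have := quad_split x; rewrite Zx nsq0 subr0 ler_norml => /andP[_ h].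
have h2 : (m - eta) * nsq x <= ip x (B *m x).
  rewrite ip_eigen nx mulr_sumr; apply: ler_sum => i _.
  have [ik|ki] := ltnP i k; last by rewrite -/c c0 // expr0n /= !mulr0.
  by rewrite ler_wpM2r ?sqr_ge0 ?top_eigen_ge.
have h3 : (m - eta) * nsq x <= eta * nsq x by apply: le_trans h.
rewrite ler_pM2r // in h3.
by exfalso; have := m_gt0; have := eta_le; have := eta_ge0; lra.
Qed.

End truncated_root.
End eigen.
End diagonal_gram.
End perturbation.

(** * Spectral estimates of Z and alpha *)

Section estimator.
Context {R : realType}.

(** [Q = H (H^T H)^(-1/2)]; injectivity of [H] makes the eigenvalues of [H^T H] positive, so the
    inverse root exists. *)
Lemma polar_decomposition k (H : 'M[R]_k) :
  (forall y : 'cV[R]_k, H *m y = 0 -> y = 0) ->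
  exists Q : 'M[R]_k, [/\ orthogonal_mx Q, (Q^T *m H)^T = Q^T *m H
    & forall y : 'cV[R]_k, 0 <= ip y (Q^T *m H *m y)].
Proof.
move=> injH; have symHH : (H^T *m H)^T = H^T *m H by rewrite trmx_mul trmxK.
have [V [lam [oV eV]]] := symmetric_diagonalizable symHH.
have HHV : H^T *m H *m V = V *m diag_mx lam.
  by rewrite -eV !mulmxA orthogonal_mulmxT // mul1mx.
have eHH : H^T *m H = V *m diag_mx lam *m V^T.
  by rewrite -HHV -mulmxA orthogonal_mulmxT // mulmx1.
have lam_gt0 i : 0 < lam 0 i.
  have -> : lam 0 i = nsq (H *m col i V).
    rewrite /nsq ip_mull mulmxA {2}colE (mulmxA _ V) HHV.
    have -> : V *m diag_mx lam *m delta_mx i 0 = lam 0 i *: col i V.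
      by rewrite -colE mul_mx_diag; apply/colP => j; rewrite !mxE mulrC.
    by rewrite ipZr -/(nsq _) nsq_col_orth // mulr1.
  apply: nsq_gt0; apply/eqP => /injH V0.
  by have := nsq_col_orth i oV; rewrite V0 nsq0 => /eqP; rewrite eq_sym oner_eq0.
pose r : 'rV[R]_k := \row_i Num.sqrt (lam 0 i).
pose ri : 'rV[R]_k := \row_i (Num.sqrt (lam 0 i))^-1.
have r_gt0 i : 0 < Num.sqrt (lam 0 i) by rewrite sqrtr_gt0.
pose W := V *m diag_mx ri *m V^T.
have symW : W^T = W by rewrite /W !trmx_mul trmxK tr_diag_mx mulmxA.
have WH : W *m (H^T *m H) = V *m diag_mx r *m V^T.
  rewrite eHH /W !mulmxA -(mulmxA _ V^T V) oV mulmx1 -(mulmxA V) mulmx_diag.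
  congr (_ *m diag_mx _ *m _); apply/rowP => i; rewrite !mxE.
  by rewrite -{2}(sqr_sqrtr (ltW (lam_gt0 i))) expr2 mulKf ?gt_eqF.
have QT : (H *m W)^T = W *m H^T by rewrite trmx_mul symW.
exists (H *m W); rewrite QT -mulmxA WH; split.
- rewrite /orthogonal_mx QT mulmxA -(mulmxA W) WH /W !mulmxA.
  rewrite -(mulmxA _ V^T V) oV mulmx1 -(mulmxA V) mulmx_diag.
  rewrite (_ : (\row__ _) = const_mx 1); last first.
    by apply/rowP => i; rewrite !mxE divff // gt_eqF.
  by rewrite diag_const_mx mulmx1 orthogonal_mulmxT.
- by rewrite !trmx_mul trmxK tr_diag_mx mulmxA.
- move=> y; rewrite -!mulmxA -[V in X in ip y X]trmxK -ip_mull trmxK ip_diag.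
  apply: sumr_ge0 => i _; rewrite mulr_ge0 ?sumr_ge0 // => [|j _].
    by rewrite mxE ltW.
  by rewrite sqr_ge0.
Qed.

(** The aligning rotation is the orthogonal polar factor of [Z^T Zt], which makes [procrustes]
    applicable; [55/2 = 5/4 * 22]. *)
Lemma truncated_root_dist n k (Z : 'M[R]_(n, k)) (d : 'rV[R]_k) (m : R)
    (B q : 'M[R]_n) (lam : 'rV[R]_n) (eta : R) (kn : (k <= n)%N) :
  Z^T *m Z = diag_mx d -> 0 < m -> (forall l, m <= d 0 l) ->
  orthogonal_mx q -> (forall i j : 'I_n, (i <= j)%N -> lam 0 j <= lam 0 i) ->
  (forall i, B *m col i q = lam 0 i *: col i q) ->
  0 <= eta -> eta <= m / 4 -> nsq (B - Z *m Z^T) <= eta ^+ 2 ->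
  let Zt : 'M[R]_(n, k) := \matrix_(i, j)
    (Num.sqrt (Num.max (lam 0 (widen_ord kn j)) 0) * q i (widen_ord kn j)) in
  exists2 Q, orthogonal_mx Q & m * nsq (Zt - Z *m Q) <= 55 / 2 * nsq (B - Z *m Z^T).
Proof.
move=> gramZ m0 dm oq sl eB eta0 etam hB Zt.
have [Q [oQ sQ pQ]] := polar_decomposition
  (truncated_root_cross_inj gramZ m0 dm oq sl eB eta0 etam hB (kn := kn)).
exists Q => //; apply: le_trans (procrustes gramZ dm oQ sQ pQ) _.
have := truncated_root_err gramZ m0 dm oq sl eB eta0 etam hB kn; rewrite -/Zt.
by move: (nsq _) (nsq _) => x y; clear; lra.
Qed.

(** * Estimation of the intercepts *)

Section intercept.
Context n (n_gt0 : (0 < n)%N).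
Let J : 'M[R]_n := n%:R%:M + all_ones n *m (all_ones n)^T.

Let ones_entry (x : 'cV[R]_n) i : (all_ones n *m (all_ones n)^T *m x) i 0 = \sum_j x j 0.
Proof.
rewrite -mulmxA mxE big_ord1 mxE mul1r mxE.
by apply: eq_bigr => j _; rewrite !mxE mul1r.
Qed.

Lemma intercept_mxE (x : 'cV[R]_n) i : (J *m x) i 0 = n%:R * x i 0 + \sum_j x j 0.
Proof. by rewrite mulmxDl mxE ones_entry mul_scalar_mx mxE. Qed.

(** [J >= n I] as quadratic forms, since the rank-one term is positive semidefinite; Cauchy-Schwarz
    turns this into a bound on [J x]. *)
Lemma intercept_mx_ge (x : 'cV[R]_n) : n%:R ^+ 2 * nsq x <= nsq (J *m x).
Proof.
have [x0|x0] := leP (nsq x) 0.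
  by rewrite (nsq_eq0 x0) nsq0 mulr0 nsq_ge0.
have h : n%:R * nsq x <= ip x (J *m x).
  have -> : ip x (J *m x) = n%:R * nsq x + (\sum_j x j 0) ^+ 2.
    rewrite ipE nsq_cV mulr_sumr expr2 mulr_suml -big_split /=.
    by apply: eq_bigr => i _; rewrite big_ord1 intercept_mxE; ring.
  by rewrite lerDl sqr_ge0.
rewrite -(ler_pM2l x0); apply: le_trans (ip_sqr_le x (J *m x)).
have -> : nsq x * (n%:R ^+ 2 * nsq x) = (n%:R * nsq x) ^+ 2 by ring.
by rewrite ler_sqr ?nnegrE ?mulr_ge0 ?nsq_ge0 // (le_trans _ h) // mulr_ge0 ?nsq_ge0.
Qed.

Lemma intercept_mx_unit : J \in unitmx.
Proof.
have symJ : J^T = J.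
  by rewrite linearD /= trmx_mul trmxK tr_scalar_mx.
rewrite -row_free_unit; apply: inj_row_free => v vJ.
have := intercept_mx_ge v^T.
have -> : J *m v^T = (v *m J)^T by rewrite trmx_mul symJ.
rewrite vJ trmx0 nsq0.
rewrite pmulr_rle0 ?exprn_gt0 ?ltr0n // => /nsq_eq0 h.
by rewrite -[v]trmxK h trmx0.
Qed.

Lemma nsq_rank1_ones (x : 'cV[R]_n) : nsq (x *m (all_ones n)^T) = n%:R * nsq x.
Proof.
rewrite nsqE nsq_cV mulr_sumr; apply: eq_bigr => i _.
rewrite (eq_bigr (fun=> x i 0 ^+ 2)); last first.
  by move=> j _; rewrite mxE big_ord1 !mxE mulr1.
by rewrite sumr_const card_ord mulr_natl.
Qed.

Context k (Z : 'M[R]_(n, k)) (alpha : 'cV[R]_n) (Th : 'M[R]_n).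
Hypothesis centeredZ : (all_ones n)^T *m Z = 0.
Let ah := invmx J *m (Th *m all_ones n).

Let Jah : J *m ah = Th *m all_ones n.
Proof. by rewrite mulmxA mulmxV ?mul1mx // intercept_mx_unit. Qed.

Lemma ThetaE : Theta Z alpha =
  Z *m Z^T + alpha *m (all_ones n)^T + all_ones n *m alpha^T.
Proof.
apply/matrixP => i j; rewrite !mxE !big_ord1 !mxE.
have -> : \sum_l Z i l * Z^T l j = \sum_l Z i l * Z j l.
  by apply: eq_bigr => l _; rewrite mxE.
by ring.
Qed.

(** Centring kills [Z Z^T 1], so the true intercepts solve the linear system of the estimator with
    [Theta] in place of [Th]. *)
Let Jalpha : J *m alpha = Theta Z alpha *m all_ones n.
Proof.
have Z1 : Z^T *m all_ones n = 0.
  by rewrite -[LHS]trmxK trmx_mul trmxK centeredZ trmx0.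
apply/matrixP => i j; rewrite ord1 intercept_mxE ThetaE 2!mulmxDl -(mulmxA Z) Z1.
rewrite mulmx0 add0r [RHS]mxE; congr (_ + _).
  rewrite -mulmxA [RHS]mxE big_ord1 mulrC; congr (_ * _).
  rewrite mxE (eq_bigr (fun=> 1)) ?sumr_const ?card_ord // => l _.
  by rewrite !mxE mulr1.
rewrite -mulmxA [RHS]mxE big_ord1 [all_ones _ _ _]mxE mul1r mxE.
by apply: eq_bigr => l _; rewrite !mxE mulr1.
Qed.

Lemma intercept_err : n%:R * nsq (ah - alpha) <= nsq (Th - Theta Z alpha).
Proof.
have h1 := intercept_mx_ge (ah - alpha).
rewrite mulmxBr Jah Jalpha -mulmxBl in h1.
have h2 : nsq ((Th - Theta Z alpha) *m all_ones n)
    <= nsq (Th - Theta Z alpha) * n%:R.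
  have -> : (n%:R : R) = nsq (all_ones n : 'cV[R]_n).
    rewrite nsq_cV (eq_bigr (fun=> 1)) ?sumr_const ?card_ord // => i _.
    by rewrite mxE expr1n.
  exact: nsq_mulmx_le.
have n0 : 0 < (n%:R : R) by rewrite ltr0n.
by rewrite -(ler_pM2l n0) mulrA -expr2 (le_trans h1) // mulrC.
Qed.

(** Summing the equations of [J ah = Th 1] gives [2 n sum ah = 1^T Th 1], which controls [sum ah];
    each single equation then controls [n ah_i]. *)
Lemma intercept_bound (b : R) : (forall i j, `|Th i j| <= b) ->
  forall i, `|ah i 0| <= 2 * b.
Proof.
move=> hb i; have n0 : 0 < (n%:R : R) by rewrite ltr0n.
have b0 : 0 <= b by apply: le_trans (hb i i).
have row_le l : `|(Th *m all_ones n) l 0| <= n%:R * b.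
  rewrite mxE (eq_bigr (fun j => Th l j)); last by move=> j _; rewrite mxE mulr1.
  apply: le_trans (ler_norm_sum _ _ _) _.
  apply: le_trans (ler_sum _ (fun j _ => hb l j)) _.
  by rewrite sumr_const card_ord mulr_natl.
have S_le : `|\sum_j ah j 0| <= n%:R * b.
  have e : \sum_l (Th *m all_ones n) l 0 = 2 * n%:R * \sum_j ah j 0.
    rewrite -Jah (eq_bigr _ (fun l _ => intercept_mxE ah l)) big_split /=.
    rewrite -mulr_sumr sumr_const card_ord -mulr_natl; ring.
  have h : `|\sum_l (Th *m all_ones n) l 0| <= n%:R * (n%:R * b).
    apply: le_trans (ler_norm_sum _ _ _) _.
    apply: le_trans (ler_sum _ (fun j _ => row_le j)) _.
    by rewrite sumr_const card_ord -(mulr_natl (n%:R * b)).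
  move: h; rewrite e normrM [`|2 * _|]ger0_norm ?mulr_ge0 // => h.
  rewrite -(ler_pM2l n0); apply: le_trans h.
  by rewrite -mulrA ler_peMl ?mulr_ge0 // ler1n.
have := intercept_mxE ah i; rewrite Jah => e.
have h : `|n%:R * ah i 0| <= n%:R * (2 * b).
  have -> : n%:R * ah i 0 = (Th *m all_ones n) i 0 - \sum_j ah j 0 by rewrite e addrK.
  apply: le_trans (ler_normB _ _) _; apply: le_trans (lerD (row_le i) S_le) _; lra.
by rewrite normrM ger0_norm // ler_pM2l in h.
Qed.

(** The intercept error enters through two rank-one matrices of squared norm [n * nsq D] each; the
    constant is [10 = 2 + 2 * (2 + 2)]. *)
Lemma residual_err :
  nsq (Th - ah *m (all_ones n)^T - all_ones n *m ah^T - Z *m Z^T)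
  <= 10 * nsq (Th - Theta Z alpha).
Proof.
pose D := ah - alpha.
have -> : Th - ah *m (all_ones n)^T - all_ones n *m ah^T - Z *m Z^T
    = (Th - Theta Z alpha) + (- (D *m (all_ones n)^T) + - (all_ones n *m D^T)).
  by rewrite ThetaE /D; apply/matrixP => i j; rewrite !mxE !big_ord1 !mxE; ring.
apply: le_trans (nsqD_le _ _) _.
have h := nsqD_le (- (D *m (all_ones n)^T)) (- (all_ones n *m D^T)).
rewrite !nsqN -(nsq_trmx (all_ones n *m _)) trmx_mul trmxK nsq_rank1_ones in h.
have := intercept_err; rewrite -/D.
move: h; move: (nsq _) (nsq _) (n%:R * _) => x y z; lra.
Qed.

End intercept.

Lemma linfnorm_le n (v : 'cV[R]_n) (c : R) : 0 <= c ->
  (forall i, `|v i 0| <= c) -> linfnorm v <= c.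
Proof. by move=> c0 h; apply/bigmax_leP; split. Qed.

Lemma linfnorm_ge n (v : 'cV[R]_n) i : `|v i 0| <= linfnorm v.
Proof. exact: (le_bigmax _ (fun i => `|v i 0|)). Qed.

Lemma l2norm_eq1 n (v : 'cV[R]_n) : (l2norm v = 1) <-> (nsq v = 1).
Proof.
split=> h; first by rewrite -l2norm_sqr h expr1n.
by apply/eqP; rewrite -(eqrXn2 (_ : 0 < 2)%N) ?sqrtr_ge0 // l2norm_sqr h expr1n.
Qed.

Lemma norm_mulmx_le n k (M : 'M[R]_(n, k)) (v : 'cV[R]_k) i (c : R) : 0 <= c ->
  nsq v = 1 -> \sum_j M i j ^+ 2 <= c ^+ 2 -> `|(M *m v) i 0| <= c.
Proof.
move=> c0 v1 h; apply: norm_le_sqr => //.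
have := ip_sqr_le (row i M)^T v; rewrite /ip trmxK -row_mul trace_mx11 v1 mulr1 mxE.
move=> /le_trans; apply; rewrite nsq_trmx nsqE big_ord1; apply: le_trans h.
by apply: ler_sum => j _; rewrite mxE.
Qed.

Lemma norm2inf_le n k (M : 'M[R]_(n, k)) (c : R) : (0 < k)%N -> 0 <= c ->
  (forall i, \sum_j M i j ^+ 2 <= c ^+ 2) -> norm2inf M <= c.
Proof.
move=> k0 c0 h; apply: ge_sup.
  pose j0 := Ordinal k0.
  exists (linfnorm (M *m delta_mx j0 0)), (delta_mx j0 0) => //=.
  by apply/l2norm_eq1; rewrite nsq_delta.
move=> _ [v /= /l2norm_eq1 v1 <-]; apply: linfnorm_le => // i.
exact: norm_mulmx_le.
Qed.

Lemma norm2inf_entry n k (M : 'M[R]_(n, k)) i j : `|M i j| <= norm2inf M.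
Proof.
have d1 : nsq (delta_mx j 0 : 'cV[R]_k) = 1 by rewrite nsq_delta.
apply: (@le_trans _ _ (linfnorm (M *m delta_mx j 0))).
  by apply: le_trans (linfnorm_ge _ i); rewrite -colE mxE.
apply: ub_le_sup; last by exists (delta_mx j 0) => //=; apply/l2norm_eq1.
exists (Num.sqrt (nsq M)) => _ [v /= /l2norm_eq1 v1 <-].
apply: linfnorm_le; rewrite ?sqrtr_ge0 // => l; apply: norm_mulmx_le => //.
rewrite sqr_sqrtr ?nsq_ge0 // nsqE [leRHS](bigD1 l) //= lerDl.
by do 2!(apply: sumr_ge0 => ? _); rewrite sqr_ge0.
Qed.

(** For the nonnegative diagonal matrix [Z^T Z / n] the identity matrices form a singular value
    decomposition, so every diagonal entry belongs to the set whose infimum is [sigma_min]. *)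
Lemma cond_T3_gram n k (Z : 'M[R]_(n, k)) (M2 : R) : (0 < n)%N ->
  is_diag_mx (Z^T *m Z) -> cond_T3 M2 Z ->
  exists2 d : 'rV[R]_k, Z^T *m Z = diag_mx d & forall l, M2 * n%:R <= d 0 l.
Proof.
move=> n0 /is_diag_mxP hd h3; have n0' : 0 < (n%:R : R) by rewrite ltr0n.
pose d : 'rV[R]_k := \row_l (Z^T *m Z) l l.
have gramZ : Z^T *m Z = diag_mx d.
  apply/matrixP => i j; rewrite [RHS]mxE [d _ _]mxE.
  have [->|ij] := eqVneq i j; first by rewrite mulr1n.
  by rewrite hd.
exists d => // l; rewrite -ler_pdivlMr //; apply: le_trans h3 _.
have dge0 l' : 0 <= d 0 l'.
  rewrite [d _ _]mxE mxE; apply: sumr_ge0 => i _.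
  by rewrite mxE -expr2 sqr_ge0.
apply: ge_inf; first by exists 0 => _ [U [s [V [[_ _ s0 _] [i ->]]]]].
exists 1%:M, (\row_i (d 0 i / n%:R)), 1%:M; split; last by exists l; rewrite [RHS]mxE.
have o1 : orthogonal_mx (1%:M : 'M[R]_k) by rewrite /orthogonal_mx trmx1 mul1mx.
split=> // [i|].
  by rewrite mxE divr_ge0 // ltW.
rewrite (is_svdE _ _ _ xpredT) trmx1 mul1mx mulmx1 gramZ.
by apply/matrixP => i j; rewrite !mxE -mulrnAr mulrC mulrnAl mulrnAr.
Qed.

(** The perturbation lemmas are used with [m = M2 n] and [eta = m / 4]. The constants are
    [275 = 10 * 55/2] and [50 b^2 = 2 (5 b)^2], the residual having entries at most
    [b + 2b + 2b]. *)
Lemma spectral_estimator_err n k (Z Zt : 'M[R]_(n, k)) (alpha : 'cV[R]_n)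
    (Th : 'M[R]_n) (M2 b : R) : (0 < n)%N -> 0 < M2 ->
  cond_T1 Z -> cond_T3 M2 Z -> (forall i j, `|Th i j| <= b) ->
  10 * nsq (Th - Theta Z alpha) <= (M2 * n%:R / 4) ^+ 2 ->
  let ah := invmx (n%:R%:M + all_ones n *m (all_ones n)^T) *m (Th *m all_ones n) in
  top_psd_sqrt (Th - ah *m (all_ones n)^T - all_ones n *m ah^T) Zt ->
  dist2 (row_mx Zt ah) (row_mx Z alpha)
    <= (275 / M2 + 1) * nsq (Th - Theta Z alpha) / n%:R /\
  norm2inf (row_mx Zt ah) <= 1 + k%:R * (50 * b ^+ 2 / M2) + 4 * b ^+ 2.
Proof.
move=> n0 M20 [cZ dZ] h3 hb small ah [q [lam [kn [oq sl eB ->]]]].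
have n0' : 0 < (n%:R : R) by rewrite ltr0n.
have b0 : 0 <= b by apply: le_trans (hb (Ordinal n0) (Ordinal n0)).
have [d gramZ dm] := cond_T3_gram n0 dZ h3.
have m0 : 0 < M2 * n%:R by rewrite mulr_gt0.
pose B := Th - ah *m (all_ones n)^T - all_ones n *m ah^T.
have hres : nsq (B - Z *m Z^T) <= 10 * nsq (Th - Theta Z alpha).
  exact: residual_err.
have hah i : `|ah i 0| <= 2 * b by apply: intercept_bound.
have eta0 : 0 <= M2 * n%:R / 4 by rewrite divr_ge0 // ltW.
have hB := le_trans hres small.
split.
  rewrite /dist2 !row_mxKl !row_mxKr l2norm_sqr.
  have [Q oQ hQ] := truncated_root_dist kn gramZ m0 dm oq sl eB eta0 (lexx _) hB.
  have hal := intercept_err n0 alpha Th cZ; rewrite -/ah in hal.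
  have h1 : nsq (ah - alpha) <= nsq (Th - Theta Z alpha) / n%:R.
    by rewrite ler_pdivlMr // mulrC.
  set Zt' := (\matrix_(i, j) _) in hQ *.
  have h2 : nsq (Zt' - Z *m Q) <= 275 / M2 * nsq (Th - Theta Z alpha) / n%:R.
    have -> : 275 / M2 * nsq (Th - Theta Z alpha) / n%:R
       = 275 * nsq (Th - Theta Z alpha) / (M2 * n%:R) by field; rewrite !gt_eqF.
    rewrite ler_pdivlMr // mulrC; apply: le_trans hQ _.
    by move: hres; rewrite /B; lra.
  have -> : (275 / M2 + 1) * nsq (Th - Theta Z alpha) / n%:R =
     275 / M2 * nsq (Th - Theta Z alpha) / n%:R + nsq (Th - Theta Z alpha) / n%:R by ring.
  apply: lerD h1; apply: le_trans h2; apply: ge_inf.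
    by exists 0 => _ [Q' _ <-]; rewrite sqr_ge0.
  by exists Q => //; rewrite frob_sqr.
have hBe i j : `|B i j| <= 5 * b.
  have -> : B i j = Th i j - ah i 0 - ah j 0.
    by rewrite /B; move: (ah) => a; rewrite !mxE !big_ord1 !mxE mulr1 mul1r.
  apply: le_trans (ler_normB _ _) _; apply: le_trans (lerD (ler_normB _ _) (lexx _)) _.
  by have := hb i j; have := hah i; have := hah j; lra.
have hZ := truncated_root_entry gramZ m0 dm oq sl eB eta0 (lexx _) hB kn
  (mulr_ge0 (ler0n R 5) b0) hBe.
set Zt' := (\matrix_(i, j) _).
(* The summand 1 makes the constant at least 1, hence at most its own square: a bound on squared row
   norms then serves for the row norms without a root. *)
have c1 : 1 <= 1 + k%:R * (50 * b ^+ 2 / M2) + 4 * b ^+ 2.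
  by rewrite -addrA lerDl addr_ge0 // !mulr_ge0 ?sqr_ge0 ?invr_ge0 // ltW.
apply: norm2inf_le; [by rewrite addn1|exact: le_trans c1|move=> i].
rewrite big_split_ord /= big_ord1 row_mxEr.
apply: (@le_trans _ _ (k%:R * (50 * b ^+ 2 / M2) + 4 * b ^+ 2)).
  apply: lerD; last first.
    rewrite -real_normK ?num_real // (_ : 4 * b ^+ 2 = (2 * b) ^+ 2); last by ring.
    by rewrite ler_sqr ?nnegrE ?mulr_ge0.
  rewrite mulr_natl -[k in _ *+ k]card_ord -sumr_const; apply: ler_sum => j _.
  rewrite row_mxEl; apply: le_trans (hZ i j) _.
  by rewrite le_eqVlt; apply/orP; left; apply/eqP; field; rewrite !gt_eqF.
apply: (@le_trans _ _ (1 + k%:R * (50 * b ^+ 2 / M2) + 4 * b ^+ 2)).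
  by rewrite -addrA lerDr.
by rewrite expr2 ler_peMl // (le_trans _ c1).
Qed.

End estimator.

(** * Order statistics and projection onto the range of the link *)

Section order_statistics.
Context {R : realType}.

Section sorted_seq.
Variables (s : seq R).
Hypothesis s_sorted : sorted <=%O s.

Let nth_le i j : (i <= j)%N -> (j < size s)%N -> nth 0 s i <= nth 0 s j.
Proof.
move=> ij js; apply: (sorted_leq_nth (@le_trans _ _) (@lexx _ _) 0 s_sorted) => //.
by rewrite inE (leq_ltn_trans ij).
Qed.

Lemma count_lt_nth i : (count (fun y => (y < nth 0 s i)%R) s <= i)%N.
Proof.
have [si|is_] := leqP (size s) i; first exact: leq_trans (count_size _ _) si.
rewrite -{2}(cat_take_drop i s) count_cat.
rewrite [X in (_ + X)%N](_ : _ = 0%N) ?addn0.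
  by apply: leq_trans (count_size _ _) _; rewrite size_takel // ltnW.
apply/eqP; rewrite -leqn0 leqNgt -has_count; apply/hasPn => y /(nthP 0)[j].
rewrite size_drop ltn_subRL nth_drop => ji <-.
by rewrite -leNgt nth_le // leq_addr.
Qed.

Lemma count_gt_nth i : (i < size s)%N ->
  (count (fun y => (nth 0 s i < y)%R) s <= size s - i.+1)%N.
Proof.
move=> is_; rewrite -{2}(cat_take_drop i.+1 s) count_cat.
rewrite [X in (X + _)%N](_ : _ = 0%N) ?add0n.
  by apply: leq_trans (count_size _ _) _; rewrite size_drop.
apply/eqP; rewrite -leqn0 leqNgt -has_count; apply/hasPn => y /(nthP 0)[j].
rewrite size_takel // => ji <-; rewrite nth_take // -leNgt nth_le //.
Qed.

Lemma nth_lt_count i x : (i < size s)%N -> nth 0 s i < x ->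
  (i < count (fun y => (y < x)%R) s)%N.
Proof.
move=> is_ ix; rewrite -(cat_take_drop i.+1 s) count_cat ltn_addr //.
rewrite (_ : count _ _ = i.+1) // -[RHS](size_takel is_); apply/eqP.
rewrite -all_count; apply/allP => y /(nthP 0)[j].
rewrite size_takel // => ji <-; rewrite nth_take //.
by apply: le_lt_trans ix; apply: nth_le.
Qed.

Lemma nth_gt_count i x : (i < size s)%N -> x < nth 0 s i ->
  (size s - i <= count (fun y => (x < y)%R) s)%N.
Proof.
move=> is_ ix; rewrite -[X in count _ X](cat_take_drop i s) count_cat.
apply: leq_trans (leq_addl _ _).
rewrite (_ : count _ _ = (size s - i)%N) // -size_drop; apply/eqP.
rewrite -all_count; apply/allP => y /(nthP 0)[j].
rewrite size_drop ltn_subRL nth_drop => ji <-.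
by apply: lt_le_trans ix _; rewrite nth_le // leq_addr.
Qed.

End sorted_seq.

Context n (E : 'M[R]_n).
Let s := sort <=%O [seq E e.1 e.2 | e : 'I_n * 'I_n].

Let s_sorted : sorted <=%O s.
Proof. exact: sort_le_sorted. Qed.

Let size_s : size s = (n ^ 2)%N.
Proof. by rewrite size_sort size_image card_prod card_ord expnS expn1. Qed.

Let count_s (a : pred R) : count a s = #|[set e : 'I_n * 'I_n | a (E e.1 e.2)]%SET|.
Proof.
rewrite count_sort count_map enumT cardE /enum_mem size_filter.
by apply: eq_count => e /=; rewrite inE.
Qed.

Lemma order_stat_le l l' : (l <= l' <= n ^ 2)%N -> (0 < l')%N ->
  order_stat E l <= order_stat E l'.
Proof.
move=> /andP[ll' l'n] l0.
apply: (sorted_leq_nth (@le_trans _ _) (@lexx _ _) 0 s_sorted).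
- by rewrite inE size_s; lia.
- by rewrite inE size_s; lia.
- by lia.
Qed.

Lemma card_lt_order_stat l :
  (#|[set e : 'I_n * 'I_n | (E e.1 e.2 < order_stat E l)%R]%SET| <= l.-1)%N.
Proof. by rewrite -(count_s (fun y => y < _)) count_lt_nth. Qed.

Lemma card_gt_order_stat l : (0 < l <= n ^ 2)%N ->
  (#|[set e : 'I_n * 'I_n | (order_stat E l < E e.1 e.2)%R]%SET| <= n ^ 2 - l)%N.
Proof.
move=> ln; rewrite -(count_s (fun y => _ < y)).
have h : (l.-1 < size s)%N by rewrite size_s; lia.
by apply: leq_trans (count_gt_nth s_sorted h) _; rewrite size_s; lia.
Qed.

Lemma order_stat_lt_card l x : (0 < l <= n ^ 2)%N -> order_stat E l < x ->
  (l <= #|[set e : 'I_n * 'I_n | (E e.1 e.2 < x)%R]%SET|)%N.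
Proof.
move=> ln lx; rewrite -(count_s (fun y => y < x)).
have h : (l.-1 < size s)%N by rewrite size_s; lia.
by apply: leq_trans (nth_lt_count s_sorted h lx); lia.
Qed.

Lemma order_stat_gt_card l x : (0 < l <= n ^ 2)%N -> x < order_stat E l ->
  (n ^ 2 - l < #|[set e : 'I_n * 'I_n | (x < E e.1 e.2)%R]%SET|)%N.
Proof.
move=> ln lx; rewrite -(count_s (fun y => x < y)).
have h : (l.-1 < size s)%N by rewrite size_s; lia.
by apply: leq_trans (nth_gt_count s_sorted h lx); rewrite size_s; lia.
Qed.

End order_statistics.

(** * Monotonicity and range of the link function *)

Section link_function.
Context {R : realType} (mu : R -> R).
Hypothesis L1 : cond_L1 mu.

Lemma link_continuous : continuous mu.
Proof.
by case: L1 => dmu _ _ x; apply: differentiable_continuous; apply/derivable1_diffP.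
Qed.

Lemma link_increment (b : R) : 0 < b -> exists ka kb : R, [/\ 0 < ka, 0 < kb
  & forall x y, - b <= x -> x <= y -> y <= b ->
    ka * (y - x) <= mu y - mu x <= kb * (y - x)].
Proof.
move=> b0; case: L1 => dmu _ /(_ b b0)[ka [kb [ka0 kb0 h]]].
exists ka, kb; split=> // x y bx xy yb.
have [||c cxy ->] := @MVT_segment _ mu (derive1 mu) x y xy.
- by move=> z _; rewrite derive1E; apply: DeriveDef.
- by apply: continuous_subspaceT; exact: link_continuous.
have cb : c \in `[- b, b].
  move: cxy; rewrite !in_itv /= => /andP[xc cy].
  by rewrite (le_trans bx xc) (le_trans cy yb).
have /andP[h1 h2] := h _ cb.
by rewrite !ler_wpM2r ?subr_ge0.
Qed.

(** The derivative bounds hold on bounded intervals only, so [b] is taken large enough to contain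
    both points. *)
Lemma link_lt x y : x < y -> mu x < mu y.
Proof.
move=> xy; pose b := `|x| + `|y| + 1.
have b0 : 0 < b by rewrite ltr_wpDl ?addr_ge0.
have [ka [kb [ka0 _ h]]] := link_increment b0.
have xb : - b <= x by have := ler_norm (- x); rewrite normrN /b; have := normr_ge0 y; lra.
have yb : y <= b by have := ler_norm y; rewrite /b; have := normr_ge0 x; lra.
have /andP[h1 _] := h x y xb (ltW xy) yb.
by rewrite -subr_gt0; apply: lt_le_trans h1; rewrite mulr_gt0 // subr_gt0.
Qed.

Lemma link_le x y : (mu x <= mu y) = (x <= y).
Proof.
have [xy|yx] := leP x y; last by apply/negbTE; rewrite -ltNge link_lt.
by move: xy; rewrite le_eqVlt => /predU1P[->|/link_lt/ltW->]; rewrite ?lexx.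
Qed.

Lemma link_range x y v : mu x <= v -> v <= mu y ->
  exists2 c, x <= c <= y & mu c = v.
Proof.
move=> xv vy; have xy : x <= y by rewrite -link_le (le_trans xv).
have [||c] := @IVT _ mu x y v xy.
- by apply: continuous_subspaceT; exact: link_continuous.
- by rewrite ge_min xv le_max vy orbT.
by rewrite in_itv /=; exists c.
Qed.


Lemma link_range_itv x y : range mu x -> range mu y -> `[x, y] `<=` range mu.
Proof.
move=> [a _ <-] [b _ <-] v /=; rewrite in_itv /= => /andP[av vb].
by have [c _ <-] := link_range av vb; exists c.
Qed.

(** * Clipping a noisy matrix between its order statistics *)

Section projection.
Context n (Et M : 'M[R]_n) (gamma : nat) (lo hi m0 m1 delta : R).
Hypotheses (range_lo : range mu lo) (range_hi : range mu hi).
Hypotheses (delta_gt0 : 0 < delta) (lo_le : lo <= m0 - delta) (le_hi : m1 + delta <= hi).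
Hypothesis M_itv : forall i j, m0 <= M i j <= m1.
Hypotheses (gamma_gt0 : (0 < gamma)%N) (gamma_small : (2 * gamma < n ^ 2)%N).
Hypothesis err_small : nsq (Et - M) < gamma%:R * delta ^+ 2.

(** Chebyshev counting: each entry of [S] contributes at least [delta^2] to the squared error. *)
Let bad_card (S : {set 'I_n * 'I_n}) :
  (forall e, e \in S -> delta <= `|Et e.1 e.2 - M e.1 e.2|) -> (#|S| < gamma)%N.
Proof.
move=> hS; rewrite -(ltr_nat R) -(ltr_pM2r (exprn_gt0 2 delta_gt0)).
apply: le_lt_trans err_small; rewrite nsqE pair_big /= mulr_natl -sumr_const.
rewrite [leRHS](bigID (mem S)) /= -[leLHS]addr0; apply: lerD; last first.
  by apply: sumr_ge0 => e _; rewrite sqr_ge0.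
apply: ler_sum => e eS; rewrite !mxE -[leRHS]real_normK ?num_real //.
by rewrite ler_sqr ?nnegrE ?hS // ltW.
Qed.

Let lo_le_stat : lo <= order_stat Et gamma.
Proof.
rewrite leNgt; apply/negP => h.
have := order_stat_lt_card _ h; rewrite gamma_gt0 /=.
have hn : (gamma <= n ^ 2)%N by lia.
move=> /(_ hn); rewrite leqNgt => /negP; apply; apply: bad_card => e.
rewrite inE => he; have /andP[h0 _] := M_itv e.1 e.2.
have ll := lo_le; by rewrite distrC; apply: le_trans (ler_norm _); lra.
Qed.

Let stat_le_hi : order_stat Et (n ^ 2 - gamma) <= hi.
Proof.
rewrite leNgt; apply/negP => h.
have hn : (0 < n ^ 2 - gamma <= n ^ 2)%N by lia.
have := order_stat_gt_card hn h; rewrite subKn; last by lia.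
move=> h'; have := ltn_trans h' (bad_card _); rewrite ltnn => h2.
have : false; last by [].
apply: h2 => e; rewrite inE => he; have /andP[_ h1] := M_itv e.1 e.2.
have ll := le_hi; by apply: le_trans (ler_norm _); lra.
Qed.

Let stat_le : order_stat Et gamma <= order_stat Et (n ^ 2 - gamma).
Proof. by apply: order_stat_le; lia. Qed.

Let adm : admissible_indices mu Et gamma (n ^ 2 - gamma).
Proof.
split=> //; [by lia|by lia|].
move=> v /=; rewrite in_itv /= => /andP[h1 h2].
apply: (link_range_itv range_lo range_hi) => /=; rewrite in_itv /=.
by rewrite (le_trans lo_le_stat h1) (le_trans h2 stat_le_hi).
Qed.

Let clip := fun e : R => Num.max (order_stat Et gamma)
  (Num.min (order_stat Et (n ^ 2 - gamma)) e).

(** As [(gamma, n^2 - gamma)] is itself admissible, the extreme indices lie outside it and the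
    intersection of the two intervals is the one given by [gamma]. *)
Let extreme_clip l1 l2 : extreme_indices mu Et l1 l2 ->
  Num.max (order_stat Et gamma) (order_stat Et l1) = order_stat Et gamma /\
  Num.min (order_stat Et (n ^ 2 - gamma)) (order_stat Et l2)
    = order_stat Et (n ^ 2 - gamma).
Proof.
move=> [[l1_gt0 l12 l2n _] /(_ _ _ adm)[h1 h2]].
by split; [apply/max_idPl|apply/min_idPl]; apply: order_stat_le; lia.
Qed.

Lemma range_projectionE Er : range_projection mu gamma Et Er -> Er = map_mx clip Et.
Proof. by move=> [l1 [l2 [/extreme_clip[-> ->] [_ _]]]]. Qed.

(** The smallest [l1] and the largest [l2] may come from different admissible pairs. They still form
    one, because the range of [mu] is an interval and contains both end order statistics. *)
Let extreme_exists : exists l1 l2, extreme_indices mu Et l1 l2.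
Proof.
pose p1 := fun l => `[< exists l', admissible_indices mu Et l l' >].
pose p2 := fun l => `[< exists l', admissible_indices mu Et l' l >].
have ex1 : exists l, p1 l by exists gamma; apply/asboolP; exists (n ^ 2 - gamma)%N.
have ex2 : exists l, p2 l by exists (n ^ 2 - gamma)%N; apply/asboolP; exists gamma.
have ub2 l : p2 l -> (l <= n ^ 2)%N by move=> /asboolP[l' []].
have [l1 /asboolP[l1' adm1] min1] := ex_minnP ex1.
have [l2 /asboolP[l2' adm2] max2] := ex_maxnP ex2 ub2.
have ext l l' : admissible_indices mu Et l l' -> (l1 <= l)%N /\ (l' <= l2)%N.
  by move=> h; split; [apply: min1|apply: max2]; apply/asboolP; eexists; exact: h.
exists l1, l2; split => //.
have [hg1 hg2] := ext _ _ adm.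
case: adm1 => a1 a2 a3 a4; case: adm2 => b1 b2 b3 b4.
split; [by []|by lia|by []|].
apply: link_range_itv.
  by apply: a4; rewrite /= in_itv /= lexx /=; apply: order_stat_le; lia.
by apply: b4; rewrite /= in_itv /= lexx andbT; apply: order_stat_le; lia.
Qed.

Lemma range_projection_exists : range_projection mu gamma Et (map_mx clip Et).
Proof.
have [l1 [l2 ext]] := extreme_exists; exists l1, l2; split=> //.
have [-> ->] := extreme_clip ext; split=> //.
by apply/andP; split => //; lia.
Qed.

Let clip_itv e : lo <= clip e <= hi.
Proof.
apply/andP; split; first by rewrite /clip le_max lo_le_stat.
rewrite /clip ge_max (le_trans stat_le stat_le_hi) /=.
by rewrite ge_min stat_le_hi.
Qed.

Lemma range_projection_itv i j : lo <= map_mx clip Et i j <= hi.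
Proof. by rewrite mxE. Qed.

(** Clipping changes at most [gamma] entries on either side, each ending within [hi - lo] of [M];
    all others keep their error. *)
Lemma range_projection_err :
  nsq (map_mx clip Et - M) <= nsq (Et - M) + 2 * gamma%:R * (hi - lo) ^+ 2.
Proof.
pose S1 := [set e : 'I_n * 'I_n | Et e.1 e.2 < order_stat Et gamma]%SET.
pose S2 := [set e : 'I_n * 'I_n | order_stat Et (n ^ 2 - gamma) < Et e.1 e.2]%SET.
have c1 : (#|S1| <= gamma)%N.
  by apply: leq_trans (card_lt_order_stat _ _) _; apply: leq_pred.
have c2 : (#|S2| <= gamma)%N.
  apply: leq_trans (card_gt_order_stat _ _) _; first by lia.
  by rewrite subKn; lia.
have sumS (S : {set 'I_n * 'I_n}) : \sum_e (if e \in S then (hi - lo) ^+ 2 else 0)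
    = #|S|%:R * (hi - lo) ^+ 2.
  by rewrite -big_mkcond sumr_const mulr_natl.
apply: (@le_trans _ _ (nsq (Et - M) + (#|S1|%:R * (hi - lo) ^+ 2
    + #|S2|%:R * (hi - lo) ^+ 2))); last first.
  have d0 := sqr_ge0 (hi - lo).
  have h1 : #|S1|%:R * (hi - lo) ^+ 2 <= gamma%:R * (hi - lo) ^+ 2.
    by rewrite ler_wpM2r // ler_nat.
  have h2 : #|S2|%:R * (hi - lo) ^+ 2 <= gamma%:R * (hi - lo) ^+ 2.
    by rewrite ler_wpM2r // ler_nat.
  rewrite lerD2l; lra.
rewrite -!sumS !nsqE !pair_big /= -!big_split /=; apply: ler_sum => e _.
have big_err : (map_mx clip Et - M) e.1 e.2 ^+ 2 <= (hi - lo) ^+ 2.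
  rewrite 3!mxE -real_normK ?num_real // ler_sqr ?nnegrE //; last first.
    have /andP[h1 h2] := clip_itv 0; lra.
  have /andP[h1 h2] := clip_itv (Et e.1 e.2); have /andP[h3 h4] := M_itv e.1 e.2.
  have d0 := delta_gt0; have ll := lo_le; have hh := le_hi.
  by rewrite ler_norml; apply/andP; split; lra.
have s0 : 0 <= (Et - M) e.1 e.2 ^+ 2 by rewrite sqr_ge0.
have d0 : 0 <= (hi - lo) ^+ 2 by rewrite sqr_ge0.
rewrite !inE; case: ltP => h1; first by case: ifP => _; lra.
case: ltP => h2; first by lra.
rewrite !addr0 !mxE /clip (min_idPr h2) (max_idPr h1) //.
Qed.

End projection.
End link_function.

(** * Finite product spaces and lattice points *)

Section finite_product.
Context {R : realType}.

(** Upper bound from lower ones: [exp (-x) >= (1 - x/2)^2], and this square times the quadratic is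
    at least 1 on [[-1, 1]]. *)
Lemma expR_le_quadratic (x : R) : `|x| <= 1 -> expR x <= 1 + x + 2 * x ^+ 2.
Proof.
rewrite ler_norml => /andP[x1 x2].
have e0 := expR_gt0 (- x); have ee : expR x * expR (- x) = 1 by rewrite -expRD subrr expR0.
have q0 : 0 <= 1 + x + 2 * x ^+ 2 by have := sqr_ge0 x; nra.
have h1 : (1 - x / 2) ^+ 2 <= expR (- x).
  have -> : - x = - x / 2 + - x / 2 by field.
  rewrite expRD -expr2 ler_sqr ?nnegrE; [|by lra|exact: expR_ge0].
  by have := expR_ge1Dx (- x / 2); lra.
have h2 : 1 <= (1 - x / 2) ^+ 2 * (1 + x + 2 * x ^+ 2).
  have -> : (1 - x / 2) ^+ 2 * (1 + x + 2 * x ^+ 2)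
     = 1 + x ^+ 2 * ((1 - x) * (5 / 2 - x) / 2) by field.
  by rewrite lerDl mulr_ge0 ?sqr_ge0 // divr_ge0 // mulr_ge0; lra.
have h3 : expR x * expR (- x) <= (1 + x + 2 * x ^+ 2) * expR (- x).
  by rewrite ee; apply: le_trans h2 _; rewrite mulrC ler_wpM2l.
by rewrite ler_pM2r in h3.
Qed.

Section product_weight.
Variables (I V : finType) (q : I -> V -> R).
Hypotheses (q_ge0 : forall i v, 0 <= q i v) (q_sum : forall i, \sum_v q i v = 1).

Definition pweight (w : {ffun I -> V}) : R := \prod_i q i (w i).

Lemma pweight_ge0 w : 0 <= pweight w.
Proof. by apply: prodr_ge0. Qed.

Lemma expect_prod (g : I -> V -> R) :
  \sum_w pweight w * \prod_i g i (w i) = \prod_i \sum_v q i v * g i v.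
Proof.
rewrite bigA_distr_bigA; apply: eq_bigr => w _.
by rewrite /pweight -big_split.
Qed.

Lemma pweight_sum : \sum_w pweight w = 1.
Proof.
transitivity (\sum_w pweight w * \prod_(i : I) 1).
  by apply: eq_bigr => w _; rewrite big1 ?mulr1.
rewrite (expect_prod (fun _ _ => 1)); apply: big1 => i _.
by under eq_bigr do rewrite mulr1.
Qed.

Lemma expect_sqr_sum (b : I -> V -> R) : (forall i, \sum_v q i v * b i v = 0) ->
  \sum_w pweight w * (\sum_i b i (w i)) ^+ 2 = \sum_i \sum_v q i v * b i v ^+ 2.
Proof.
move=> b0.
have h i j : \sum_w pweight w * (b i (w i) * b j (w j)) =
    if i == j then \sum_v q i v * b i v ^+ 2 else 0.
  (* The product [b i * b j] is rewritten as a product over all coordinates so that [expect_prod]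
     applies; for [i != j] the factor at [i] is a vanishing mean. *)
  pose g l v := (if l == i then b i v else 1) * (if l == j then b j v else 1).
  have e w : b i (w i) * b j (w j) = \prod_l g l (w l).
    rewrite big_split /= -!big_mkcond !big_pred1_eq; congr (_ * _).
  under eq_bigr do rewrite e; rewrite expect_prod (bigD1 i) //= {1 2}/g eqxx.
  case: (eqVneq i j) => [<-|ij].
    rewrite [X in _ * X]big1 ?mulr1; first by apply: eq_bigr => v _; rewrite expr2.
    by move=> l li; under eq_bigr do rewrite /g (negPf li) !mulr1.
  under eq_bigr do rewrite mulr1; by rewrite b0 mul0r.
under eq_bigr => w _.
  rewrite expr2 mulr_suml mulr_sumr.
  under eq_bigr do rewrite mulr_sumr mulr_sumr; over.
rewrite exchange_big /=; apply: eq_bigr => i _.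
rewrite exchange_big /= (bigD1 i) //= h eqxx [X in _ + X]big1 ?addr0 // => j ji.
by rewrite h eq_sym (negPf ji).
Qed.

(** Bernstein's argument: the linear term of each factor vanishes by centring, and
    [1 + 2 s <= exp (2 s)]. *)
Lemma mgf_sum (c : I -> V -> R) (s : I -> R) :
  (forall i v, `|c i v| <= 1) -> (forall i, \sum_v q i v * c i v = 0) ->
  (forall i, \sum_v q i v * c i v ^+ 2 <= s i) ->
  \sum_w pweight w * expR (\sum_i c i (w i)) <= expR (2 * \sum_i s i).
Proof.
move=> c1 c0 cs; under eq_bigr do rewrite expR_sum.
rewrite (expect_prod (fun i v => expR (c i v))) mulr_sumr expR_sum.
apply: ler_prod => i _; rewrite sumr_ge0 /=; last first.
  by move=> v _; rewrite mulr_ge0 ?expR_ge0.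
apply: le_trans (expR_ge1Dx _).
apply: (@le_trans _ _ (\sum_v (q i v + q i v * c i v + 2 * (q i v * c i v ^+ 2)))).
  apply: ler_sum => v _; have := ler_wpM2l (q_ge0 i v) (expR_le_quadratic (c1 i v)); lra.
rewrite !big_split /= q_sum c0 addr0 -mulr_sumr lerD2l ler_pM2l //.
Qed.

Lemma markov_exp (f : {ffun I -> V} -> R) (c E : R) :
  \sum_w pweight w * expR (f w) <= expR E ->
  \sum_(w | c <= f w) pweight w <= expR (E - c).
Proof.
move=> h; rewrite expRD expRN ler_pdivlMr ?expR_gt0 // mulrC mulr_sumr.
apply: le_trans h; rewrite big_mkcond; apply: ler_sum => w _.
case: ifP => cf; last by rewrite mulr_ge0 ?expR_ge0 ?pweight_ge0.
by rewrite mulrC ler_wpM2l ?pweight_ge0 // ler_expR.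
Qed.

Lemma union_bound (J : finType) (S : pred J) (bad : J -> pred {ffun I -> V}) (c e : R) :
  (forall j, S j -> \sum_(w | bad j w) pweight w <= e) -> 0 <= e -> #|S|%:R <= c ->
  \sum_(w | [exists j, S j && bad j w]) pweight w <= c * e.
Proof.
move=> h e0 hc; apply: (@le_trans _ _ (\sum_(j | S j) \sum_(w | bad j w) pweight w)).
  rewrite (exchange_big_dep predT) //= big_mkcond; apply: ler_sum => w _.
  case: existsP => [[j /andP[Sj bj]]|_]; last by apply: sumr_ge0 => *; apply: pweight_ge0.
  rewrite (bigD1 j) ?Sj //= lerDl; apply: sumr_ge0 => *; exact: pweight_ge0.
apply: le_trans (ler_sum _ h) _; rewrite sumr_const -mulr_natl.
by rewrite ler_wpM2r.
Qed.

End product_weight.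

(* Generating-function count: [#{z : f z <= c} <= e^c sum_z e^(-f z)]. *)
Lemma card_exp_le (I K : finType) (f : K -> R) (c A : R) :
  \sum_k expR (- f k) <= expR A ->
  #|[pred z : {ffun I -> K} | \sum_i f (z i) <= c]|%:R <= expR (c + #|I|%:R * A).
Proof.
move=> hA; rewrite -sum1_card natr_sum /=.
apply: (@le_trans _ _ (\sum_(z : {ffun I -> K}) expR c * \prod_i expR (- f (z i)))).
  rewrite [leLHS]big_mkcond; apply: ler_sum => z _; rewrite inE.
  have p0 : 0 <= \prod_i expR (- f (z i)) by apply: prodr_ge0 => i _; apply: expR_ge0.
  case: ifP => h; last by rewrite mulr_ge0 ?expR_ge0.
  rewrite -expR_sum -expRD sumrN; apply: le_trans (expR_ge1Dx _).
  by rewrite lerDl subr_ge0.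
rewrite -mulr_sumr -(bigA_distr_bigA (fun _ k => expR (- f k))) expRD ler_pM2l ?expR_gt0 //.
rewrite prodr_const expRM_natl lerXn2r ?nnegrE ?expR_ge0 //.
by apply: sumr_ge0 => k _; apply: expR_ge0.
Qed.


Lemma sum_half_pow N : \sum_(j < N) (2^-1 : R) ^+ j <= 2.
Proof.
suff h : \sum_(j < N) (2^-1 : R) ^+ j = 2 - 2 * 2^-1 ^+ N.
  by rewrite h gerBl mulr_ge0 // exprn_ge0.
elim: N => [|N IH]; first by rewrite big_ord0 expr0; ring.
by rewrite big_ord_recr /= IH exprS; field.
Qed.

Lemma expRN_sqr_le (m : nat) : expR (- (m%:R : R) ^+ 2) <= 2^-1 ^+ m.
Proof.
rewrite expRN exprVn lef_pV2 ?posrE ?expR_gt0 ?exprn_gt0 //.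
apply: le_trans (_ : expR (m%:R) <= _); last first.
  by rewrite ler_expR expr2 -natrM ler_nat; case: m => // m; rewrite leq_pmulr.
rewrite -[m%:R]mulr1 expRM_natl lerXn2r ?nnegrE ?expR_ge0 //.
by apply: le_trans (expR_ge1Dx _); lra.
Qed.

(* The points of [h Z^n], [h = 1 / (4 sqrt n)], with coordinates in [-1, 1]. *)
Section lattice.
Variable n : nat.
Hypothesis n_gt0 : (0 < n)%N.

Local Notation lat := 'I_(4 * n + (4 * n).+1)%N.
Definition lat_h : R := (4 * Num.sqrt n%:R)^-1.
Definition latv (k : lat) : R := ((k : nat)%:R - (4 * n)%:R) * lat_h.
Definition lat0 : lat := rshift (4 * n) ord0.
Definition nvec (z : {ffun 'I_n -> lat}) : 'cV[R]_n := \col_i latv (z i).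

Let sqrtn_gt0 : 0 < Num.sqrt (n%:R : R). Proof. by rewrite sqrtr_gt0 ltr0n. Qed.

Lemma lat_h_gt0 : 0 < lat_h.
Proof. by rewrite invr_gt0 mulr_gt0. Qed.

Lemma lat_h_sqr : 16 * n%:R * lat_h ^+ 2 = 1.
Proof.
rewrite exprVn exprMn sqr_sqrtr // (_ : 4 ^+ 2 = 16); last by ring.
by rewrite divff // gt_eqF // mulr_gt0 // ltr0n.
Qed.

Lemma latv0 : latv lat0 = 0.
Proof. by rewrite /latv /= addn0 subrr mul0r. Qed.

(** Rounding goes towards zero, so that rounded vectors stay in the unit ball. *)
Lemma latv_round (x : R) : `|x| <= 1 ->
  exists k : lat, `|latv k| <= `|x| /\ `|x - latv k| <= lat_h.
Proof.
move=> x1; have h0 := lat_h_gt0.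
pose m := Num.truncn (`|x| / lat_h).
have xh0 : 0 <= `|x| / lat_h by rewrite divr_ge0 // ltW.
have /andP[m1 m2] := truncn_itv xh0; rewrite -/m in m1 m2.
rewrite ler_pdivlMr // in m1; rewrite ltr_pdivrMr // in m2.
(* [m * lat_h <= 1] means [m <= 4 sqrt n], which is at most [4 n]: the index stays in range. *)
have mn : (m <= 4 * n)%N.
  rewrite -(ler_nat R); have : m%:R * lat_h <= 1 by apply: le_trans x1.
  rewrite /lat_h ler_pdivrMr ?mulr_gt0 // mul1r => /le_trans; apply.
  rewrite natrM ler_pM2l // -{2}(sqr_sqrtr (ler0n R n)) expr2 ler_peMr ?sqrtr_ge0 //.
  by rewrite -[leLHS]sqrtr1 ler_sqrt // ler1n.
have m0 : 0 <= m%:R * lat_h by rewrite mulr_ge0 // ltW.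
rewrite -natr1 mulrDl mul1r in m2.
case: (lerP 0 x) => x0.
  have mlt : (4 * n + m < 4 * n + (4 * n).+1)%N by lia.
  exists (Ordinal mlt); rewrite /latv /= natrD addrAC subrr add0r.
  rewrite (ger0_norm x0) in m1 m2 *.
  by rewrite (ger0_norm m0) ger0_norm; [split|]; lra.
have mlt : (4 * n - m < 4 * n + (4 * n).+1)%N by lia.
exists (Ordinal mlt); rewrite /latv /= natrB // addrAC subrr add0r mulNr normrN.
rewrite opprK; rewrite ltr0_norm // in m1 m2 *.
rewrite ger0_norm //; split=> //; rewrite ler_norml; apply/andP; split; lra.
Qed.

Lemma nvec_round (u : 'cV[R]_n) : nsq u <= 1 ->
  exists z, nsq (nvec z) <= 1 /\ nsq (u - nvec z) <= 16^-1.
Proof.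
move=> u1; have hu i : exists k : lat, `|latv k| <= `|u i 0| /\ `|u i 0 - latv k| <= lat_h.
  apply: latv_round; apply: norm_le_sqr => //; rewrite expr1n.
  exact: le_trans (entry_nsq _ _ _) u1.
have [f hf] := choice hu; exists [ffun i => f i]; split.
  apply: le_trans u1; rewrite !nsq_cV; apply: ler_sum => i _; rewrite mxE ffunE.
  rewrite -[leLHS]real_normK ?num_real // -[leRHS]real_normK ?num_real //.
  by rewrite ler_sqr ?nnegrE //; case: (hf i).
have := @nsq_entry R n 1 lat_h (u - nvec [ffun i => f i]).
have := lat_h_sqr; move=> e h; apply: le_trans (h _) _.
  by move=> i j; rewrite ord1 !mxE ffunE; case: (hf i).
rewrite mulr1; lra.
Qed.

(** Rounding either argument leaves a vector of norm at most 1/4, so the supremum [s] of the form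
    satisfies [s <= c + s / 4 + s / 4]. The Frobenius bound makes [s] finite, which the absorption
    requires. *)
Lemma net_opb (X : 'M[R]_n) (c : R) : 0 <= c ->
  (forall z z', nsq (nvec z) <= 1 -> nsq (nvec z') <= 1 ->
     ip (nvec z) (X *m nvec z') <= c) -> opb (2 * c) X.
Proof.
move=> c0 hc.
pose S := [set x | exists u v : 'cV[R]_n, [/\ nsq u <= 1, nsq v <= 1 & x = ip u (X *m v)]].
have S_ub : ubound S (Num.sqrt (nsq X)).
  move=> _ [u [v [u1 v1 ->]]]; rewrite -[leRHS]mul1r; apply: ip_le_mul => //.
  - by rewrite expr1n.
  - rewrite sqr_sqrtr ?nsq_ge0 //; apply: le_trans (nsq_mulmx_le _ _) _.
    by rewrite ler_piMr ?nsq_ge0.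
have S_sup : has_sup S.
  split; last by exists (Num.sqrt (nsq X)).
  by exists 0, 0, 0; rewrite nsq0 mulmx0 ip0r.
have le_sup (u v : 'cV[R]_n) : nsq u <= 1 -> nsq v <= 1 -> ip u (X *m v) <= sup S.
  by move=> u1 v1; apply: ub_le_sup; [case: S_sup|exists u, v].
have scale (u v : 'cV[R]_n) : nsq u <= 16^-1 -> nsq v <= 1 -> ip u (X *m v) <= sup S / 4.
  move=> u1 v1; have := @le_sup (4 *: u) v; rewrite nsqZ ipZl => h.
  by have := h _ v1; rewrite -ler_pdivlMl //; lra.
have scale' (u v : 'cV[R]_n) : nsq u <= 1 -> nsq v <= 16^-1 -> ip u (X *m v) <= sup S / 4.
  move=> u1 v1; have := @le_sup u (4 *: v); rewrite nsqZ -scalemxAr ipZr => h.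
  by have := h u1; lra.
have : sup S <= c + sup S / 2.
  apply: ge_sup; first by case: S_sup.
  move=> _ [u [v [u1 v1 ->]]].
  have [z [z1 zu]] := nvec_round u1; have [z' [z1' zv]] := nvec_round v1.
  have -> : ip u (X *m v) = ip (nvec z) (X *m nvec z') + ip (u - nvec z) (X *m v)
     + ip (nvec z) (X *m (v - nvec z')).
    by rewrite mulmxBr ipDr ipNr ipDl ipNl; ring.
  by have := hc _ _ z1 z1'; have := scale _ _ zu v1; have := scale' _ _ z1 zv; lra.
move=> hS; apply: opb_bilinear => [|u v u1 v1]; first by rewrite mulr_ge0.
by apply: le_trans (le_sup u v u1 v1) _; lra.
Qed.

(** Generating-function count with weight [exp (- j^2)] at offset [j] from the origin: the ball is
    [sum j^2 <= 16 n], and one coordinate has total weight at most [4 <= exp 2]. *)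
Lemma card_ball : #|[pred z | nsq (nvec z) <= 1]|%:R <= expR (18 * n%:R : R).
Proof.
pose f (k : lat) : R := ((k : nat)%:R - (4 * n)%:R) ^+ 2.
have hA : \sum_k expR (- f k) <= expR 2.
  rewrite big_split_ord /=.
  apply: (@le_trans _ _ (2 + 2)).
    apply: lerD.
      rewrite (reindex_inj rev_ord_inj) /=; apply: le_trans (sum_half_pow (4 * n)).
      apply: ler_sum => j _; rewrite /f /=.
      have -> : ((4 * n - j.+1)%:R - (4 * n)%:R : R) = - (j.+1)%:R.
        by rewrite natrB // addrAC subrr add0r.
      rewrite sqrrN; apply: le_trans (expRN_sqr_le _) _.
      by rewrite exprS ler_piMl ?exprn_ge0 //; lra.
    apply: le_trans (sum_half_pow (4 * n).+1); apply: ler_sum => j _.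
    by rewrite /f /= natrD addrAC subrr add0r expRN_sqr_le.
  have -> : (2 : R) = 1 + 1 by ring.
  rewrite expRD; have h1 : 2 <= expR 1 :> R by have := expR_ge1Dx (1 : R); lra.
  by have := ler_pM _ _ h1 h1; lra.
have := card_exp_le 'I_n (16 * n%:R) hA.
rewrite card_ord (_ : 16 * n%:R + n%:R * 2 = 18 * n%:R :> R); last by ring.
apply: le_trans; rewrite ler_nat; apply: subset_leq_card; apply/fintype.subsetP => z.
rewrite !inE nsq_cV => h.
have -> : \sum_i f (z i) = 16 * n%:R * \sum_i nvec z i 0 ^+ 2.
  rewrite mulr_sumr; apply: eq_bigr => i _; rewrite mxE /latv exprMn.
  by rewrite mulrCA lat_h_sqr mulr1.
by rewrite -[leRHS]mulr1 ler_pM2l // mulr_gt0 // ltr0n.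
Qed.

(** Same count with weight [exp (- l)] for a nonzero coordinate; [l] is so large that the total
    weight of a coordinate is at most [1 + 1/n]. *)
Lemma card_support (s : nat) (l : R) : 0 <= l -> n%:R * (8 * n%:R + 1) <= expR l ->
  #|[pred z : {ffun 'I_n -> lat} | (#|[pred i | z i != lat0]| <= s)%N]|%:R
  <= expR (s%:R * l + 1).
Proof.
move=> l0 hl; pose f (k : lat) : R := if k == lat0 then 0 else l.
have n0 : 0 < (n%:R : R) by rewrite ltr0n.
have hA : \sum_k expR (- f k) <= expR (n%:R^-1).
  apply: le_trans (expR_ge1Dx _); rewrite (bigD1 lat0) //= /f eqxx oppr0 expR0 lerD2l.
  apply: (@le_trans _ _ (\sum_(k : lat) expR (- l))).
    rewrite [leRHS](bigD1 lat0) //= -[leLHS]add0r lerD ?expR_ge0 //.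
    by apply: ler_sum => k /negPf ->.
  rewrite sumr_const -(mulr_natl (expR _)) expRN ler_pdivrMr ?expR_gt0 //.
  rewrite ler_pdivlMl //; apply: le_trans hl; rewrite ler_pM2l //.
  have -> : #|{: lat}| = (4 * n + (4 * n).+1)%N by rewrite card_ord.
  by rewrite natrD -natr1 natrM; lra.
have := card_exp_le 'I_n (s%:R * l) hA.
rewrite card_ord divff ?gt_eqF //; apply: le_trans; rewrite ler_nat.
apply: subset_leq_card; apply/fintype.subsetP => z; rewrite !inE => h.
have -> : \sum_i f (z i) = #|[pred i | z i != lat0]|%:R * l.
  rewrite mulr_natl -sumr_const [RHS]big_mkcond; apply: eq_bigr => i _.
  by rewrite /f inE; case: eqP.
by rewrite ler_wpM2r // ler_nat.
Qed.

End lattice.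
End finite_product.

(** * Operator norm of a matrix with independent centred entries *)

Section concentration.
Context {R : realType}.
Variables (n : nat) (V : finType).
Implicit Types (q a : 'I_n -> 'I_n -> V -> R) (w : {ffun 'I_n -> {ffun 'I_n -> V}}).

(** A product of row weights that are themselves products: [mgf_quadratic] uses the independence of
    whole rows, then that of entries within a row. *)
Definition mxweight q w : R := pweight (fun i => pweight (q i)) w.
Definition smx a w : 'M[R]_n := \matrix_(i, j) a i j (w i j).

Definition mxT w : {ffun 'I_n -> {ffun 'I_n -> V}} := [ffun i => [ffun j => w j i]].

Lemma mxTK : involutive mxT.
Proof. by move=> w; apply/ffunP => i; apply/ffunP => j; rewrite !ffunE. Qed.

Lemma smxT a w : (smx a w)^T = smx (fun i j => a j i) (mxT w).
Proof. by apply/matrixP => i j; rewrite !mxE !ffunE. Qed.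

Lemma mxweightT q w : mxweight q w = mxweight (fun i j => q j i) (mxT w).
Proof.
rewrite /mxweight /pweight exchange_big; apply: eq_bigr => i _.
by apply: eq_bigr => j _; rewrite !ffunE.
Qed.

Section tails.
Variables (q a : 'I_n -> 'I_n -> V -> R) (s2 b : R).
Hypotheses (q_ge0 : forall i j v, 0 <= q i j v) (q_sum : forall i j, \sum_v q i j v = 1).
Hypotheses (a_mean : forall i j, \sum_v q i j v * a i j v = 0).
Hypotheses (a_var : forall i j, \sum_v q i j v * a i j v ^+ 2 <= s2).
Hypotheses (a_bound : forall i j v, `|a i j v| <= b) (b_ge0 : 0 <= b).

Let row_ge0 i r : 0 <= pweight (q i) r. Proof. exact: pweight_ge0. Qed.
Let row_sum i : \sum_r pweight (q i) r = 1. Proof. exact: pweight_sum. Qed.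

Lemma mxweight_ge0 w : 0 <= mxweight q w.
Proof. exact: pweight_ge0. Qed.

Lemma mxweight_le (P Q : pred {ffun 'I_n -> {ffun 'I_n -> V}}) : (forall w, P w -> Q w) ->
  \sum_(w | P w) mxweight q w <= \sum_(w | Q w) mxweight q w.
Proof.
move=> PQ; rewrite big_mkcond [leRHS]big_mkcond; apply: ler_sum => w _.
case: ifP => [/PQ->//|_]; case: ifP => _ //; exact: mxweight_ge0.
Qed.

Lemma mgf_bilinear (u v : 'cV[R]_n) (l bu bv : R) :
  (forall i, `|u i 0| <= bu) -> (forall i, `|v i 0| <= bv) -> 0 <= l ->
  l * bu * bv * b <= 1 -> nsq u <= 1 -> nsq v <= 1 -> 0 <= s2 ->
  \sum_w mxweight q w * expR (l * ip u (smx a w *m v)) <= expR (2 * l ^+ 2 * s2).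
Proof.
move=> hu hv l0 hl u1 v1 s0.
pose g i (r : {ffun 'I_n -> V}) := \sum_j l * u i 0 * v j 0 * a i j (r j).
have e w : l * ip u (smx a w *m v) = \sum_i g i (w i).
  rewrite ipE mulr_sumr; apply: eq_bigr => i _; rewrite big_ord1 mxE !mulr_sumr.
  by apply: eq_bigr => j _; rewrite mxE; ring.
under eq_bigr do rewrite e expR_sum.
rewrite (expect_prod _ (fun i r => expR (g i r))).
apply: (@le_trans _ _ (\prod_i expR (2 * \sum_j (l ^+ 2 * u i 0 ^+ 2 * v j 0 ^+ 2 * s2)))).
  apply: ler_prod => i _; rewrite sumr_ge0 /=; last first.
    by move=> r _; rewrite mulr_ge0 ?expR_ge0.
  apply: (mgf_sum (q_ge0 i) (q_sum i) (c := fun j x => l * u i 0 * v j 0 * a i j x)).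
  - move=> j x; rewrite !normrM (ger0_norm l0); apply: le_trans hl.
    have bu0 : 0 <= bu := le_trans (normr_ge0 _) (hu i).
    have bv0 : 0 <= bv := le_trans (normr_ge0 _) (hv j).
    apply: ler_pM => //; rewrite ?mulr_ge0 //.
    by apply: ler_pM => //; rewrite ?mulr_ge0 // ler_wpM2l.
  - move=> j; transitivity (l * u i 0 * v j 0 * \sum_x q i j x * a i j x).
      by rewrite mulr_sumr; apply: eq_bigr => x _; ring.
    by rewrite a_mean mulr0.
  - move=> j; apply: le_trans (_ : l ^+ 2 * u i 0 ^+ 2 * v j 0 ^+ 2 *
       \sum_x q i j x * a i j x ^+ 2 <= _).
      rewrite le_eqVlt; apply/orP; left; apply/eqP.
      by rewrite mulr_sumr; apply: eq_bigr => x _; ring.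
    have p : 0 <= l ^+ 2 * u i 0 ^+ 2 * v j 0 ^+ 2.
      by apply: mulr_ge0; [apply: mulr_ge0|]; apply: sqr_ge0.
    by rewrite ler_wpM2l ?a_var.
rewrite -expR_sum ler_expR.
have -> : \sum_i 2 * \sum_j l ^+ 2 * u i 0 ^+ 2 * v j 0 ^+ 2 * s2
   = 2 * l ^+ 2 * s2 * (nsq u * nsq v).
  rewrite !nsq_cV mulr_suml mulr_sumr; apply: eq_bigr => i _.
  by rewrite mulr_sumr mulr_sumr mulr_sumr; apply: eq_bigr => j _; ring.
rewrite -[leRHS]mulr1; apply: ler_wpM2l; first by rewrite !mulr_ge0 ?sqr_ge0.
by rewrite -[leRHS]mulr1; apply: ler_pM; rewrite ?nsq_ge0.
Qed.

(** The squares of the coordinates of [A v] are independent with mean at most [s2]; as [l] times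
    each is at most 1, [exp x <= 1 + 3 x] applies row by row. *)
Lemma mgf_quadratic (v : 'cV[R]_n) (l : R) : 0 <= l -> nsq v <= 1 -> 0 <= s2 ->
  (forall i (r : {ffun 'I_n -> V}), l * (\sum_j a i j (r j) * v j 0) ^+ 2 <= 1) ->
  \sum_w mxweight q w * expR (l * nsq (smx a w *m v)) <= expR (3 * l * s2 * n%:R).
Proof.
move=> l0 v1 s0 hl.
pose g i (r : {ffun 'I_n -> V}) := l * (\sum_j a i j (r j) * v j 0) ^+ 2.
have e w : l * nsq (smx a w *m v) = \sum_i g i (w i).
  rewrite nsq_cV mulr_sumr; apply: eq_bigr => i _; rewrite /g mxE.
  by congr (_ * _ ^+ 2); apply: eq_bigr => j _; rewrite mxE.
under eq_bigr do rewrite e expR_sum.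
rewrite (expect_prod _ (fun i r => expR (g i r))).
apply: (@le_trans _ _ (\prod_(i < n) expR (3 * l * s2))); last first.
  by rewrite prodr_const card_ord -expRM_natl mulrC.
apply: ler_prod => i _; rewrite sumr_ge0 /=; last first.
  by move=> r _; rewrite mulr_ge0 ?expR_ge0.
apply: le_trans (expR_ge1Dx _).
apply: (@le_trans _ _ (\sum_r (pweight (q i) r + 3 * l * (pweight (q i) r *
    (\sum_j a i j (r j) * v j 0) ^+ 2)))).
  apply: ler_sum => r _; have g0 : 0 <= g i r by rewrite mulr_ge0 ?sqr_ge0.
  have g1 : g i r <= 1 := hl i r.
  have h : expR (g i r) <= 1 + 3 * g i r.
    apply: le_trans (expR_le_quadratic _) _; first by rewrite ger0_norm.
    have : g i r * g i r <= g i r by rewrite ler_piMr.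
    by rewrite expr2; lra.
  by have := ler_wpM2l (row_ge0 i r) h; rewrite /g; lra.
rewrite big_split /= row_sum -mulr_sumr lerD2l ler_wpM2l ?mulr_ge0 //.
rewrite (expect_sqr_sum (q_sum i) (b := fun j x => a i j x * v j 0)).
  apply: (@le_trans _ _ (\sum_j s2 * v j 0 ^+ 2)).
    apply: ler_sum => j _.
    have -> : \sum_x q i j x * (a i j x * v j 0) ^+ 2
        = (\sum_x q i j x * a i j x ^+ 2) * v j 0 ^+ 2.
      by rewrite mulr_suml; apply: eq_bigr => x _; ring.
    by rewrite ler_wpM2r ?sqr_ge0.
  by rewrite -mulr_sumr -nsq_cV -[leRHS]mulr1 ler_wpM2l.
move=> j; transitivity ((\sum_x q i j x * a i j x) * v j 0).
  by rewrite mulr_suml; apply: eq_bigr => x _; ring.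
by rewrite a_mean mul0r.
Qed.

Lemma bilinear_tail (S1 S2 : pred {ffun 'I_n -> 'I_(4 * n + (4 * n).+1)%N})
    (l c b1 b2 N1 N2 : R) : 0 < l -> 0 <= s2 ->
  (forall z, S1 z -> nsq (nvec z : 'cV[R]_n) <= 1 /\ forall i, `|(nvec z : 'cV[R]_n) i 0| <= b1) ->
  (forall z, S2 z -> nsq (nvec z : 'cV[R]_n) <= 1 /\ forall i, `|(nvec z : 'cV[R]_n) i 0| <= b2) ->
  l * b1 * b2 * b <= 1 -> #|S1|%:R <= N1 -> #|S2|%:R <= N2 ->
  \sum_(w | [exists z, S1 z && [exists z', S2 z' && (c < ip (nvec z) (smx a w *m nvec z'))]])
     mxweight q w <= N1 * (N2 * expR (2 * l ^+ 2 * s2 - l * c)).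
Proof.
move=> l0 s0 h1 h2 hl c1 c2.
have e0 : 0 <= N2 * expR (2 * l ^+ 2 * s2 - l * c).
  by rewrite mulr_ge0 ?expR_ge0 // (le_trans _ c2).
apply: (union_bound row_ge0 _ e0 c1
   (bad := fun z w => [exists z', S2 z' && (c < ip (nvec z) (smx a w *m nvec z'))])) => z Sz.
apply: (union_bound row_ge0 _ (expR_ge0 _) c2
   (bad := fun z' w => c < ip (nvec z) (smx a w *m nvec z'))) => z' Sz'.
have [z1 zb] := h1 _ Sz; have [z1' zb'] := h2 _ Sz'.
have := markov_exp row_ge0 (l * c) (mgf_bilinear zb zb' (ltW l0) hl z1 z1' s0).
apply: le_trans; apply: mxweight_le => w h.
by rewrite ler_pM2l // ltW.
Qed.

Lemma quadratic_tail (S : pred {ffun 'I_n -> 'I_(4 * n + (4 * n).+1)%N}) (l c N : R) :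
  0 < l -> 0 <= s2 ->
  (forall z, S z -> nsq (nvec z : 'cV[R]_n) <= 1 /\ forall i (r : {ffun 'I_n -> V}),
     l * (\sum_j a i j (r j) * (nvec z : 'cV[R]_n) j 0) ^+ 2 <= 1) -> #|S|%:R <= N ->
  \sum_(w | [exists z, S z && (c < nsq (smx a w *m nvec z))]) mxweight q w
    <= N * expR (3 * l * s2 * n%:R - l * c).
Proof.
move=> l0 s0 h cN.
apply: (union_bound row_ge0 _ (expR_ge0 _) cN
   (bad := fun z w => c < nsq (smx a w *m nvec z))) => z Sz.
have [z1 zb] := h _ Sz.
have := markov_exp row_ge0 (l * c) (mgf_quadratic (ltW l0) z1 s0 zb).
apply: le_trans; apply: mxweight_le => w hw.
by rewrite ler_pM2l // ltW.
Qed.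

End tails.

Local Notation lat := 'I_(4 * n + (4 * n).+1)%N.
Local Notation nvc z := (nvec z : 'cV[R]_n).

Definition zrestrict (P : pred lat) (z : {ffun 'I_n -> lat}) : {ffun 'I_n -> lat} :=
  [ffun i => if P (z i) then z i else lat0 n].

Lemma nvec_restrict P z i :
  nvc (zrestrict P z) i 0 = if P (z i) then latv (z i) else 0.
Proof. by rewrite mxE ffunE; case: ifP => // _; rewrite latv0. Qed.

Lemma nvec_split P Q z : (forall k, P k = ~~ Q k) ->
  nvc z = nvc (zrestrict P z) + nvc (zrestrict Q z).
Proof.
move=> PQ; apply/colP => i; rewrite [RHS]mxE !nvec_restrict mxE PQ.
by case: (Q _); rewrite ?add0r ?addr0.
Qed.

Lemma nsq_nvec_restrict P z : nsq (nvc (zrestrict P z)) <= nsq (nvc z).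
Proof.
rewrite !nsq_cV; apply: ler_sum => i _; rewrite nvec_restrict [nvec z _ _]mxE.
by case: ifP => // _; rewrite expr0n sqr_ge0.
Qed.

(** A vector of the unit ball has at most [b^2] coordinates above [1 / b]. *)
Lemma card_restrict (P : pred lat) z (b : R) (s : nat) : 0 < b ->
  (forall k, P k -> b^-1 < `|latv k : R|) -> nsq (nvc z) <= 1 -> b ^+ 2 <= s%:R ->
  (#|[pred i | zrestrict P z i != lat0 n]| <= s)%N.
Proof.
move=> b0 hP z1 bs; rewrite -(ler_nat R); apply: le_trans bs.
rewrite -[leRHS]mul1r -ler_pdivrMr ?exprn_gt0 //.
apply: le_trans z1; apply: le_trans (nsq_nvec_restrict P z); rewrite nsq_cV.
rewrite mulr_natl -sumr_const big_mkcond; apply: ler_sum => i _.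
rewrite unfold_in /= ffunE nvec_restrict.
case: (boolP (P (z i))) => [/hP h|_]; last by rewrite eqxx expr0n.
case: ifP => _; last by rewrite sqr_ge0.
rewrite -exprVn -[leRHS]real_normK ?num_real // ler_sqr ?nnegrE ?invr_ge0 //; exact: ltW.
Qed.

(* The entries are bounded by [t], of order [n ^ (1/20)]; the powers of [t] used
   to split test vectors by the size of their coordinates leave room for the
   Bernstein bounds at every scale. *)
Section opnorm.
Variables (s2 : R) (t : nat).
Hypotheses (s2_ge0 : 0 <= s2) (t_gt0 : (0 < t)%N).
Hypotheses (t_le : (t ^ 20 <= n)%N) (le_t : (n <= (2 * t) ^ 20)%N).

(** [2^10] compensates the choice [l = r / 2^10] in [eMS]; 200 exceeds the entropy constants
    [2 * 84 + 2 + 1] of [eM], and [3 * s2] the variance terms. *)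
Definition opnorm_const : R := 2 ^+ 10 * (200 + 3 * s2).
Local Notation C := opnorm_const.
Local Notation r := (Num.sqrt (n%:R : R)).
Local Notation T := (t%:R : R).

Let n_gt0 : (0 < n)%N.
Proof. by apply: leq_trans t_le; rewrite expn_gt0 t_gt0. Qed.
Let T_ge1 : 1 <= T. Proof. by rewrite ler1n. Qed.
Let T_gt0 : 0 < T. Proof. by rewrite ltr0n. Qed.
Let r_sqr : r ^+ 2 = n%:R. Proof. by rewrite sqr_sqrtr. Qed.
Let Tn : T ^+ 20 <= n%:R. Proof. by rewrite -natrX ler_nat. Qed.
Let nT : n%:R <= 2 ^+ 20 * T ^+ 20.
Proof.
by rewrite -exprMn -natrM -natrX ler_nat.
Qed.
Let Tr : T ^+ 10 <= r.
Proof. by rewrite -ler_sqr ?nnegrE ?exprn_ge0 // r_sqr -exprM. Qed.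
Let rT : r <= 2 ^+ 10 * T ^+ 10.
Proof.
have p : 0 <= 2 ^+ 10 * T ^+ 10 by apply: mulr_ge0; apply: exprn_ge0.
by rewrite -ler_sqr ?nnegrE // r_sqr exprMn -!exprM.
Qed.

Let C_ge : 200 + 3 * s2 <= C.
Proof. by rewrite /C ler_peMl ?exprn_ege1 ?ler1n //; have := s2_ge0; lra. Qed.

Let Tpow_le i j : (i <= j)%N -> T ^+ i <= T ^+ j.
Proof. by move=> ij; apply: ler_weXn2l. Qed.

Let Tpow_ge1 i : 1 <= T ^+ i.
Proof. exact: exprn_ege1. Qed.

(** [84 = 4 + 40 + 40], from [9 <= exp (4 T)] and [n <= 2^20 T^20 <= exp (40 T)]. *)
Let count_bound : n%:R * (8 * n%:R + 1) <= expR (84 * T).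
Proof.
have e1 : 2 <= expR 1 :> R by have := expR_ge1Dx (1 : R); lra.
have eT : T <= expR T by have := expR_ge1Dx T; lra.
have e40 : n%:R <= expR (40 * T).
  apply: le_trans nT _; have -> : 40 * T = 20%:R * T + 20%:R * T by ring.
  rewrite expRD; apply: ler_pM; [exact: exprn_ge0|exact: exprn_ge0| |].
    rewrite expRM_natl.
    rewrite lerXn2r ?nnegrE ?expR_ge0 //; apply: le_trans e1 _.
    by rewrite ler_expR.
  by rewrite expRM_natl lerXn2r ?nnegrE ?expR_ge0.
have e4 : 9 <= expR (4 * T).
  apply: (@le_trans _ _ (2 ^+ 4)); first by lra.
  rewrite expRM_natl lerXn2r ?nnegrE ?expR_ge0 //.
  by apply: le_trans e1 _; rewrite ler_expR.
have n1 : 1 <= n%:R :> R by rewrite ler1n.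
apply: (@le_trans _ _ (9 * (n%:R * n%:R))); first by nra.
have -> : 84 * T = 4 * T + (40 * T + 40 * T) by ring.
rewrite !expRD; apply: ler_pM; rewrite ?mulr_ge0 //.
by apply: ler_pM.
Qed.

(** The support sizes [t^8] and [t^16] are the inverse squares of the thresholds [T^-4] and [T^-8].
    Class [pM] is both sparse and spread out; [pMS] and [pS] are spread out at the two levels,
    without sparsity. *)
Let pB (z : {ffun 'I_n -> lat}) :=
  (nsq (nvc z) <= 1) && (#|[pred i | z i != lat0 n]| <= t ^ 8)%N.
Let pM (z : {ffun 'I_n -> lat}) := [&& nsq (nvc z) <= 1,
  (#|[pred i | z i != lat0 n]| <= t ^ 16)%N & [forall i, `|nvc z i 0| <= (T ^+ 4)^-1]].
Let pMS (z : {ffun 'I_n -> lat}) :=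
  (nsq (nvc z) <= 1) && [forall i, `|nvc z i 0| <= (T ^+ 4)^-1].
Let pS (z : {ffun 'I_n -> lat}) :=
  (nsq (nvc z) <= 1) && [forall i, `|nvc z i 0| <= (T ^+ 8)^-1].

Let T84_ge0 : 0 <= 84 * T. Proof. by rewrite mulr_ge0. Qed.

Let card_pB : #|pB|%:R <= expR ((t ^ 8)%:R * (84 * T) + 1).
Proof.
apply: le_trans (card_support n_gt0 _ T84_ge0 count_bound); rewrite ler_nat.
by apply: subset_leq_card; apply/fintype.subsetP => z; rewrite !inE => /andP[].
Qed.

Let card_pM : #|pM|%:R <= expR ((t ^ 16)%:R * (84 * T) + 1).
Proof.
apply: le_trans (card_support n_gt0 _ T84_ge0 count_bound); rewrite ler_nat.
by apply: subset_leq_card; apply/fintype.subsetP => z; rewrite !inE => /and3P[].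
Qed.

Let card_pMS : #|pMS|%:R <= expR (18 * n%:R : R).
Proof.
apply: le_trans (card_ball n_gt0); rewrite ler_nat.
by apply: subset_leq_card; apply/fintype.subsetP => z; rewrite !inE => /andP[].
Qed.

Let card_pS : #|pS|%:R <= expR (18 * n%:R : R).
Proof.
apply: le_trans (card_ball n_gt0); rewrite ler_nat.
by apply: subset_leq_card; apply/fintype.subsetP => z; rewrite !inE => /andP[].
Qed.

Let big (k : lat) := (T ^+ 4)^-1 < `|latv k : R|.
Let small (k : lat) := `|latv k : R| <= (T ^+ 8)^-1.

(* The big coordinates are sparse, the small ones spread out; the remaining
   ones are both. *)
Lemma net_split_opb (X : 'M[R]_n) :
  (forall z, pB z -> nsq (X *m nvc z) <= C ^+ 2 * n%:R) ->
  (forall z, pB z -> nsq (X^T *m nvc z) <= C ^+ 2 * n%:R) ->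
  (forall z z', pM z -> pM z' -> ip (nvc z) (X *m nvc z') <= C * r) ->
  (forall z z', pMS z -> pS z' -> ip (nvc z) (X *m nvc z') <= C * r) ->
  (forall z z', pS z -> pMS z' -> ip (nvc z) (X *m nvc z') <= C * r) ->
  opb (10 * C * r) X.
Proof.
move=> hB hBT hM hMS hSM.
have C0 : 0 <= C by apply: le_trans C_ge; have := s2_ge0; lra.
have Cr0 : 0 <= C * r by rewrite mulr_ge0.
have -> : 10 * C * r = 2 * (5 * (C * r)) by ring.
have ball_restrict P z : nsq (nvc z) <= 1 -> nsq (nvc (zrestrict P z)) <= 1.
  exact/le_trans/nsq_nvec_restrict.
have inB z : nsq (nvc z) <= 1 -> pB (zrestrict big z).
  move=> z1; rewrite /pB ball_restrict //=.
  by apply: (@card_restrict _ _ (T ^+ 4)) => //; rewrite ?exprn_gt0 ?natrX -?exprM.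
have inMS z : nsq (nvc z) <= 1 -> pMS (zrestrict (predC big) z).
  move=> z1; rewrite /pMS ball_restrict //=; apply/forallP => i.
  rewrite nvec_restrict; case: ifP => [|_]; first by rewrite /= -leNgt.
  by rewrite normr0 invr_ge0 exprn_ge0.
have inS z : nsq (nvc z) <= 1 -> pS (zrestrict small (zrestrict (predC big) z)).
  move=> z1; rewrite /pS !ball_restrict //=; apply/forallP => i.
  rewrite nvec_restrict; case: ifP => // _.
  by rewrite normr0 invr_ge0 exprn_ge0.
have inM z : nsq (nvc z) <= 1 -> pM (zrestrict (predC small) (zrestrict (predC big) z)).
  move=> z1; rewrite /pM !ball_restrict //=; apply/andP; split.
    apply: (@card_restrict _ _ (T ^+ 8)); rewrite ?exprn_gt0 //.
    - by move=> k /=; rewrite -ltNge.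
    - exact: ball_restrict.
    - by rewrite natrX -exprM.
  apply/forallP => i; rewrite nvec_restrict ffunE /=.
  case: ifP => [_|_]; last by rewrite normr0 invr_ge0 exprn_ge0.
  case: ifP => [|_]; first by rewrite -leNgt.
  by rewrite latv0 normr0 invr_ge0 exprn_ge0.
have MS_of_M z : pM z -> pMS z by move=> /and3P[h1 _ h2]; apply/andP.
apply: net_opb => // [|z z' z1 z1']; first by rewrite mulr_ge0.
set B := nvc (zrestrict big z); set N := nvc (zrestrict (predC big) z).
set B' := nvc (zrestrict big z'); set N' := nvc (zrestrict (predC big) z').
have ez : nvc z = B + N by apply: nvec_split => k; rewrite /= negbK.
have ez' : nvc z' = B' + N' by apply: nvec_split => k; rewrite /= negbK.
set S := nvc (zrestrict small (zrestrict (predC big) z)).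
set M := nvc (zrestrict (predC small) (zrestrict (predC big) z)).
set S' := nvc (zrestrict small (zrestrict (predC big) z')).
set M' := nvc (zrestrict (predC small) (zrestrict (predC big) z')).
have eN : N = S + M by apply: nvec_split => k; rewrite /= negbK.
have eN' : N' = S' + M' by apply: nvec_split => k; rewrite /= negbK.
have Crsq : (C * r) ^+ 2 = C ^+ 2 * n%:R by rewrite exprMn r_sqr.
have b1 : ip B (X *m nvc z') <= C * r.
  rewrite -[C * r]mulr1 -[X]trmxK -ip_mull; apply: ip_le_mul => //.
    by rewrite Crsq hBT // inB.
  by rewrite expr1n.
have b2 : ip N (X *m B') <= C * r.
  rewrite -[C * r]mul1r; apply: ip_le_mul => //.
    by rewrite expr1n ball_restrict.
  by rewrite Crsq hB // inB.
have b3 := hMS _ _ (inMS z z1) (inS z' z1').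
have b4 := hM _ _ (inM z z1) (inM z' z1').
have b5 := hSM _ _ (inS z z1) (MS_of_M _ (inM z' z1')).
(* Big coordinates meet the whole other vector, through the norm of [X] or [X^T] on sparse vectors.
   In what remains, medium against medium is kept apart, and every other pair has a small side. Five
   pieces, doubled by [net_opb], give the factor 10. *)
have -> : ip (nvc z) (X *m nvc z') = ip B (X *m nvc z') + ip N (X *m B')
    + (ip N (X *m S') + (ip M (X *m M') + ip S (X *m M'))).
  rewrite {1}ez ipDl -addrA; congr (_ + _); rewrite ez' mulmxDr ipDr; congr (_ + _).
  by rewrite {1}eN' mulmxDr ipDr; congr (_ + _); rewrite eN ipDl addrC.
rewrite -/N -/N' -/S -/M -/S' -/M' in b3 b4 b5 *.
by lra.
Qed.

Let exp_nT : T <= n%:R.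
Proof. by apply: le_trans Tn; rewrite -{1}[T]expr1 Tpow_le. Qed.

(** With [l = r / 2^10 <= T^10], [l * T^-4 * T^-8 * T <= 1]; the gain [(200 + 3 s2) n] pays for the
    entropy [18 n] of each side. *)
Let eMS : expR (18 * n%:R) * (expR (18 * n%:R) *
  expR (2 * (r / 2 ^+ 10) ^+ 2 * s2 - r / 2 ^+ 10 * (C * r))) <= expR (- T).
Proof.
rewrite -!expRD ler_expR.
have -> : r / 2 ^+ 10 * (C * r) = (200 + 3 * s2) * n%:R.
  by have := r_sqr; move: (Num.sqrt _) => x <-; rewrite /C; field.
rewrite exprMn r_sqr; have := exp_nT; have := s2_ge0; have := ler0n R n.
have h : (2 ^+ 10)^-1 ^+ 2 <= 1 :> R by rewrite exprVn invf_le1 ?exprn_gt0 // !exprn_ege1 ?ler1n.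
have : s2 * n%:R * (2 ^+ 10)^-1 ^+ 2 <= s2 * n%:R by rewrite ler_piMr ?mulr_ge0.
move: ((2 ^+ 10)^-1 ^+ 2) h => y _.
have : 0 <= s2 * n%:R by rewrite mulr_ge0.
by lra.
Qed.

(** [l = T^7] is the largest value with [l * T^-4 * T^-4 * T <= 1]; its gain, of order [T^17],
    matches the entropy [84 T^17] of vectors with [T^16] nonzero coordinates. *)
Let eM : expR ((t ^ 16)%:R * (84 * T) + 1) * (expR ((t ^ 16)%:R * (84 * T) + 1) *
  expR (2 * (T ^+ 7) ^+ 2 * s2 - T ^+ 7 * (C * r))) <= expR (- T).
Proof.
rewrite -!expRD ler_expR natrX -exprM.
have -> : T ^+ 16 * (84 * T) = 84 * T ^+ 17 by rewrite (exprSr T 16); ring.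
have h1 : T ^+ 14 * s2 <= T ^+ 17 * s2 by rewrite ler_wpM2r // Tpow_le.
have h2 : T <= T ^+ 17 by rewrite -{1}[T]expr1 Tpow_le.
have h3 := Tpow_ge1 17.
have h4 : (200 + 3 * s2) * T ^+ 17 <= T ^+ 7 * (C * r).
  have -> : T ^+ 7 * (C * r) = C * (T ^+ 7 * r) by ring.
  apply: ler_pM; rewrite ?exprn_ge0 //; first by have := s2_ge0; lra.
  by rewrite (exprD T 7 10) ler_wpM2l ?exprn_ge0.
have -> : (7 * 2)%N = 14%N by [].
have : 0 <= s2 * T ^+ 17 by rewrite mulr_ge0 ?exprn_ge0.
by move: h1 h2 h3 h4; move: (T ^+ 17) (T ^+ 14) (T ^+ 7 * _) => x y z; lra.
Qed.

(** Here [l = T^-10] and the gain is at least [200 T^10], against an entropy of order [T^9]. *)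
Let eB : expR ((t ^ 8)%:R * (84 * T) + 1) *
  expR (3 * (T ^+ 10)^-1 * s2 * n%:R - (T ^+ 10)^-1 * (C ^+ 2 * n%:R)) <= expR (- T).
Proof.
rewrite -!expRD ler_expR natrX.
have -> : T ^+ 8 * (84 * T) = 84 * T ^+ 9 by rewrite (exprSr T 8); ring.
have h1 : T ^+ 9 <= T ^+ 10 by apply: Tpow_le.
have h2 : T <= T ^+ 10 by rewrite -{1}[T]expr1 Tpow_le.
have h3 := Tpow_ge1 10.
have h4 : T ^+ 10 <= (T ^+ 10)^-1 * n%:R.
  by rewrite ler_pdivlMl ?exprn_gt0 // -exprD.
have h5 : 200 <= C ^+ 2 - 3 * s2.
  have : C <= C ^+ 2 by rewrite expr2 ler_peMr //; have := C_ge; have := s2_ge0; lra.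
  by have := C_ge; lra.
have h6 : 200 * T ^+ 10 <= (C ^+ 2 - 3 * s2) * ((T ^+ 10)^-1 * n%:R).
  by apply: ler_pM; rewrite ?exprn_ge0.
have -> : 3 * (T ^+ 10)^-1 * s2 * n%:R - (T ^+ 10)^-1 * (C ^+ 2 * n%:R)
  = - ((C ^+ 2 - 3 * s2) * ((T ^+ 10)^-1 * n%:R)) by ring.
move: h6; move: ((C ^+ 2 - 3 * s2) * _) => y h6.
by move: h1 h2 h3 h6; move: (T ^+ 10) (T ^+ 9) => x z; lra.
Qed.


Section tail.
Variables (q a : 'I_n -> 'I_n -> V -> R).
Hypotheses (q_ge0 : forall i j v, 0 <= q i j v) (q_sum : forall i j, \sum_v q i j v = 1).
Hypotheses (a_mean : forall i j, \sum_v q i j v * a i j v = 0).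
Hypotheses (a_var : forall i j, \sum_v q i j v * a i j v ^+ 2 <= s2).
Hypotheses (a_bound : forall i j v, `|a i j v| <= T).

(** Cauchy-Schwarz on the support: at most [T^8] entries of size at most [T]. *)
Let pB_quadratic (b : 'I_n -> 'I_n -> V -> R) : (forall i j v, `|b i j v| <= T) ->
  forall z, pB z -> nsq (nvc z) <= 1 /\ forall i (w : {ffun 'I_n -> V}),
     (T ^+ 10)^-1 * (\sum_j b i j (w j) * nvc z j 0) ^+ 2 <= 1.
Proof.
move=> b_bound z /andP[z1 zs]; split=> // i w.
rewrite ler_pdivrMl ?exprn_gt0 // mulr1.
pose x : 'cV[R]_n := \col_j (if z j != lat0 n then b i j (w j) else 0).
have -> : \sum_j b i j (w j) * nvc z j 0 = ip x (nvc z).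
  rewrite ipE; apply: eq_bigr => j _; rewrite big_ord1 !mxE.
  by case: eqP => //= ->; rewrite latv0 mulr0 mul0r.
apply: le_trans (ip_sqr_le _ _) _; rewrite -[leRHS]mulr1.
apply: ler_pM; rewrite ?nsq_ge0 // nsq_cV.
apply: (@le_trans _ _ (#|[pred i | z i != lat0 n]|%:R * T ^+ 2)).
  rewrite mulr_natl -sumr_const [leRHS]big_mkcond; apply: ler_sum => j _.
  rewrite unfold_in /= mxE; case: ifP => _; last by rewrite expr0n.
  by rewrite -[leLHS]real_normK ?num_real // ler_sqr ?nnegrE.
by rewrite (exprD T 8 2) ler_wpM2r ?exprn_ge0 // -natrX ler_nat.
Qed.

Lemma opnorm_tail : \sum_(w | ~~ `[< opb (10 * C * r) (smx a w) >]) mxweight q w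
  <= 5 * expR (- T).
Proof.
have T10 : 0 < (T ^+ 10)^-1 by rewrite invr_gt0 exprn_gt0.
have r0 : 0 < r by rewrite sqrtr_gt0 ltr0n.
have h1 := quadratic_tail q_ge0 q_sum a_mean a_var (C ^+ 2 * n%:R) T10 s2_ge0
  (pB_quadratic a_bound) card_pB.
have h1' := quadratic_tail (q := fun i j => q j i) (a := fun i j => a j i)
  (fun i j => q_ge0 j i) (fun i j => q_sum j i)
  (fun i j => a_mean j i) (fun i j => a_var j i) (C ^+ 2 * n%:R) T10 s2_ge0
  (pB_quadratic (fun i j => a_bound j i)) card_pB.
have pM_ball z : pM z -> nsq (nvc z) <= 1 /\ forall i, `|nvc z i 0| <= (T ^+ 4)^-1.
  by move=> /and3P[? _ /forallP].
have pMS_ball z : pMS z -> nsq (nvc z) <= 1 /\ forall i, `|nvc z i 0| <= (T ^+ 4)^-1.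
  by move=> /andP[? /forallP].
have pS_ball z : pS z -> nsq (nvc z) <= 1 /\ forall i, `|nvc z i 0| <= (T ^+ 8)^-1.
  by move=> /andP[? /forallP].
have T7 : 0 < T ^+ 7 by rewrite exprn_gt0.
have T7b : T ^+ 7 * (T ^+ 4)^-1 * (T ^+ 4)^-1 * T <= 1.
  have -> : T ^+ 7 * (T ^+ 4)^-1 * (T ^+ 4)^-1 * T = 1 by field; rewrite gt_eqF.
  exact: lexx.
have h2 := bilinear_tail q_ge0 q_sum a_mean a_var a_bound (C * r) T7 s2_ge0
  pM_ball pM_ball T7b card_pM card_pM.
have rK : 0 < r / 2 ^+ 10 by rewrite divr_gt0 ?exprn_gt0.
have T11 : T ^+ 10 * T <= T ^+ 12 by rewrite -exprSr Tpow_le.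
have rKT : r / 2 ^+ 10 * T <= T ^+ 12.
  apply: le_trans T11; rewrite ler_wpM2r // ler_pdivrMr ?exprn_gt0 // mulrC.
  exact: rT.
have rKb : r / 2 ^+ 10 * (T ^+ 4)^-1 * (T ^+ 8)^-1 * T <= 1.
  have -> : r / 2 ^+ 10 * (T ^+ 4)^-1 * (T ^+ 8)^-1 * T = (r / 2 ^+ 10 * T) / T ^+ 12.
    by move: (r / 2 ^+ 10) => x; field; rewrite gt_eqF.
  by rewrite ler_pdivrMr ?exprn_gt0 // mul1r.
have rKb' : r / 2 ^+ 10 * (T ^+ 8)^-1 * (T ^+ 4)^-1 * T <= 1 by rewrite (mulrAC (r / _)).
have h3 := bilinear_tail q_ge0 q_sum a_mean a_var a_bound (C * r) rK s2_ge0
  pMS_ball pS_ball rKb card_pMS card_pS.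
have h3' := bilinear_tail q_ge0 q_sum a_mean a_var a_bound (C * r) rK s2_ge0
  pS_ball pMS_ball rKb' card_pS card_pMS.
have {}h1 := le_trans h1 eB; have {}h1' := le_trans h1' eB.
have {}h2 := le_trans h2 eM; have {}h3 := le_trans h3 eMS; have {}h3' := le_trans h3' eMS.
(* [h1'] is the quadratic bound for the transposed array; transposing the sample points restates it
   under the original weight. *)
rewrite (reindex_inj (inv_inj mxTK)) /= in h1'.
rewrite (eq_bigr (mxweight q)) in h1'; last first.
  by move=> w _; rewrite (mxweightT q).
pose F1 w := [exists z, pB z && (C ^+ 2 * n%:R < nsq (smx a w *m nvc z))].
pose F1' w := [exists z, pB z && (C ^+ 2 * n%:R < nsq (smx (fun i j => a j i) (mxT w) *m nvc z))].
pose F2 w := [exists z, pM z && [exists z', pM z' && (C * r < ip (nvc z) (smx a w *m nvc z'))]].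
pose F3 w := [exists z, pMS z && [exists z', pS z' && (C * r < ip (nvc z) (smx a w *m nvc z'))]].
pose F3' w := [exists z, pS z && [exists z', pMS z' && (C * r < ip (nvc z) (smx a w *m nvc z'))]].
pose sumF (F : pred {ffun 'I_n -> {ffun 'I_n -> V}}) := \sum_(w | F w) mxweight q w.
have sumU (F G : pred {ffun 'I_n -> {ffun 'I_n -> V}}) : sumF (predU F G) <= sumF F + sumF G.
  rewrite /sumF big_mkcond [in leRHS]big_mkcond /= [X in _ + X]big_mkcond -big_split /=.
  apply: ler_sum => w _; have w0 := mxweight_ge0 q_ge0 w.
  by case: (F w); case: (G w); rewrite /= ?addr0 ?add0r // lerDl.
apply: (@le_trans _ _ (sumF (predU F1 (predU F1' (predU F2 (predU F3 F3')))))).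
  apply: mxweight_le => // w; apply: contraR; rewrite /= !negb_or.
  move=> /and5P[n1 n1' n2 n3 n3']; apply/asboolP; apply: net_split_opb.
  - move=> z Bz; move/existsPn/(_ z): n1; rewrite Bz /=; exact: contraNle.
  - move=> z Bz; move/existsPn/(_ z): n1'; rewrite Bz smxT /=; exact: contraNle.
  - move=> z z' Sz Sz'; move/existsPn/(_ z): n2; rewrite Sz /= => /existsPn/(_ z').
    by rewrite Sz' /=; exact: contraNle.
  - move=> z z' Sz Sz'; move/existsPn/(_ z): n3; rewrite Sz /= => /existsPn/(_ z').
    by rewrite Sz' /=; exact: contraNle.
  - move=> z z' Sz Sz'; move/existsPn/(_ z): n3'; rewrite Sz /= => /existsPn/(_ z').
    by rewrite Sz' /=; exact: contraNle.
have u1 := sumU F1 (predU F1' (predU F2 (predU F3 F3'))).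
have u2 := sumU F1' (predU F2 (predU F3 F3')).
have u3 := sumU F2 (predU F3 F3'); have u4 := sumU F3 F3'.
rewrite -/(sumF F1) in h1; rewrite -/(sumF F1') in h1'; rewrite -/(sumF F2) in h2.
rewrite -/(sumF F3) in h3; rewrite -/(sumF F3') in h3'.
move: u1 u2 u3 u4 h1 h1' h2 h3 h3'.
move: (sumF _) (sumF _) (sumF _) (sumF _) (sumF _) (sumF _) (sumF _) (sumF _) (sumF _) (expR _).
by move=> x1 x2 x3 x4 x5 x6 x7 x8 x9 e; lra.
Qed.

End tail.
End opnorm.
End concentration.

(** * Discretization of the noise *)

Section density.
Context {R : realType} {d : measure_display} {X : measurableType d}.
Variables (nu : {measure set X -> \bar R}) (f : X -> R).
Hypotheses (f_meas : measurable_fun [set: X] f) (f_ge0 : forall x, 0 <= f x).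
Hypothesis f_int : (\int[nu]_x (f x)%:E = 1)%E.

Lemma density_integrable : nu.-integrable [set: X] (EFin \o f).
Proof.
apply/integrableP; split; first exact/measurable_EFinP.
under eq_integral do rewrite /= ger0_norm //.
by rewrite f_int ltry.
Qed.

Lemma density_restrict (D : set X) : measurable D ->
  (\int[nu]_(x in D) (f x)%:E = \int[nu]_x (\1_D x * f x)%:E)%E.
Proof.
move=> mD; rewrite integral_mkcond; apply: eq_integral => x _.
by rewrite patchE indicE; case: ifP => _; rewrite ?mul1r ?mul0r.
Qed.

Lemma sum_inv_sqr_le (N : nat) : \sum_(0 <= m < N) ((m.+1)%:R ^+ 2)^-1 <= 2 :> R.
Proof.
suff h : \sum_(0 <= m < N) ((m.+1)%:R ^+ 2)^-1 <= 2 - 2 * ((N.+1)%:R)^-1 :> R.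
  by apply: le_trans h _; rewrite gerBl mulr_ge0 // invr_ge0.
elim: N => [|N IH]; first by rewrite big_nil invr1 mulr1 subrr.
rewrite big_nat_recr //=; apply: le_trans (lerD IH (lexx _)) _.
have a0 : 0 < (N.+1)%:R :> R by rewrite ltr0n.
have a1 : 1 <= (N.+1)%:R :> R by rewrite ler1n.
have -> : (N.+2)%:R = (N.+1)%:R + 1 :> R by rewrite natr1.
move: (N.+1%:R : R) a0 a1 => a a0 a1.
rewrite -subr_ge0.
have -> : 2 - 2 * (a + 1)^-1 - (2 - 2 * a^-1 + (a ^+ 2)^-1) = (a - 1) / (a ^+ 2 * (a + 1)).
  by field; rewrite !gt_eqF // ltr_wpDl // ltW.
by rewrite divr_ge0 ?mulr_ge0 ?sqr_ge0 //; lra.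
Qed.

(** [|Y|^q] is at most the sum of [(m+1)^q] over [m < |Y|]; the two spare powers in the tail leave
    the series of [1/(m+1)^2]. *)
Lemma layer_cake (Y : X -> R) (q : nat) (A : R) : measurable_fun [set: X] Y ->
  (0 < q)%N -> 0 <= A ->
  (forall m : nat, (\int[nu]_(x in [set x | (m%:R < `|Y x|)%R]) (f x)%:E
     <= (A / m.+1%:R ^+ (q + 2))%:E)%E) ->
  (\int[nu]_x (`|Y x| ^+ q * f x)%:E <= (2 * A)%:E)%E.
Proof.
move=> mY q0 A0 htail.
pose D (m : nat) := [set x | m%:R < `|Y x|].
have mD m : measurable (D m).
  have mnY : measurable_fun [set: X] (fun x => `|Y x|) by apply: measurableT_comp.
  have := mnY measurableT _ (measurable_itv `]m%:R, +oo[); rewrite setTI.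
  by congr measurable; apply/seteqP; split => x /=; rewrite in_itv /= andbT.
pose F (m : nat) x := (m.+1%:R ^+ q * (\1_(D m) x * f x))%:E.
have F0 m x : (0 <= F m x)%E by rewrite lee_fin !mulr_ge0 ?exprn_ge0.
have mF m : measurable_fun [set: X] (F m).
  apply/measurable_EFinP; apply: measurable_funM; first exact: measurable_cst.
  by apply: measurable_funM => //; apply: measurable_indic.
apply: (@le_trans _ _ (\int[nu]_x (\sum_(0 <= m <oo) F m x))%E).
  apply: ge0_le_integral => //.
  - by move=> x _; rewrite lee_fin mulr_ge0 ?exprn_ge0.
  - apply/measurable_EFinP; apply: measurable_funM => //.
    by apply: measurable_funX; apply: measurableT_comp.
  - exact: ge0_emeasurable_sum.
  move=> x _; have [Y0|Y0] := eqVneq (Y x) 0.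
    by rewrite Y0 normr0 expr0n eqn0Ngt q0 mul0r; apply: nneseries_ge0.
  (* The layer is open below and closed above, so an integer value of [|Y x|] belongs to the
     preceding layer. *)
  have [m /andP[m1 m2]] : exists m : nat, m%:R < `|Y x| <= m.+1%:R.
    have /andP[h1 h2] := truncn_itv (normr_ge0 (Y x)).
    move: h1; rewrite le_eqVlt => /predU1P[h1|h1]; last first.
      by exists (Num.truncn `|Y x|); rewrite h1 ltW.
    have t0 : (0 < Num.truncn `|Y x|)%N by rewrite -(ltr_nat R) h1 normr_gt0.
    exists (Num.truncn `|Y x|).-1; rewrite prednK // h1 lexx andbT -h1 ltr_nat.
    by rewrite h1 ltn_predL.
  apply: (@le_trans _ _ (F m x)).
    rewrite lee_fin indicE mem_set // mul1r ler_wpM2r //.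
    by rewrite lerXn2r ?nnegrE.
  apply: (@le_trans _ _ (\sum_(0 <= i < m.+1) F i x)%E); last exact: nneseries_lim_ge.
  by rewrite big_nat_recr //= leeDr // sume_ge0.
rewrite integral_nneseries //.
apply: lime_le; first by apply: is_cvg_nneseries => m _ _; apply: integral_ge0.
apply: nearW => N.
apply: (@le_trans _ _ (\sum_(0 <= m < N) (A * (m.+1%:R ^+ 2)^-1)%:E)%E).
  apply: lee_sum => m _.
  have -> : (\int[nu]_x F m x = (m.+1%:R ^+ q)%:E * \int[nu]_x (\1_(D m) x * f x)%:E)%E.
    rewrite -ge0_integralZl //.
    - by apply/measurable_EFinP; apply: measurable_funM.
    - by move=> x _; rewrite lee_fin mulr_ge0.
  rewrite -density_restrict //.
  apply: le_trans (lee_wpmul2l _ (htail m)) _; first by rewrite lee_fin exprn_ge0.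
  rewrite -EFinM lee_fin exprD le_eqVlt; apply/orP; left; apply/eqP.
  by rewrite mulrA (mulrC _ A) invfM mulrA mulfK // expf_neq0 // pnatr_eq0.
rewrite sumEFin lee_fin -mulr_sumr mulrC ler_wpM2r //.
exact: sum_inv_sqr_le.
Qed.

Lemma finite_pushforward (V : finType) (G : X -> V) (phi : V -> R) :
  (forall v, measurable (G @^-1` [set v])) ->
  \sum_v fine (\int[nu]_(x in G @^-1` [set v]) (f x)%:E) * phi v
  = \int[nu]_x (phi (G x) * f x).
Proof.
move=> mG; pose h v x := phi v * (\1_(G @^-1` [set v]) x * f x).
have ih v : nu.-integrable [set: X] (EFin \o (fun x => \1_(G @^-1` [set v]) x * f x)).
  apply: (le_integrable measurableT _ _ density_integrable).
    apply/measurable_EFinP; apply: measurable_funM => //; exact: measurable_indic.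
  move=> x _ /=; rewrite lee_fin normrM ler_piMl // indicE.
  by case: (_ \in _); rewrite ?normr1 // normr0.
have -> : (fun x => phi (G x) * f x) = (fun x => \sum_v h v x).
  apply/funext => x; rewrite (bigD1 (G x)) //= /h indicE mem_set // mul1r.
  rewrite big1 ?addr0 // => v vG; rewrite indicE memNset ?mul0r ?mulr0 //=.
  by move=> e; move: vG; rewrite e eqxx.
rewrite /Rintegral; under eq_integral do rewrite -sumEFin.
rewrite integral_sum //; last first.
  by move=> v; apply: (integrableZl measurableT (phi v) (ih v)).
have e v : (\int[nu]_x (h v x)%:E = (phi v)%:E * \int[nu]_(x in G @^-1` [set v]) (f x)%:E)%E.
  by rewrite density_restrict // -(integralZl measurableT (ih v)).
have fin v : (\int[nu]_(x in G @^-1` [set v]) (f x)%:E \is a fin_num)%E.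
  by rewrite density_restrict //; apply: integrable_fin_num (ih v).
rewrite (eq_bigr (fun v => (fine (\int[nu]_(x in G @^-1` [set v]) (f x)%:E) * phi v)%:E)).
  by rewrite sumEFin.
by move=> v _; rewrite e mulrC EFinM fineK.
Qed.

End density.

(** * Moments from a Weibull tail *)

Section weibull.
Context {R : realType}.

(** [exp u >= u^N / N!] with [u = (t/K)^s] and [N >= q / s] absorbs the polynomial when [t > K]. *)
Lemma weibull_poly (K s : R) (q : nat) : 0 < K -> 0 < s ->
  exists2 c : R, 0 < c & forall t, 0 <= t -> (t + 1) ^+ q * expR (- (t / K) `^ s) <= c.
Proof.
move=> K0 s0; pose N := (Num.truncn (q%:R / s)).+1.
have Ns : q%:R <= s * N%:R.
  have /andP[_ h] := truncn_itv (divr_ge0 (ler0n R q) (ltW s0)).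
  by move: h; rewrite -/N ltr_pdivrMr // mulrC => /ltW.
have f0 : 0 < (N`!)%:R :> R by rewrite ltr0n fact_gt0.
have f1 : 1 <= (N`!)%:R :> R by rewrite ler1n fact_gt0.
have K1 : 0 <= K + 1 by lra.
have Kq : 0 < (K + 1) ^+ q by rewrite exprn_gt0; lra.
exists ((K + 1) ^+ q * (N`!)%:R); first by rewrite mulr_gt0.
move=> t t0; rewrite expRN ler_pdivrMr ?expR_gt0 //.
have e1 : 1 <= expR ((t / K) `^ s) by rewrite -expR0 ler_expR powR_ge0.
have [tK|tK] := lerP t K.
  have tq : (t + 1) ^+ q <= (K + 1) ^+ q by rewrite lerXn2r ?nnegrE ?lerD2r // addr_ge0.
  by apply: (le_trans tq); rewrite -mulrA; apply: ler_peMr; [exact: ltW|exact: mulr_ege1].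
have u1 : 1 <= t / K by rewrite ler_pdivlMr // mul1r ltW.
have u0 : 0 <= t / K by apply: le_trans u1.
have tu : t + 1 <= (K + 1) * (t / K).
  have -> : (K + 1) * (t / K) = t + t / K by field; rewrite gt_eqF.
  by rewrite lerD2l.
apply: (@le_trans _ _ (((K + 1) * (t / K)) ^+ q)).
  by rewrite lerXn2r ?nnegrE //; [lra|apply: mulr_ge0].
rewrite exprMn -mulrA; apply: ler_wpM2l; first exact: ltW.
apply: (@le_trans _ _ (((t / K) `^ s) ^+ N)).
  have <- : (t / K) `^ (s * N%:R) = (t / K) `^ s ^+ N by rewrite powRrM powR_mulrn ?powR_ge0.
  by rewrite -(powR_mulrn q u0) ler_powR.
have := expR_ge1Dxn N.-1 (powR_ge0 (t / K) s); rewrite /= => h.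
by rewrite [leRHS]mulrC -ler_pdivrMr //; apply: le_trans h; rewrite lerDr.
Qed.

(** The constant is chosen before the measure and the density, hence is uniform over edges and over
    [n]. *)
Lemma weibull_moment (K s : R) (q : nat) : 0 < K -> 0 < s -> (0 < q)%N ->
  exists2 c : R, 0 < c &
    forall d (X : measurableType d) (nu : {measure set X -> \bar R}) (f Y : X -> R),
    measurable_fun [set: X] f -> (forall x, 0 <= f x) ->
    measurable_fun [set: X] Y ->
    (forall t, 0 <= t -> (\int[nu]_(x in [set x | (t < `|Y x|)%R]) (f x)%:E
        <= (2 * expR (- (t / K) `^ s))%:E)%E) ->
    (\int[nu]_x (`|Y x| ^+ q * f x)%:E <= c%:E)%E.
Proof.
move=> K0 s0 q0; have [c c0 hc] := weibull_poly (q + 2) K0 s0.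
exists (2 * (2 * c)); first by rewrite !mulr_gt0.
move=> d X nu f Y mf f0 mY tail; apply: (layer_cake mf f0 mY q0).
  by rewrite mulr_ge0 // ltW.
move=> m; apply: (le_trans (tail _ (ler0n _ m))).
rewrite lee_fin -mulrA ler_wpM2l // ler_pdivlMr ?exprn_gt0 ?ltr0n // mulrC.
by have := hc _ (ler0n R m); rewrite natr1.
Qed.
End weibull.

(** * Truncation and rounding to a finite grid *)

Section rounding.
Context {R : realType}.
Variables (B n : nat).
Hypotheses (B_gt0 : (0 < B)%N) (n_gt0 : (0 < n)%N).

Definition grid := 'I_(2 * (B * n)).+1.
Definition grid_val (v : grid) : R := (v : nat)%:R / n%:R - B%:R.
Definition grid0 : grid := inord (B * n).
Definition grid_round (y : R) : grid :=
  if `|y| <= B%:R then inord (Num.truncn ((y + B%:R) * n%:R)) else grid0.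

Let n_pos : 0 < n%:R :> R. Proof. by rewrite ltr0n. Qed.
Let B_pos : 0 < B%:R :> R. Proof. by rewrite ltr0n. Qed.

Lemma grid_val0 : grid_val grid0 = 0.
Proof.
rewrite /grid_val /grid0 inordK ?natrM; last by rewrite ltnS mul2n -addnn leq_addr.
by rewrite mulfK ?subrr // gt_eqF.
Qed.

Lemma grid_val_le v : `|grid_val v| <= B%:R.
Proof.
have v0 : 0 <= (v : nat)%:R / n%:R :> R by rewrite divr_ge0 // ltW.
have v2 : (v : nat)%:R / n%:R <= 2 * B%:R :> R.
  by rewrite ler_pdivrMr // -!natrM ler_nat -mulnA -ltnS ltn_ord.
by rewrite /grid_val ler_norml; lra.
Qed.

Lemma grid_trunc y : `|y| <= B%:R ->
  grid_round y = Num.truncn ((y + B%:R) * n%:R) :> nat /\ 0 <= (y + B%:R) * n%:R.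
Proof.
move=> yB; have /andP[y1 y2] : - B%:R <= y <= B%:R by rewrite -ler_norml.
have y0 : 0 <= (y + B%:R) * n%:R by rewrite mulr_ge0 //; lra.
split=> //; rewrite /grid_round yB inordK // truncn_lt_nat //.
apply: (@le_lt_trans _ _ (2 * (B * n))%:R); last by rewrite ltr_nat.
by rewrite mulnA !natrM ler_wpM2r //; lra.
Qed.

Lemma grid_round_err y : `|y| <= B%:R -> 0 <= y - grid_val (grid_round y) <= n%:R^-1.
Proof.
move=> yB; have [e y0] := grid_trunc yB; have /andP[h1 h2] := truncn_itv y0.
rewrite /grid_val e; move: h1 h2; rewrite -natr1.
move: ((Num.truncn _)%:R : R) => z h1 h2.
have -> : y - (z / n%:R - B%:R) = ((y + B%:R) * n%:R - z) / n%:R by field; rewrite gt_eqF.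
apply/andP; split; first by rewrite divr_ge0 ?subr_ge0 // ltW.
by rewrite ler_pdivrMr // mulVf ?gt_eqF //; lra.
Qed.

Lemma grid_round_out y : B%:R < `|y| -> grid_val (grid_round y) = 0.
Proof. by move=> yB; rewrite /grid_round leNgt yB /= grid_val0. Qed.

Lemma grid_round_le y : `|grid_val (grid_round y)| <= `|y| + 1.
Proof.
have [yB|yB] := lerP `|y| B%:R; last by rewrite grid_round_out // normr0 addr_ge0.
have /andP[h1 h2] := grid_round_err yB.
have n1 : n%:R^-1 <= 1 :> R by rewrite invf_le1 // ler1n.
have -> : grid_val (grid_round y) = y - (y - grid_val (grid_round y)) by ring.
by apply: (le_trans (ler_normB _ _)); rewrite lerD2l ger0_norm // (le_trans h2).
Qed.

(** Beyond [B] the value is sent to 0 and [|y| <= |y|^21 / B^20]. The power 20 is chosen because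
    [B^20] will be of order [n]. *)
Lemma grid_round_approx y :
  `|y - grid_val (grid_round y)| <= n%:R^-1 + `|y| ^+ 21 / B%:R ^+ 20.
Proof.
have p20 : 0 < B%:R ^+ 20 :> R by rewrite exprn_gt0.
have [yB|yB] := lerP `|y| B%:R.
  have /andP[h1 h2] := grid_round_err yB.
  by rewrite ger0_norm // (le_trans h2) // lerDl divr_ge0 ?exprn_ge0 // ltW.
rewrite grid_round_out // subr0 -[leLHS]add0r lerD ?invr_ge0 //.
rewrite ler_pdivlMr // [leRHS]exprS; apply: ler_wpM2l => //.
by rewrite lerXn2r ?nnegrE // ltW.
Qed.

Lemma grid_round_fiber v : measurable (grid_round @^-1` [set v] : set (measurableTypeR R)).
Proof.
pose S : set (measurableTypeR R) := `[- B%:R, B%:R]%classic.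
pose I : set (measurableTypeR R) :=
  `[grid_val v, (v.+1)%:R / n%:R - B%:R[%classic.
have -> : grid_round @^-1` [set v] = (S `&` I) `|` (if v == grid0 then ~` S else set0).
  apply/seteqP; split => y /=.
    move=> yv; have [yB|yB] := lerP `|y| B%:R.
      left; split; first by rewrite /S /= in_itv /= -ler_norml.
      have [e y0] := grid_trunc yB; have /andP[h1 h2] := truncn_itv y0.
      rewrite /I /= in_itv /= /grid_val -yv e lerBlDr ltrBrDr.
      by rewrite ler_pdivrMr // ltr_pdivlMr // h1.
    right; move: yv; rewrite /grid_round leNgt yB /= => ->; rewrite eqxx.
    by rewrite /S /= in_itv /= -ler_norml leNgt yB.
  move=> [[]|].
    rewrite /S /= in_itv /= -ler_norml => yB; rewrite /I /= in_itv /=.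
    rewrite /grid_val lerBlDr ltrBrDr ler_pdivrMr // ltr_pdivlMr // => h.
    have [e y0] := grid_trunc yB; apply/val_inj; rewrite /= e.
    by apply/eqP; rewrite truncn_eq.
  case: eqP => // -> ; rewrite /S /= in_itv /= -ler_norml => /negP.
  by rewrite -ltNge => yB; rewrite /grid_round leNgt yB.
apply: measurableU; first by apply: measurableI; exact: measurable_itv.
by case: ifP => _ //; apply: measurableC; exact: measurable_itv.
Qed.

End rounding.

Section discretized_density.
Context {R : realType}.
Variables (B n : nat) (nu : {measure set (measurableTypeR R) -> \bar R}).
Variables (f : R -> R) (m0 c2 c21 : R).
Hypotheses (B_gt0 : (0 < B)%N) (n_gt0 : (0 < n)%N).
Hypothesis f_meas : measurable_fun [set: measurableTypeR R] f.
Hypothesis f_ge0 : forall x, 0 <= f x.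
Hypothesis f_int : (\int[nu]_x (f x)%:E = 1)%E.
Hypothesis f_mean_int : nu.-integrable [set: measurableTypeR R] (fun x => (x * f x)%:E).
Hypothesis f_mean : \int[nu]_x (x * f x) = m0.
Hypothesis f_moment2 : (\int[nu]_x (`|x - m0| ^+ 2 * f x)%:E <= c2%:E)%E.
Hypothesis f_moment21 : (\int[nu]_x (`|x - m0| ^+ 21 * f x)%:E <= c21%:E)%E.

Let g (x : measurableTypeR R) : grid B n := grid_round B n (x - m0).

Lemma grid_fiber v : measurable (g @^-1` [set v]).
Proof.
have h : measurable_fun [set: measurableTypeR R] (fun x : measurableTypeR R => x - m0 : measurableTypeR R).
  by apply: measurable_funB => //; exact: measurable_cst.
by have := h measurableT _ (grid_round_fiber n_gt0 v); rewrite setTI.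
Qed.

Lemma moment_integrable (q : nat) (c : R) :
  (\int[nu]_x (`|x - m0| ^+ q * f x)%:E <= c%:E)%E ->
  nu.-integrable [set: measurableTypeR R] (EFin \o (fun x => `|x - m0| ^+ q * f x)) /\
  \int[nu]_x (`|x - m0| ^+ q * f x) <= c.
Proof.
move=> hc; set h := fun x => _.
have h0 x : 0 <= h x by rewrite mulr_ge0 ?exprn_ge0.
have hi : nu.-integrable [set: measurableTypeR R] (EFin \o h).
  apply/integrableP; split.
    apply/measurable_EFinP; apply: measurable_funM => //.
    apply: measurable_funX; apply: measurableT_comp => //.
    by apply: measurable_funB => //; exact: measurable_cst.
  under eq_integral do rewrite /= ger0_norm //.
  by apply: le_lt_trans hc _; rewrite ltry.
split=> //; rewrite -lee_fin /Rintegral fineK //.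
exact: integrable_fin_num hi.
Qed.

Let q (v : grid B n) : R := fine (\int[nu]_(x in g @^-1` [set v]) (f x)%:E).
Let fi := density_integrable f_meas f_ge0 f_int.

Lemma grid_sum (phi : grid B n -> R) : \sum_v q v * phi v = \int[nu]_x (phi (g x) * f x).
Proof. exact: (finite_pushforward f_meas f_ge0 f_int phi grid_fiber). Qed.

Lemma grid_mass_sum : \sum_v q v = 1.
Proof.
rewrite -[RHS](_ : fine 1%E = 1) // -f_int.
transitivity (\sum_v q v * 1); first by apply: eq_bigr => v _; rewrite mulr1.
rewrite (grid_sum (fun=> 1)); congr (fine (integral _ _ _)).
by apply/funext => x; rewrite mul1r.
Qed.

Lemma grid_integrable (phi : grid B n -> R) :
  nu.-integrable [set: measurableTypeR R] (EFin \o (fun x => phi (g x) * f x)).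
Proof.
pose M := \sum_v `|phi v|.
have hM v : `|phi v| <= M by rewrite /M (bigD1 v) //= lerDl sumr_ge0.
have mphi : measurable_fun [set: measurableTypeR R] (fun x => phi (g x)).
  move=> _ Y mY; rewrite setTI.
  have -> : (fun x => phi (g x)) @^-1` Y =
     \bigcup_(v in [set v | Y (phi v)]) (g @^-1` [set v]).
    apply/seteqP; split => x /=; first by move=> h; exists (g x).
    by move=> [v /= h e]; rewrite e.
  by apply: fin_bigcup_measurable; [exact: finite_finset|move=> v _; exact: grid_fiber].
apply: (le_integrable measurableT _ _ (integrableZl measurableT M fi)).
  by apply/measurable_EFinP; apply: measurable_funM.
move=> x _ /=; rewrite lee_fin !normrM ler_wpM2r //.
by apply: le_trans (hM _) _; apply: ler_norm.
Qed.

Lemma grid_mean : `|\sum_v q v * grid_val v| <= n%:R^-1 + c21 / B%:R ^+ 20.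
Proof.
have [i21 h21] := moment_integrable f_moment21.
have im0 := integrableZl measurableT m0 fi.
(* Since [x - m0] has mean zero, the mean of the rounded value is minus the mean rounding error. *)
have e : \sum_v q v * grid_val v =
   - \int[nu]_x ((x - m0 - grid_val (g x)) * f x).
  rewrite grid_sum.
  have -> : (fun x => (x - m0 - grid_val (g x)) * f x) =
    (fun x => (x * f x - m0 * f x) - grid_val (g x) * f x).
    by apply/funext => x; ring.
  have iB : nu.-integrable [set: measurableTypeR R] (EFin \o (fun x => x * f x - m0 * f x)).
    exact: (integrableB measurableT f_mean_int im0).
  rewrite RintegralB //; last exact: grid_integrable.
  rewrite RintegralB // f_mean RintegralZl //.
  have -> : \int[nu]_x f x = 1 by rewrite /Rintegral f_int.
  by ring.
have ih : nu.-integrable [set: measurableTypeR R]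
    (EFin \o (fun x => (x - m0 - grid_val (g x)) * f x)).
  have := integrableB measurableT (integrableB measurableT f_mean_int im0)
     (grid_integrable (@grid_val R B n)).
  by apply: eq_integrable => // x _ /=; rewrite -!EFinB; congr EFin; ring.
rewrite e normrN; apply: (le_trans (le_normr_Rintegral measurableT ih)).
have i1 := integrableZl measurableT (n%:R^-1 : R) fi.
have i2 := integrableZl measurableT ((B%:R ^+ 20)^-1 : R) i21.
pose h x := n%:R^-1 * f x + (B%:R ^+ 20)^-1 * (`|x - m0| ^+ 21 * f x).
have ih' : nu.-integrable [set: measurableTypeR R] (EFin \o h).
  exact: (integrableD measurableT i1 i2).
apply: (@le_trans _ _ (\int[nu]_x h x)).
  apply: le_Rintegral => //; first exact: integrable_norm ih.
  move=> x _; rewrite normrM (ger0_norm (f_ge0 x)) /h mulrA -mulrDl ler_wpM2r //.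
  by rewrite [_^-1 * _]mulrC; exact: grid_round_approx.
rewrite /h RintegralD // !RintegralZl //.
have -> : \int[nu]_x f x = 1 by rewrite /Rintegral f_int.
by rewrite mulr1 lerD2l mulrC ler_wpM2r // invr_ge0 exprn_ge0.
Qed.

Lemma grid_variance (m : R) : m = \sum_v q v * grid_val v ->
  \sum_v q v * (grid_val v - m) ^+ 2 <= 2 * c2 + 2.
Proof.
move=> em; have [i2 h2] := moment_integrable f_moment2.
apply: (@le_trans _ _ (\sum_v q v * grid_val v ^+ 2)).
  have -> : \sum_v q v * (grid_val v - m) ^+ 2 =
     \sum_v q v * grid_val v ^+ 2 - 2 * m * (\sum_v q v * grid_val v) + m ^+ 2 * \sum_v q v.
    rewrite !mulr_sumr -sumrB -big_split; apply: eq_bigr => v _ /=; ring.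
  rewrite -em grid_mass_sum; have := sqr_ge0 m; lra.
rewrite (grid_sum (fun v => grid_val v ^+ 2)).
pose h x := 2 * (`|x - m0| ^+ 2 * f x) + 2 * f x.
have i2' := integrableZl measurableT (2 : R) i2.
have i1 := integrableZl measurableT (2 : R) fi.
have ih : nu.-integrable [set: measurableTypeR R] (EFin \o h).
  exact: (integrableD measurableT i2' i1).
apply: (@le_trans _ _ (\int[nu]_x h x)).
  apply: le_Rintegral => //; first exact: grid_integrable (fun v => grid_val v ^+ 2).
  move=> x _; rewrite /h mulrA -mulrDl ler_wpM2r //.
  have h1 := grid_round_le B n_gt0 (x - m0).
  have h3 : `|grid_val (g x)| ^+ 2 <= (`|x - m0| + 1) ^+ 2.
    by rewrite lerXn2r ?nnegrE ?addr_ge0.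
  move: h3; rewrite real_normK ?num_real // => h3; apply: le_trans h3 _.
  by have := sqr_ge0 (`|x - m0| - 1); move: (`|x - m0|) => z hz; rewrite -subr_ge0;
    have -> : 2 * z ^+ 2 + 2 - (z + 1) ^+ 2 = (z - 1) ^+ 2 by ring.
rewrite /h RintegralD // !RintegralZl //.
have -> : \int[nu]_x f x = 1 by rewrite /Rintegral f_int.
by rewrite mulr1 lerD2r ler_wpM2l.
Qed.

End discretized_density.

(** * Law of the discretized matrix *)

Section joint_law.
Context {R : realType} {d : measure_display} {T : measurableType d}.
Variables (P : probability T R).

Lemma finite_union_bound (I : finType) (S : pred I) (E : I -> set T) :
  (forall i, S i -> measurable (E i)) ->
  (P (\big[setU/set0]_(i | S i) E i) <= \sum_(i | S i) P (E i))%E.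
Proof.
move=> mE; pose K (A : set T) (x : \bar R) := measurable A /\ (P A <= x)%E.
suff [] : K (\big[setU/set0]_(i | S i) E i) (\sum_(i | S i) P (E i))%E by [].
apply: (big_rec2 K); first by split; rewrite ?measure0.
move=> i A x Si [mA PA]; split; first by apply: measurableU => //; apply: mE.
by apply: (le_trans (measureU2 _ (mE _ Si) mA)); rewrite leeD2l.
Qed.

Variables (n : nat) (A : T -> 'M[R]_n) (V : finType) (g : 'I_n -> 'I_n -> R -> V) (v0 : V).
Hypothesis A_meas : forall i j, measurable_fun [set: T] (fun w => A w i j : measurableTypeR R).
Hypothesis A_indep : mutually_independent P [set e : 'I_n * 'I_n | (e.1 < e.2)%N]%SET
  (fun e w => A w e.1 e.2).
Hypothesis g_fiber : forall i j v, measurable (g i j @^-1` [set v] : set (measurableTypeR R)).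

Definition discr_mx w : {ffun 'I_n -> {ffun 'I_n -> V}} :=
  [ffun i : 'I_n => [ffun j : 'I_n => if (i < j)%N then g i j (A w i j) else v0]].

(** Positions on and below the diagonal carry a point mass at [v0], so that the law is a product
    over all [n^2] positions. *)
Definition discr_law (i j : 'I_n) (v : V) : R :=
  if (i < j)%N then fine (P [set w | g i j (A w i j) = v]) else (v == v0)%:R.

Lemma discr_entry_measurable i j v : measurable [set w | g i j (A w i j) = v].
Proof. by have := A_meas i j measurableT (g_fiber i j v); rewrite setTI. Qed.

(** [F] is arbitrary because the array takes finitely many values; in particular it may be the
    failure of an operator norm bound. *)
Lemma discr_mx_measurable (F : pred {ffun 'I_n -> {ffun 'I_n -> V}}) :
  measurable [set w | F (discr_mx w)].
Proof.
have -> : [set w | F (discr_mx w)] = \bigcup_(u in [set u | F u]) [set w | discr_mx w = u].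
  by apply/seteqP; split => w /=; [exists (discr_mx w)|by move=> [u Fu ->]].
apply: fin_bigcup_measurable; first exact: finite_finset.
move=> u _.
have -> : [set w | discr_mx w = u] = \bigcap_(e in [set: 'I_n * 'I_n])
   [set w | (if (e.1 < e.2)%N then g e.1 e.2 (A w e.1 e.2) else v0) = u e.1 e.2].
  apply/seteqP; split => w /=.
    by move=> <- e _; rewrite /= !ffunE.
  by move=> h; apply/ffunP => i; apply/ffunP => j; rewrite !ffunE; apply: (h (i, j)).
apply: fin_bigcap_measurable; first exact: finite_finset.
move=> e _; have [_|_] := boolP (e.1 < e.2)%N; first exact: discr_entry_measurable.
have [->|ne] := eqVneq v0 (u e.1 e.2).
  by rewrite (_ : [set _ | _] = setT) //; apply/seteqP; split.
rewrite (_ : [set _ | _] = set0) //; apply/seteqP; split => // w /= h.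
by move: ne; rewrite h eqxx.
Qed.

Lemma discr_law_ge0 i j v : 0 <= discr_law i j v.
Proof.
by rewrite /discr_law; case: ifP => _; [exact: fine_ge0|exact: ler0n].
Qed.

(** An upper bound is enough for tail estimates: the event is empty if [u] differs from [v0] on or
    below the diagonal, and otherwise lies in an intersection of independent events. *)
Lemma discr_mx_law u : (P [set w | discr_mx w = u] <= (mxweight discr_law u)%:E)%E.
Proof.
have mw0 : 0 <= mxweight discr_law u.
  by apply: prodr_ge0 => i _; apply: prodr_ge0 => j _; apply: discr_law_ge0.
have [/existsP[e /andP[ne ue]]|/existsPn hu] :=
    boolP [exists e : 'I_n * 'I_n, ~~ (e.1 < e.2)%N && (u e.1 e.2 != v0)].
  rewrite (_ : [set _ | _] = set0) ?measure0 ?lee_fin //.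
  apply/seteqP; split => // w /= h; move: ue; rewrite -h !ffunE (negbTE ne).
  by rewrite eqxx.
pose J := [set e : 'I_n * 'I_n | (e.1 < e.2)%N]%SET.
have := A_indep (B := fun e => g e.1 e.2 @^-1` [set u e.1 e.2]) (fintype.subxx J)
  (fun e => g_fiber _ _ _).
have sub : [set w | discr_mx w = u] `<=` \bigcap_(e in [set` J])
    ((fun w => A w e.1 e.2) @^-1` (g e.1 e.2 @^-1` [set u e.1 e.2])).
  by move=> w /= <- e; rewrite /= inE => lt; rewrite !ffunE lt.
have mu1 : measurable [set w | discr_mx w = u].
  have := discr_mx_measurable (pred1 u); congr measurable.
  by apply/seteqP; split => w /=; [move/eqP|move->].
have mcap : measurable (\bigcap_(e in [set` J])
    ((fun w => A w e.1 e.2) @^-1` (g e.1 e.2 @^-1` [set u e.1 e.2]))).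
  apply: fin_bigcap_measurable; first exact: finite_finset.
  by move=> e _; apply: discr_entry_measurable.
move=> h; apply: (le_trans (le_measure P _ _ sub)); rewrite ?inE //.
have /eqP := h; rewrite eq_le => /andP[{}h _]; apply: (le_trans h); rewrite (eq_bigr (fun e => (discr_law e.1 e.2 (u e.1 e.2))%:E)); last first.
  move=> e; rewrite inE => lt; rewrite /discr_law lt fineK //.
  by apply: fin_num_measure; apply: discr_entry_measurable.
rewrite prodEFin lee_fin /mxweight /pweight pair_big_dep /=.
rewrite [leRHS](bigID (mem J)) /= [X in _ * X]big1 ?mulr1 // => e.
rewrite inE => lt; rewrite /discr_law (negbTE lt).
by move: (hu e); rewrite lt negbK => ->.
Qed.

Lemma discr_mx_prob (F : pred {ffun 'I_n -> {ffun 'I_n -> V}}) :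
  (P [set w | F (discr_mx w)] <= (\sum_(u | F u) mxweight discr_law u)%:E)%E.
Proof.
pose E u := [set w | discr_mx w = u].
have mE u : measurable (E u).
  have := discr_mx_measurable (pred1 u); congr measurable.
  by apply/seteqP; split => w /=; [move/eqP|move->].
have sub : [set w | F (discr_mx w)] `<=` \big[setU/set0]_(u | F u) E u.
  by move=> w /= Fw; rewrite (bigD1 (discr_mx w)) //=; left.
apply: (@le_trans _ _ (P (\big[setU/set0]_(u | F u) E u))).
  apply: le_measure; rewrite ?inE //; first exact: discr_mx_measurable.
  exact: bigsetU_measurable.
apply: (le_trans (finite_union_bound (fun u _ => mE u))).
by rewrite -sumEFin; apply: lee_sum => u _; apply: discr_mx_law.
Qed.

End joint_law.

(** Take the largest [B] with [(2 B)^r <= n]; then [n < (2 (B + 1))^r <= (4 B)^r]. *)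
Lemma pow_bracket (r n : nat) : (0 < r)%N -> (2 ^ r <= n)%N ->
  exists B, [/\ (0 < B)%N, ((2 * B) ^ r <= n)%N & (n <= (4 * B) ^ r)%N].
Proof.
move=> r0 h.
have ex : exists B, ((2 * B) ^ r <= n)%N by exists 1%N; rewrite muln1.
have ub B : ((2 * B) ^ r <= n)%N -> (B <= n)%N.
  move=> hB; apply: leq_trans hB; case: B => // B.
  apply: (@leq_trans (2 * B.+1)); first by rewrite mul2n -addnn leq_addr.
  by rewrite -[leqLHS]expn1 leq_pexp2l.
case: (ex_maxnP ex ub) => B hB maxB; exists B.
have B0 : (0 < B)%N by apply: (maxB 1%N); rewrite muln1.
split=> //; rewrite leqNgt; apply/negP => hlt.
have : (B.+1 <= B)%N; last by rewrite ltnn.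
apply: maxB; apply: leq_trans (ltnW hlt); rewrite leq_exp2r //.
by lia.
Qed.

(** * Noise bound *)

Section noise.
Context {R : realType} {d : measure_display} {T : measurableType d}.
Variables (k n : nat) (discrete : bool) (p : R -> R -> R).
Variables (Z : 'M[R]_(n, k)) (alpha : 'cV[R]_n) (P : probability T R) (A : T -> 'M[R]_n).
Hypothesis p_density : edge_family discrete p.
Hypothesis A_model : latent_space_model discrete p Z alpha P A.
Let nu := base_measure (R := R) discrete.
Let th := Theta Z alpha.
Let mu := link discrete p.

Lemma ThetaC i j : th i j = th j i.
Proof.
rewrite !mxE (addrC (alpha i 0)); congr (_ + _).
by apply: eq_bigr => l _; rewrite mulrC.
Qed.

(** Transports the tail of [A_ij] to the edge density. The moment bound is a hypothesis so that its
    constant stays independent of the model. *)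
Lemma edge_moment (K s c : R) (q : nat) : cond_L2 mu K s Z alpha P A ->
  (forall d (X : measurableType d) (nu : {measure set X -> \bar R}) (f Y : X -> R),
    measurable_fun [set: X] f -> (forall x, 0 <= f x) ->
    measurable_fun [set: X] Y ->
    (forall t, 0 <= t -> (\int[nu]_(x in [set x | (t < `|Y x|)%R]) (f x)%:E
        <= (2 * expR (- (t / K) `^ s))%:E)%E) ->
    (\int[nu]_x (`|Y x| ^+ q * f x)%:E <= c%:E)%E) ->
  forall i j : 'I_n, (i < j)%N ->
  (\int[nu]_x (`|x - mu (th i j)| ^+ q * p x (th i j))%:E <= c%:E)%E.
Proof.
move=> L2 moment i j ij; have [mp p0 p1 _] := p_density (th i j).
have mY : measurable_fun [set: measurableTypeR R]
   (fun x : measurableTypeR R => x - mu (th i j) : measurableTypeR R).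
  by apply: measurable_funB => //; exact: measurable_cst.
apply: (moment _ (measurableTypeR R) nu) => // t t0.
have [_ _ law _] := A_model.
have mS : measurable ([set x | t < `|x - mu (th i j)|] : set (measurableTypeR R)).
  have mN : measurable_fun [set: measurableTypeR R] (fun x : measurableTypeR R => `|x - mu (th i j)|).
    by apply: measurableT_comp.
  have := mN measurableT _ (measurable_itv `]t, +oo[); rewrite setTI.
  by congr measurable; apply/seteqP; split => x /=; rewrite in_itv /= andbT.
have := L2 i j ij t t0; rewrite -(law _ _ _ ij mS).
by apply: le_trans.
Qed.

Variables (K s c2 c21 cd : R) (B : nat).
Hypotheses (n_gt0 : (0 < n)%N) (B_gt0 : (0 < B)%N).
Hypotheses (B_le : ((2 * B) ^ 20 <= n)%N) (le_B : (n <= (4 * B) ^ 20)%N).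
Hypotheses (c2_ge0 : 0 <= c2) (c21_ge0 : 0 <= c21) (cd_ge0 : 0 <= cd).
Hypothesis A_tail : cond_L2 mu K s Z alpha P A.
Hypothesis moment2 : forall i j : 'I_n, (i < j)%N ->
  (\int[nu]_x (`|x - mu (th i j)| ^+ 2 * p x (th i j))%:E <= c2%:E)%E.
Hypothesis moment21 : forall i j : 'I_n, (i < j)%N ->
  (\int[nu]_x (`|x - mu (th i j)| ^+ 21 * p x (th i j))%:E <= c21%:E)%E.
Hypothesis diag_bound : forall i, `|mu (th i i)| <= cd.

Let g (i j : 'I_n) (x : R) : grid B n := grid_round B n (x - mu (th i j)).
Let q := discr_law P A g (grid0 B n).
Let m i j : R := \sum_v q i j v * grid_val v.
Let a (i j : 'I_n) (v : grid B n) : R := if (i < j)%N then grid_val v - m i j else 0.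

Let g_fiber i j v : measurable (g i j @^-1` [set v] : set (measurableTypeR R)).
Proof. exact: grid_fiber. Qed.

Lemma discr_lawE (i j : 'I_n) : (i < j)%N -> forall v,
  q i j v = fine (\int[nu]_(x in (fun x : measurableTypeR R => grid_round B n (x - mu (th i j))) @^-1`
              [set v]) (p x (th i j))%:E).
Proof.
move=> ij v; have [_ _ law _] := A_model.
by rewrite /q /discr_law ij -(law _ _ _ ij (g_fiber i j v)).
Qed.

Lemma discr_law_sum i j : \sum_v q i j v = 1.
Proof.
have [ij|ij] := boolP (i < j)%N; last first.
  rewrite /q (bigD1 (grid0 B n)) //= /discr_law (negbTE ij) eqxx big1 ?addr0 // => v ne.
  by rewrite (negbTE ne).
have [mp p0 p1 _] := p_density (th i j).
rewrite (eq_bigr _ (fun v _ => discr_lawE ij v)).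
exact: grid_mass_sum.
Qed.

Lemma discr_mean_le (i j : 'I_n) : (i < j)%N -> `|m i j| <= n%:R^-1 + c21 / B%:R ^+ 20.
Proof.
move=> ij; have [mp p0 p1 ip] := p_density (th i j).
rewrite /m (eq_bigr _ (fun v _ => congr1 (fun x => x * _) (discr_lawE ij v))).
exact: (grid_mean B_gt0 n_gt0 mp p0 p1 ip erefl (moment21 ij)).
Qed.

Lemma discr_var_le (i j : 'I_n) : (i < j)%N ->
  \sum_v q i j v * (grid_val v - m i j) ^+ 2 <= 2 * c2 + 2.
Proof.
move=> ij; have [mp p0 p1 ip] := p_density (th i j).
rewrite (eq_bigr _ (fun v _ => congr1 (fun x => x * _) (discr_lawE ij v))).
apply: (grid_variance n_gt0 mp p0 p1 (moment2 ij)).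
by rewrite /m (eq_bigr _ (fun v _ => congr1 (fun x => x * _) (discr_lawE ij v))).
Qed.

Let q_ge0 i j v : 0 <= q i j v.
Proof. exact: discr_law_ge0. Qed.

Lemma discr_mean_le_range i j : `|m i j| <= B%:R.
Proof.
apply: (le_trans (ler_norm_sum _ _ _)).
apply: (@le_trans _ _ (\sum_v q i j v * B%:R)); last by rewrite -mulr_suml discr_law_sum mul1r.
by apply: ler_sum => v _; rewrite normrM ger0_norm // ler_wpM2l // grid_val_le.
Qed.

Definition noise_const : R := 20 * opnorm_const (2 * c2 + 2) + (2 + c21 * 4 ^+ 20) + cd.

(* With [L] the centred rounded upper triangle, [A - mu(Theta) - L - L^T] has
   off-diagonal entries O(1/n), from the rounding and from the bias of the
   truncation at [B], which the 21st moment bounds by [c21 / B^20]. *)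
Lemma noise_event : exists G : set T, [/\ measurable G,
   (P G >= (1 - (5 * expR (- (2 * B)%:R) + n%:R ^+ 2 * (2 * expR (- (B%:R / K) `^ s))))%:E)%E
   & forall w, G w -> opb (noise_const * Num.sqrt n%:R) (A w - map_mx mu th)].
Proof.
have [A_meas A_sym law A_indep] := A_model.
pose s2 := 2 * c2 + 2; have s20 : 0 <= s2 by rewrite addr_ge0 // mulr_ge0.
pose r : R := Num.sqrt n%:R.
pose F u := ~~ `[< opb (10 * opnorm_const s2 * r) (smx a u) >].
(* The grid value and its mean are both at most [B] in absolute value, so the centred entries are at
   most [2 * B], which plays the role of [t]. *)
have tail : \sum_(u | F u) mxweight q u <= 5 * expR (- (2 * B)%:R).
  apply: opnorm_tail => //; rewrite ?muln_gt0 //.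
  - by rewrite mulnA.
  - exact: discr_law_sum.
  - move=> i j; rewrite /a; have [ij|ij] := boolP (i < j)%N; last by rewrite big1 // => v _; rewrite mulr0.
    under eq_bigr do rewrite mulrBr.
    by rewrite sumrB -mulr_suml discr_law_sum mul1r subrr.
  - move=> i j; rewrite /a; have [ij|ij] := boolP (i < j)%N; first exact: discr_var_le.
    by rewrite big1 // => v _; rewrite expr0n mulr0.
  - move=> i j v; rewrite /a; case: ifP => _; last by rewrite normr0.
    apply: (le_trans (ler_normB _ _)); rewrite mul2n -addnn natrD.
    by apply: lerD; [exact: grid_val_le|exact: discr_mean_le_range].
pose Wd := discr_mx A g (grid0 B n).
pose E1 := [set w | F (Wd w)].
have mE1 : measurable E1 by apply: discr_mx_measurable.
have PE1 : (P E1 <= (5 * expR (- (2 * B)%:R))%:E)%E.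
  by apply: (le_trans (discr_mx_prob _ A_meas A_indep g_fiber F)); rewrite lee_fin.
pose J := [pred e : 'I_n * 'I_n | (e.1 < e.2)%N].
pose E2 (e : 'I_n * 'I_n) := [set w | B%:R < `|A w e.1 e.2 - mu (th e.1 e.2)|].
have mE2 e : measurable (E2 e).
  have mN : measurable_fun [set: T] (fun w => `|A w e.1 e.2 - mu (th e.1 e.2)|).
    apply: measurableT_comp => //; apply: measurable_funB; first exact: A_meas.
    exact: measurable_cst.
  have := mN measurableT _ (measurable_itv `]B%:R, +oo[); rewrite setTI.
  by congr measurable; apply/seteqP; split => x /=; rewrite in_itv /= andbT.
pose U := \big[setU/set0]_(e | J e) E2 e.
have mU : measurable U by apply: bigsetU_measurable.
have PU : (P U <= (n%:R ^+ 2 * (2 * expR (- (B%:R / K) `^ s)))%:E)%E.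
  apply: (le_trans (@finite_union_bound _ _ _ P _ J E2 (fun e _ => mE2 e))).
  apply: (@le_trans _ _ (\sum_(e : 'I_n * 'I_n) (2 * expR (- (B%:R / K) `^ s))%:E)%E).
    rewrite [leLHS]big_mkcond; apply: lee_sum => e _; case: ifP => [Je|_].
      exact: A_tail.
    by rewrite lee_fin mulr_ge0 // expR_ge0.
  rewrite sumEFin lee_fin sumr_const card_prod card_ord.
  by rewrite expr2 -[leLHS]mulr_natl natrM.
exists (~` (E1 `|` U)); split.
- by apply: measurableC; apply: measurableU.
- rewrite probability_setC; last exact: measurableU.
  rewrite EFinB; apply: leeB => //.
  apply: (le_trans (measureU2 _ mE1 mU)).
  by rewrite EFinD; apply: leeD.
move=> w /= /not_orP[nE1 nU].
have opL : opb (10 * opnorm_const s2 * r) (smx a (Wd w)).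
  by apply: contra_notP nE1 => h; apply/asboolPn.
have XB (i j : 'I_n) : (i < j)%N -> `|A w i j - mu (th i j)| <= B%:R.
  move=> ij; rewrite leNgt; apply/negP => lt; apply: nU.
  by rewrite /U (bigD1 (i, j)) //=; left.
set L := smx a (Wd w) in opL *.
have [sym diag] := A_sym w.
have AC i j : A w i j = A w j i by rewrite -[in LHS]sym mxE.
pose D := A w - map_mx mu th - L - L^T.
have n0 : 0 < n%:R :> R by rewrite ltr0n.
have r1 : 1 <= r by rewrite -sqrtr1 ler_sqrt // ler1n.
have LE i j : L i j = if (i < j)%N then grid_val (g i j (A w i j)) - m i j else 0.
  by rewrite mxE /a /Wd /discr_mx !ffunE; case: (i < j)%N.
(* [n <= (4 B)^20] turns the truncation bias into O(1/n) per entry, hence O(1) in operator norm. *)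
have Boff : n%:R^-1 + c21 / B%:R ^+ 20 <= (1 + c21 * 4 ^+ 20) / n%:R.
  rewrite mulrDl mul1r lerD2l -mulrA ler_wpM2l //.
  rewrite ler_pdivlMr // mulrC ler_pdivrMr ?exprn_gt0 ?ltr0n //.
  by rewrite -exprMn -natrM -natrX ler_nat.
have DE (i j : 'I_n) : D i j = A w i j - mu (th i j) - L i j - L j i.
  rewrite /D 3!mxE [(- map_mx _ _) _ _]mxE [map_mx _ _ _ _]mxE [(- L) _ _]mxE.
  by rewrite [(- L^T) _ _]mxE [L^T _ _]mxE.
have Dup (i j : 'I_n) : (i < j)%N -> `|D i j| <= (2 + c21 * 4 ^+ 20) / n%:R.
  move=> ij; have nji : (j < i)%N = false by rewrite ltnNge ltnW.
  have -> : D i j = (A w i j - mu (th i j) - grid_val (g i j (A w i j))) + m i j.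
    by rewrite DE !LE ij nji; ring.
  apply: (le_trans (ler_normD _ _)).
  have -> : (2 + c21 * 4 ^+ 20) / n%:R = n%:R^-1 + (1 + c21 * 4 ^+ 20) / n%:R.
    by field; rewrite gt_eqF.
  apply: lerD; last exact: le_trans (discr_mean_le ij) Boff.
  have /andP[h1 h2] := grid_round_err n_gt0 (XB _ _ ij).
  by rewrite ger0_norm.
have DC (i j : 'I_n) : D i j = D j i.
  by rewrite !DE (ThetaC i) (AC i); ring.
(* [A] vanishes on the diagonal but the matrix of means does not; the diagonal matrix left over has
   operator norm at most [cd]. *)
pose Dd := diag_mx (\row_i D i i).
have Dii i : D i i = - mu (th i i).
  by rewrite DE !LE ltnn diag; ring.
have e0 : 0 <= 2 + c21 * 4 ^+ 20 by rewrite addr_ge0 // mulr_ge0 // exprn_ge0.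
have opDd : opb cd Dd.
  move=> v; rewrite !nsqE mulr_sumr; apply: ler_sum => i _.
  rewrite !big_ord1 mul_diag_mx [(\matrix_(_, _) _) _ _]mxE [(\row_ _ _) _ _]mxE Dii exprMn sqrrN.
  apply: ler_wpM2r; first exact: sqr_ge0.
  by rewrite -[leLHS]real_normK ?num_real // lerXn2r ?nnegrE.
have opDo : opb (2 + c21 * 4 ^+ 20) (D - Dd).
  have -> : 2 + c21 * 4 ^+ 20 = n%:R * ((2 + c21 * 4 ^+ 20) / n%:R) by field; rewrite gt_eqF.
  apply: opb_entry => i j; rewrite /Dd.
  have -> : (D - diag_mx (\row_i D i i)) i j = if i == j then 0 else D i j.
    have mxB (X Y : 'M[R]_n) : (X - Y) i j = X i j - Y i j by rewrite !mxE.
    rewrite mxB [diag_mx _ _ _]mxE [(\row_ _ _) _ _]mxE.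
    by case: eqP => [->|_]; rewrite ?mulr1n ?subrr // mulr0n subr0.
  have [_|ne] := eqVneq i j; first by rewrite normr0 divr_ge0 // ltW.
  case: (ltngtP i j) => [|h|h]; first exact: Dup.
    by rewrite DC; apply: Dup.
  by move/val_inj: h ne => ->; rewrite eqxx.
have C0 : 0 <= 10 * opnorm_const s2 * r.
  rewrite /opnorm_const !mulr_ge0 ?exprn_ge0 //; last by lra.
  by move: s20; lra.
have -> : A w - map_mx mu th = L + L^T + ((D - Dd) + Dd).
  by rewrite subrK /D addrC !addrA -addrA; apply/matrixP => i j; rewrite !mxE; ring.
have op1 := opbD C0 C0 opL (opb_trmx opL).
have op2 := opbD e0 cd_ge0 opDo opDd.
apply: opb_le (opbD (addr_ge0 C0 C0) (addr_ge0 e0 cd_ge0) op1 op2).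
  exact: addr_ge0 (addr_ge0 C0 C0) (addr_ge0 e0 cd_ge0).
have h1 : 2 + c21 * 4 ^+ 20 <= (2 + c21 * 4 ^+ 20) * r by rewrite ler_peMr.
have h2 : cd <= cd * r by rewrite ler_peMr.
rewrite /noise_const -/r -/s2; move: (opnorm_const s2) h1 => o.
move: (2 + c21 * 4 ^+ 20) => e h1.
have -> : (20 * o + e + cd) * r = 10 * o * r + 10 * o * r + (e * r + cd * r) by ring.
by rewrite lerD2l lerD.
Qed.

End noise.

Section noise_opnorm.
Context {R : realType}.

(** [n^eps] and [n^2] are at most powers of [4 B], and both exponentials in [B] beat any power by
    [weibull_poly], used with [K = s = 1] for the first. *)
Lemma noise_tail_decay (K s eps : R) : 0 < K -> 0 < s -> 0 < eps ->
  exists D : R, forall n B : nat, (0 < n)%N -> (0 < B)%N -> (n <= (4 * B) ^ 20)%N ->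
  5 * expR (- (2 * B)%:R) + n%:R ^+ 2 * (2 * expR (- (B%:R / K) `^ s)) <= D * n%:R `^ (- eps).
Proof.
move=> K0 s0 e0; pose q := (Num.truncn (20 * eps)).+1.
have qe : 20 * eps <= q%:R.
  have e20 : 0 <= 20 * eps by rewrite mulr_ge0 // ltW.
  by have /andP[_ /ltW] := truncn_itv e20.
have [c1 c10 h1] := weibull_poly q (ltr01 : 0 < 1 :> R) (ltr01 : 0 < 1 :> R).
have [c2 c20 h2] := weibull_poly (40 + q) K0 s0.
exists (5 * (4 ^+ q * c1) + 2 * (4 ^+ (40 + q) * c2)) => n B n0 B0 nB.
have np : 0 < n%:R :> R by rewrite ltr0n.
have B1 : 1 <= 4 * B%:R :> R by rewrite -natrM ler1n muln_gt0.
have nB' : n%:R <= (4 * B%:R) ^+ 20 :> R by rewrite -natrM -natrX ler_nat.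
have b4 : 4 * B%:R <= 4 * (B%:R + 1) :> R by rewrite ler_wpM2l // lerDl.
have n_eps : n%:R `^ eps <= 4 ^+ q * (B%:R + 1) ^+ q :> R.
  apply: (@le_trans _ _ (((4 * B%:R) ^+ 20) `^ eps)).
    apply: ge0_ler_powR => //; rewrite ?nnegrE ?exprn_ge0 ?ltW //.
    by rewrite mulr_gt0 // ltr0n.
  rewrite -[_ ^+ 20]powR_mulrn; last by apply: le_trans B1.
  rewrite -powRrM; apply: (@le_trans _ _ ((4 * B%:R) `^ q%:R)); first exact: ler_powR.
  rewrite powR_mulrn; last by apply: le_trans B1.
  by rewrite -exprMn lerXn2r // nnegrE; [apply: le_trans B1|apply: le_trans (le_trans _ B1) b4].
have B4 : 0 <= 4 * (B%:R + 1) :> R by rewrite mulr_ge0 // addr_ge0.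
have n_sqr : n%:R ^+ 2 <= 4 ^+ 40 * (B%:R + 1) ^+ 40 :> R.
  have h : n%:R <= (4 * (B%:R + 1)) ^+ 20 :> R.
    by apply: (le_trans nB'); rewrite lerXn2r // nnegrE; apply: le_trans B1.
  rewrite -exprMn (_ : 40%N = (20 * 2)%N) // [leRHS]exprM.
  by apply: lerXn2r; rewrite ?nnegrE // exprn_ge0.
rewrite powRN ler_pdivlMr ?powR_gt0 //.
have {}h1 := h1 _ (ler0n R B); rewrite divr1 powRr1 // in h1.
have {}h2 := h2 _ (ler0n R B).
have e1 : expR (- (2 * B)%:R) <= expR (- (B%:R : R)).
  by rewrite ler_expR lerN2 ler_nat mul2n -addnn leq_addr.
set E := expR (- (_ / K) `^ s) in h2 *; have E0 : 0 <= E := expR_ge0 _.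
set F := expR (- B%:R) in h1 e1; have F0 : 0 <= F := expR_ge0 _.
set G := expR (- _) in e1 *; have G0 : 0 <= G := expR_ge0 _.
have x0 : 0 <= n%:R `^ eps :> R := powR_ge0 _ _.
have t1 : G * n%:R `^ eps <= 4 ^+ q * c1.
  apply: (@le_trans _ _ (F * (4 ^+ q * (B%:R + 1) ^+ q))); first exact: ler_pM.
  by rewrite mulrCA ler_wpM2l ?exprn_ge0 // mulrC.
have t2 : n%:R ^+ 2 * E * n%:R `^ eps <= 4 ^+ (40 + q) * c2.
  apply: (@le_trans _ _ ((4 ^+ 40 * (B%:R + 1) ^+ 40) * E * (4 ^+ q * (B%:R + 1) ^+ q))).
    by apply: ler_pM => //; [rewrite mulr_ge0 ?exprn_ge0|exact: ler_wpM2r].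
  have -> : (4 ^+ 40 * (B%:R + 1) ^+ 40) * E * (4 ^+ q * (B%:R + 1) ^+ q) =
      4 ^+ (40 + q) * ((B%:R + 1) ^+ (40 + q) * E).
    rewrite !exprD; move: (4 ^+ 40) (4 ^+ q) ((B%:R + 1) ^+ 40) ((B%:R + 1) ^+ q) => u v x y.
    ring.
  by rewrite ler_wpM2l ?exprn_ge0.
rewrite mulrDl; apply: lerD; first by rewrite -mulrA ler_wpM2l.
by rewrite mulrCA -mulrA ler_wpM2l // mulrC.
Qed.

Lemma noise_opnorm (K s cd eps : R) : 0 < K -> 0 < s -> 0 <= cd -> 0 < eps ->
  exists (C D : R) (N : nat), 0 < C /\
  forall n, (N <= n)%N ->
  forall d (T : measurableType d) k discrete p (Z : 'M[R]_(n, k)) alpha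
    (P : probability T R) (A : T -> 'M[R]_n),
  edge_family discrete p -> latent_space_model discrete p Z alpha P A ->
  cond_L2 (link discrete p) K s Z alpha P A ->
  (forall i, `|link discrete p (Theta Z alpha i i)| <= cd) ->
  exists G : set T, [/\ measurable G, (P G >= (1 - D * n%:R `^ (- eps))%:E)%E
   & forall w, G w ->
     opb (C * Num.sqrt n%:R) (A w - map_mx (link discrete p) (Theta Z alpha))].
Proof.
move=> K0 s0 cd0 eps0; have [D hD] := noise_tail_decay K0 s0 eps0.
have [c2 c20 m2] := weibull_moment (q := 2) K0 s0 isT.
have [c21 c210 m21] := weibull_moment (q := 21) K0 s0 isT.
exists (noise_const c2 c21 cd), D, (2 ^ 20)%N; split.
  rewrite /noise_const /opnorm_const.
  have h1 : 0 < c21 * 4 ^+ 20 by rewrite mulr_gt0 // exprn_gt0.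
  have h2 : 0 < (2 ^+ 10 : R) * (200 + 3 * (2 * c2 + 2)).
    by rewrite mulr_gt0 ?exprn_gt0 //; lra.
  by move: (c21 * _) (2 ^+ 10 * _) h1 h2 => x y; lra.
move=> n hn d T k discrete p Z alpha P A dens model L2 diag.
have [B [B0 B1 B2]] := pow_bracket (isT : (0 < 20)%N) hn.
have n0 : (0 < n)%N by apply: leq_trans hn; rewrite expn_gt0.
have [G [mG PG hG]] := noise_event dens model n0 B0 B1 B2 (ltW c20) (ltW c210) cd0 L2
  (edge_moment dens model L2 m2) (edge_moment dens model L2 m21) diag.
exists G; split=> //; apply: le_trans PG; rewrite lee_fin lerD2l lerN2.
exact: hD.
Qed.
End noise_opnorm.

(** * The estimator *)

Section rasvt_existence.
Context {R : realType}.

Lemma symmetric_svd_threshold n (A : 'M[R]_n) (tau : R) : A^T = A ->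
  exists2 Et, svd_threshold A tau Et & Et^T = Et.
Proof.
move=> symA; have [q [lam [oq eq]]] := symmetric_diagonalizable symA.
have qqT : q *m q^T = 1%:M by apply: orthogonal_mulmxT.
have A_eq : A = q *m diag_mx lam *m q^T.
  by rewrite -eq !mulmxA qqT mul1mx -mulmxA qqT mulmx1.
(* A zero eigenvalue gets sign 1, which keeps [diag_mx sg] orthogonal. The decomposition uses
   [q *m diag_mx sg] and [q], so its thresholding is symmetric, as the later spectral step needs. *)
pose sg : 'rV[R]_n := \row_i (if lam 0 i < 0 then -1 else 1).
pose s : 'rV[R]_n := \row_i `|lam 0 i|.
have osg : diag_mx sg *m diag_mx sg = 1%:M.
  rewrite mulmx_diag; apply/matrixP => i j; rewrite !mxE.
  by case: ifP => _; rewrite ?mulrNN mulr1.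
have sgs i : sg 0 i * s 0 i = lam 0 i.
  by rewrite !mxE; case: ltrP => h; [rewrite ltr0_norm // mulrNN mul1r|rewrite ger0_norm // mul1r].
pose P := [pred i | tau < s 0 i].
pose Et := \sum_(i | P i) s 0 i *: (col i (q *m diag_mx sg) *m (col i q)^T).
exists Et.
  exists (q *m diag_mx sg), s, q; split=> //; split=> //.
  - by rewrite /orthogonal_mx trmx_mul tr_diag_mx mulmxA -(mulmxA (diag_mx sg)) oq mulmx1.
  - by move=> i; rewrite mxE.
  rewrite is_svdE /= -(mulmxA q) mulmx_diag {1}A_eq; congr (_ *m diag_mx _ *m _).
  by apply/rowP => i; rewrite -sgs !mxE.
rewrite /Et is_svdE -(mulmxA q) mulmx_diag.
by rewrite !trmx_mul trmxK tr_diag_mx mulmxA.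
Qed.

Lemma rasvt_exists (mu : R -> R) n k (A Et Er : 'M[R]_n) (tau : R) (gamma : nat) :
  (k <= n)%N -> svd_threshold A tau Et -> range_projection mu gamma Et Er ->
  Er^T = Er -> (forall i j, range mu (Er i j)) ->
  exists Y : 'M[R]_(n, k + 1), rasvt mu A tau gamma Y.
Proof.
move=> kn svdA proj symEr rangeEr.
pose inv v := xget 0 [set t | mu t = v].
pose Th := map_mx inv Er.
have muTh i j : mu (Th i j) = Er i j.
  rewrite mxE; have [t _ ht] := rangeEr i j.
  exact: (xgetPex 0 (ex_intro (fun t => mu t = Er i j) t ht)).
have symTh : Th^T = Th by rewrite /Th map_trmx symEr.
pose alpha := invmx (n%:R%:M + all_ones n *m (all_ones n)^T) *m (Th *m all_ones n) : 'cV[R]_n.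
pose B := Th - alpha *m (all_ones n)^T - all_ones n *m alpha^T.
have symB : B^T = B.
  rewrite /B !linearB /= symTh !trmx_mul !trmxK.
  by rewrite addrAC.
have [q [lam [oq sorted eig]]] := symmetric_spectral symB.
pose Z : 'M[R]_(n, k) := \matrix_(i, j) (Num.sqrt (Num.max (lam 0 (widen_ord kn j)) 0)
                          * q i (widen_ord kn j)).
exists (row_mx Z alpha), Et, Er, Th, alpha, Z; split=> //.
by exists q, lam, kn.
Qed.
End rasvt_existence.

Section nuclear_norm.
Context {R : realType}.

Lemma Theta_le (M1 : R) n k (Z : 'M[R]_(n, k)) (alpha : 'cV[R]_n) : 0 <= M1 ->
  cond_T2 M1 Z alpha ->
  [/\ forall i l, `|Z i l| <= M1, forall i, `|alpha i 0| <= M1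
    & forall i j, `|Theta Z alpha i j| <= 2 * M1 + k%:R * M1 ^+ 2].
Proof.
move=> M10 [ZM aM].
have hZ i l : `|Z i l| <= M1 by apply: le_trans ZM; apply: norm2inf_entry.
have ha i : `|alpha i 0| <= M1 by apply: le_trans aM; apply: linfnorm_ge.
split=> // i j; rewrite mxE; apply: (le_trans (ler_normD _ _)); apply: lerD.
  by apply: (le_trans (ler_normD _ _)); rewrite mulr2n mulrDl mul1r lerD.
apply: (le_trans (ler_norm_sum _ _ _)).
apply: (@le_trans _ _ (\sum_(l < k) M1 ^+ 2)).
  by apply: ler_sum => l _; rewrite normrM expr2 ler_pM.
by rewrite sumr_const card_ord -[leLHS]mulr_natl.
Qed.

Lemma grid_round_cell (B m : nat) (x y : R) : (0 < m)%N -> `|x| <= B%:R -> `|y| <= B%:R ->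
  grid_round B m x = grid_round B m y -> `|x - y| <= m%:R^-1.
Proof.
move=> m0 xB yB e; have := grid_round_err m0 xB; have := grid_round_err m0 yB.
by rewrite e ler_norml => /andP[? ?] /andP[? ?]; apply/andP; split; lra.
Qed.

(** [grid_round] with mesh [1/m], [m] the integer part of [x], defines the cells of the [k + 1]
    coordinates of a row. Rounding costs order [n sqrt n / x] and the cells order
    [n sqrt (x^(k+1))]; these agree exactly when [x^(k+3) = n]. *)
Lemma link_nuc_le (mu : R -> R) (k : nat) (M1 : R) : cond_L1 mu -> 0 < M1 ->
  exists2 C : R, 0 < C & forall n (Z : 'M[R]_(n, k)) (alpha : 'cV[R]_n) (x : R),
    cond_T2 M1 Z alpha -> 1 <= x -> x ^+ (k + 3) = n%:R ->
    nuc_le (C * (n%:R * Num.sqrt n%:R / x)) (map_mx mu (Theta Z alpha)).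
Proof.
move=> L1 M10; pose b0 := 2 * M1 + k%:R * M1 ^+ 2.
have b00 : 0 < b0 by rewrite ltr_pwDl ?mulr_gt0 // mulr_ge0 // exprn_ge0 // ltW.
have [ka [kb [ka0 kb0 inc]]] := link_increment L1 b00.
pose bM := `|mu (- b0)| + `|mu b0|.
pose B := (Num.truncn M1).+1.
have MB : M1 <= B%:R by have /andP[_ /ltW] := truncn_itv (ltW M10).
pose S : R := (3 * B)%:R ^+ (k + 1).
exists (2 * (kb * (1 + k%:R * M1)) + (bM + 1) * Num.sqrt S).
  rewrite ltr_pwDl ?mulr_gt0 //.
    by rewrite ltr_pwDl // mulr_ge0 // ltW.
  by rewrite mulr_ge0 ?sqrtr_ge0 // !addr_ge0.
move=> n Z alpha x T2 x1 xn; have [hZ ha hT] := Theta_le (ltW M10) T2.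
pose m := Num.truncn x.
have x0 : 0 < x by apply: lt_le_trans x1.
have /andP[mx xm] := truncn_itv (ltW x0).
have m0 : (0 < m)%N by rewrite truncn_gt0.
have mpos : 0 < m%:R :> R by rewrite ltr0n.
have x2m : x <= 2 * m%:R.
  apply: (le_trans (ltW xm)); rewrite -natr1 mulr2n mulrDl mul1r lerD2l.
  by rewrite ler1n.
pose F : finType := ({ffun 'I_k -> grid B m} * grid B m)%type.
pose f (i : 'I_n) : F := ([ffun l => grid_round B m (Z i l)], grid_round B m (alpha i 0)).
have mono u v : - b0 <= u -> u <= b0 -> - b0 <= v -> v <= b0 -> `|mu u - mu v| <= kb * `|u - v|.
  move=> u1 u2 v1 v2; case: (leP u v) => uv.
    have /andP[h1 h2] := inc _ _ u1 uv v2.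
    rewrite distrC (distrC u) ger0_norm; first by rewrite ger0_norm // subr_ge0.
    by apply: le_trans h1; apply: mulr_ge0; [exact: ltW|rewrite subr_ge0].
  have /andP[h1 h2] := inc _ _ v1 (ltW uv) u2.
  rewrite ger0_norm; first by rewrite ger0_norm // subr_ge0 ltW.
  by apply: le_trans h1; apply: mulr_ge0; [exact: ltW|rewrite subr_ge0 ltW].
have hT' i j : - b0 <= Theta Z alpha i j <= b0 by rewrite -ler_norml.
have Mle i j : `|map_mx mu (Theta Z alpha) i j| <= bM + 1.
  rewrite mxE; have /andP[t1 t2] := hT' i j.
  rewrite -(link_le L1) in t1; rewrite -(link_le L1) in t2.
  have := ler_norm (mu b0); have := ler_norm (- mu (- b0)); rewrite normrN /bM => h1 h2.
  rewrite ler_norml; move: (normr_ge0 (mu (- b0))) (normr_ge0 (mu b0)) => h3 h4.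
  by apply/andP; split; lra.
pose dd : R := kb * (1 + k%:R * M1) / m%:R.
have kM : 0 <= k%:R * M1 by rewrite mulr_ge0 // ltW.
have dd0 : 0 <= dd by rewrite divr_ge0 ?mulr_ge0 ?addr_ge0 // ltW.
have cell (i i' j : 'I_n) : f i = f i' ->
   `|map_mx mu (Theta Z alpha) i j - map_mx mu (Theta Z alpha) i' j| <= dd.
  move=> [/ffunP fZ fa]; rewrite [map_mx _ _ _ _]mxE [map_mx _ _ i' j]mxE.
  have /andP[t1 t2] := hT' i j; have /andP[t3 t4] := hT' i' j.
  apply: (le_trans (mono _ _ t1 t2 t3 t4)).
  rewrite /dd -mulrA ler_wpM2l ?(ltW kb0) //.
  have -> : Theta Z alpha i j - Theta Z alpha i' j =
     (alpha i 0 - alpha i' 0) + \sum_l (Z i l - Z i' l) * Z j l.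
    rewrite !mxE; under [in RHS]eq_bigr do rewrite mulrBl.
    by rewrite sumrB; ring.
  rewrite mulrDl mul1r; apply: (le_trans (ler_normD _ _)); apply: lerD.
    by apply: (grid_round_cell m0) fa; apply: le_trans MB; apply: ha.
  apply: (le_trans (ler_norm_sum _ _ _)).
  apply: (@le_trans _ _ (\sum_(l < k) (M1 / m%:R))).
    apply: ler_sum => l _; rewrite normrM mulrC ler_pM //.
    have := fZ l; rewrite !ffunE => fl.
    by apply: (grid_round_cell m0) fl; apply: le_trans MB; apply: hZ.
  by rewrite sumr_const card_ord -[leLHS]mulr_natl mulrA.
have bM0 : 0 <= bM + 1 by rewrite !addr_ge0.
have h := nuc_le_cells dd0 bM0 Mle cell.
have nS : 0 <= n%:R * Num.sqrt n%:R :> R by rewrite mulr_ge0 ?sqrtr_ge0.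
have cardF : Num.sqrt #|F|%:R <= Num.sqrt S * Num.sqrt n%:R / x :> R.
  have -> : Num.sqrt S * Num.sqrt n%:R / x = Num.sqrt (S * x ^+ (k + 1)).
    have -> : n%:R = x ^+ 2 * x ^+ (k + 1) 
      by rewrite -xn -exprD (addnC k 1%N) addnA addnC.
    have S0 : 0 <= S by rewrite /S exprn_ge0.
    rewrite (sqrtrM _ S0) (sqrtrM _ (sqr_ge0 x)) sqrtr_sqr gtr0_norm //.
    by field; rewrite gt_eqF.
  rewrite ler_wsqrtr // /F card_prod card_ffun !card_ord -expnSr natrX.
  have hB : (2 * (B * m)).+1%:R <= (3 * B)%:R * x :> R.
    apply: (@le_trans _ _ ((3 * B)%:R * m%:R)); last by rewrite ler_wpM2l.
    rewrite -natrM ler_nat; clear -m0; have : (0 < B)%N by [].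
    by move: (B) (m) m0 => u v; nia.
  rewrite /S -exprMn addn1; apply: lerXn2r; rewrite ?nnegrE //.
  exact: le_trans (ler0n _ _) hB.
have mi : m%:R^-1 <= 2 / x.
  by rewrite ler_pdivlMr // mulrC ler_pdivrMr.
move=> c X c0 oX; apply: (le_trans (h c X c0 oX)); apply: ler_wpM2l => //.
rewrite [leRHS]mulrDl; apply: lerD.
  rewrite /dd; move: (kb * (1 + k%:R * M1)) (mulr_ge0 (ltW kb0) (addr_ge0 ler01 kM)) => u u0.
  have -> : 2 * u * (n%:R * Num.sqrt n%:R / x) = n%:R * Num.sqrt n%:R * (u * (2 / x)) by ring.
  by rewrite !ler_wpM2l.
have -> : (bM + 1) * Num.sqrt S * (n%:R * Num.sqrt n%:R / x) =
   (bM + 1) * n%:R * (Num.sqrt S * Num.sqrt n%:R / x) by ring.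
by rewrite ler_wpM2l // mulr_ge0.
Qed.
End nuclear_norm.

(** * Deterministic bound under small noise *)

Section deterministic.
Context {R : realType}.

Lemma rasvt_bound (mu : R -> R) (k : nat) (b0 M2 : R) : cond_L1 mu -> 0 < b0 -> 0 < M2 ->
  exists C e c : R, [/\ 0 < C, 0 < e, 0 < c &
  forall n (Z : 'M[R]_(n, k)) (alpha : 'cV[R]_n) (A : 'M[R]_n) (tau N : R) (gamma : nat),
    (0 < n)%N -> (k <= n)%N -> cond_T1 Z -> cond_T3 M2 Z ->
    (forall i j, `|Theta Z alpha i j| <= b0) -> A^T = A -> 0 < tau ->
    opb (tau / 2) (A - map_mx mu (Theta Z alpha)) ->
    nuc_le N (map_mx mu (Theta Z alpha)) ->
    (0 < gamma)%N -> (2 * gamma < n ^ 2)%N ->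
    3 * N * tau < gamma%:R * e -> gamma%:R <= c * n%:R ^+ 2 ->
    (exists Y : 'M[R]_(n, k + 1), rasvt mu A tau gamma Y) /\
    (forall Y : 'M[R]_(n, k + 1), rasvt mu A tau gamma Y ->
       dist2 Y (row_mx Z alpha) <= C * gamma%:R / n%:R /\ norm2inf Y <= C)].
Proof.
(* Enlarging [b0] by 1 places [lo] and [hi] strictly beyond the entries of the mean matrix, with a
   margin [del] independent of [n]. *)
move=> L1 b00 M20; pose b := b0 + 1.
have bp : 0 < b by rewrite /b; lra.
have [ka [kb [ka0 kb0 inc]]] := link_increment L1 bp.
pose lo := mu (- b); pose hi := mu b; pose m0 := mu (- b0); pose m1 := mu b0.
pose del := Num.min (m0 - lo) (hi - m1).
have del0 : 0 < del.
  by rewrite lt_min !subr_gt0; apply/andP; split; apply: (link_lt L1); rewrite /b; lra.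
have lo_le : lo <= m0 - del by rewrite lerBrDr -lerBrDl ge_min lexx.
have le_hi : m1 + del <= hi by rewrite -lerBrDl ge_min lexx orbT.
have rlo : range mu lo by exists (- b).
have rhi : range mu hi by exists b.
pose CT := (del ^+ 2 + 2 * (hi - lo) ^+ 2) / ka ^+ 2.
have CT0 : 0 < CT.
  by rewrite divr_gt0 ?exprn_gt0 // ltr_pwDl ?exprn_gt0 // mulr_ge0 // sqr_ge0.
pose C1 := (275 / M2 + 1) * CT; pose C2 := 1 + k%:R * (50 * b ^+ 2 / M2) + 4 * b ^+ 2.
have M2i : 0 < 275 / M2 + 1 
  by apply: ltr_wpDl; [apply: divr_ge0; [exact: ler0n|exact: ltW]|exact: ltr01].
have C10 : 0 < C1 by rewrite mulr_gt0.
have C20 : 0 <= C2.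
  by rewrite !addr_ge0 // !mulr_ge0 ?sqr_ge0 ?invr_ge0 // ltW.
(* The value of [c] makes [10 * CT * c * n^2] equal to [(M2 n / 4)^2], the perturbation size allowed
   in [spectral_estimator_err]. *)
exists (C1 + C2), (del ^+ 2), (M2 ^+ 2 / (160 * CT)); split.
- by rewrite ltr_pwDl.
- by rewrite exprn_gt0.
- by rewrite divr_gt0 ?exprn_gt0 // mulr_gt0.
move=> n Z alpha A tau N gamma n0 kn T1 T3 ThB symA tau0 opA nucM g0 g2 small gn.
set M := map_mx mu _ in opA nucM.
have n0' : 0 < n%:R :> R by rewrite ltr0n.
have symM : M^T = M.
  rewrite /M map_trmx; congr map_mx; apply/matrixP => i j; rewrite mxE.
  exact: ThetaC.
have Mitv i j : m0 <= M i j <= m1.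
  rewrite mxE /m0 /m1 !(link_le L1) -ler_norml; exact: ThB.
have errE Et : svd_threshold A tau Et -> nsq (Et - M) < gamma%:R * del ^+ 2.
  by move=> hE; apply: le_lt_trans small; apply: svd_threshold_err opA nucM.
split.
  have [Et svdE symE] := symmetric_svd_threshold tau symA.
  have err := errE _ svdE.
  have proj := range_projection_exists L1 rlo rhi del0 lo_le le_hi Mitv g0 g2 err.
  apply: (rasvt_exists kn svdE proj); first by rewrite map_trmx symE.
  move=> i j; apply: (link_range_itv L1 rlo rhi).
  by rewrite /= in_itv /=; apply: (range_projection_itv del0 lo_le le_hi Mitv g0 g2 err).
move=> Y [Et [Er [Th [ah [Zt [[svdE proj muTh] ahE top ->]]]]]].
have err := errE _ svdE.
have Er_eq := range_projectionE L1 rlo rhi del0 lo_le le_hi Mitv g0 g2 err proj.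
have Eritv i j : lo <= Er i j <= hi.
  by rewrite Er_eq; apply: (range_projection_itv del0 lo_le le_hi Mitv g0 g2 err).
have nErr : nsq (Er - M) <= gamma%:R * (del ^+ 2 + 2 * (hi - lo) ^+ 2).
  rewrite {1}Er_eq; apply: (le_trans (range_projection_err del0 lo_le le_hi Mitv g0 g2 err)).
  have -> : gamma%:R * (del ^+ 2 + 2 * (hi - lo) ^+ 2) =
    gamma%:R * del ^+ 2 + 2 * gamma%:R * (hi - lo) ^+ 2 by ring.
  by apply: lerD; first exact: ltW.
have Thb i j : `|Th i j| <= b.
  have := Eritv i j; rewrite -muTh /lo /hi !(link_le L1) => h.
  by rewrite ler_norml.
have ThT : nsq (Th - Theta Z alpha) <= CT * gamma%:R.
  have -> : CT * gamma%:R = gamma%:R * (del ^+ 2 + 2 * (hi - lo) ^+ 2) / ka ^+ 2 by rewrite /CT; ring.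
  rewrite ler_pdivlMr ?exprn_gt0 //; apply: le_trans nErr; rewrite mulrC !nsqE mulr_sumr.
  apply: ler_sum => i _; rewrite mulr_sumr; apply: ler_sum => j _.
  have -> : (Th - Theta Z alpha) i j = Th i j - Theta Z alpha i j.
    by rewrite [LHS]mxE [(- Theta Z alpha) i j]mxE.
  have -> : (Er - M) i j = mu (Th i j) - mu (Theta Z alpha i j).
    by rewrite [LHS]mxE [(- M) i j]mxE [M i j]mxE muTh.
  have := Thb i j; have : `|Theta Z alpha i j| <= b by apply: (le_trans (ThB i j)); rewrite /b; lra.
  move: (Th i j) (Theta Z alpha i j) => u v.
  rewrite !ler_norml => /andP[v1 v2] /andP[u1 u2].
  rewrite -exprMn -(real_normK (num_real (ka * _))) -[leRHS]real_normK ?num_real //.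
  rewrite lerXn2r ?nnegrE // normrM (gtr0_norm ka0).
  case: (leP u v) => uv.
    have /andP[h1 _] := inc _ _ u1 uv v2.
    by rewrite distrC (distrC (mu u)) (ger0_norm (_ : 0 <= v - u)) ?subr_ge0 // (le_trans h1) // ler_norm.
  have /andP[h1 _] := inc _ _ v1 (ltW uv) u2.
  by rewrite (ger0_norm (_ : 0 <= u - v)) ?subr_ge0 ?(ltW uv) // (le_trans h1) // ler_norm.
have smallT : 10 * nsq (Th - Theta Z alpha) <= (M2 * n%:R / 4) ^+ 2.
  apply: (@le_trans _ _ (10 * (CT * (M2 ^+ 2 / (160 * CT) * n%:R ^+ 2)))).
    by rewrite ler_wpM2l // (le_trans ThT) // ler_wpM2l // ltW.
  rewrite le_eqVlt; apply/orP; left; apply/eqP; field; rewrite gt_eqF //.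
rewrite ahE in top *.
have [h1 h2] := spectral_estimator_err n0 M20 T1 T3 Thb smallT top.
split; last by apply: (le_trans h2); rewrite lerDr ltW.
apply: (le_trans h1); rewrite ler_wpM2r ?invr_ge0 ?(ltW n0') //.
apply: (@le_trans _ _ (C1 * gamma%:R)).
  by rewrite /C1 -mulrA ler_wpM2l // ltW.
by rewrite ler_wpM2r // lerDl.
Qed.
End deterministic.

Lemma asymp_ll_lt {R : realType} (g h : nat -> R) (c : R) : asymp_ll g h -> 0 < c ->
  exists N, forall n, (N <= n)%N -> 0 < h n /\ g n < c * h n.
Proof.
move=> [[N1 _ h1] gh] c0; have [N2 _ h2] := @cvgr0_norm_lt _ R^o _ _ _ _ gh _ c0.
exists (maxn N1 N2) => n; rewrite geq_max => /andP[n1 n2].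
have hn : 0 < h n by apply: h1.
split=> //; rewrite -ltr_pdivrMr //.
by apply: le_lt_trans (h2 n n2); apply: ler_norm.
Qed.

Lemma root_powR {R : realType} (n m : nat) : (0 < n)%N -> (0 < m)%N ->
  let x : R := n%:R `^ (m%:R)^-1 in
  [/\ 1 <= x, x ^+ m = n%:R & n%:R `^ (3 / 2 - (m%:R)^-1) = n%:R * Num.sqrt n%:R / x].
Proof.
move=> n0 m0 x.
have n1 : 1 <= n%:R :> R by rewrite ler1n.
have np : n%:R != 0 :> R by rewrite pnatr_eq0 -lt0n.
split.
- by rewrite /x -[leLHS](powRr0 n%:R) ler_powR // invr_ge0.
- by rewrite /x -powR_mulrn ?powR_ge0 // -powRrM mulVf ?powRr1 // pnatr_eq0 -lt0n.
rewrite powRD ?np ?implybT // powRN; congr (_ / _).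
have -> : 3 / 2 = 1 + 2^-1 :> R by field.
by rewrite powRD ?np ?implybT // powRr1 // powR12_sqrt.
Qed.

Theorem theorem3 (R : realType) (k : nat)
  (discrete : bool) (p : R -> R -> R) (supp : set R)
  (d : nat -> measure_display) (T : forall n, measurableType (d n))
  (P : forall n, probability (T n) R) (A : forall n, T n -> 'M[R]_n)
  (Z : forall n, 'M[R]_(n, k)) (alpha : forall n, 'cV[R]_n)
  (tau : nat -> R) (gamma : nat -> nat) (M1 M2 K s : R)
  (k_ge1 : (1 <= k)%N)
  (density_p : edge_family discrete p)
  (suppE : forall theta, [set x | 0 < p x theta] = supp)
  (model : forall n, latent_space_model discrete p (Z n) (alpha n) (P n) (A n))
  (M1_gt0 : 0 < M1) (M2_gt0 : 0 < M2) (K_gt0 : 0 < K) (s_gt0 : 0 < s)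
  (T1 : \forall n \near \oo, cond_T1 (Z n))
  (T2 : \forall n \near \oo, cond_T2 M1 (Z n) (alpha n))
  (T3 : \forall n \near \oo, cond_T3 M2 (Z n))
  (E1 : cond_E1 p supp)
  (E2 : forall n, cond_E2 p K s (Z n) (alpha n) (P n) (A n))
  (L1 : cond_L1 (link discrete p))
  (L2 : forall n, cond_L2 (link discrete p) K s (Z n) (alpha n) (P n) (A n))
  (P1 : cond_P1 k tau)
  (P2 : cond_P2 k tau gamma) :
  forall eps : R, 0 < eps ->
  exists (C : R) (N : nat) (D : R), 0 < C /\
  forall n, (N <= n)%N ->
  exists G : set (T n),
    [/\ measurable G,
        (P n G >= (1 - D * n%:R `^ (- eps))%:E)%E
      & G `<=` [set w |
          (exists Y : 'M[R]_(n, k + 1),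
             rasvt (link discrete p) (A n w) (tau n) (gamma n) Y) /\
          (forall Y : 'M[R]_(n, k + 1),
             rasvt (link discrete p) (A n w) (tau n) (gamma n) Y ->
             dist2 Y (row_mx (Z n) (alpha n)) <= C * (gamma n)%:R / n%:R /\
             norm2inf Y <= C)]].
Proof.
move=> eps eps0.
set mu := link discrete p in L1 L2 *.
pose b0 : R := 2 * M1 + k%:R * M1 ^+ 2.
have b00 : 0 < b0 by rewrite ltr_pwDl ?mulr_gt0 // mulr_ge0 // exprn_ge0 // ltW.
pose cd : R := `|mu (- b0)| + `|mu b0|.
have cd0 : 0 <= cd by rewrite addr_ge0.
have [Cn [D [N0 [Cn0 noise]]]] := noise_opnorm K_gt0 s_gt0 cd0 eps0.
have [CN CN0 nuc] := link_nuc_le k L1 M1_gt0.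
have [C [e [c [C0 e0 c0 bound]]]] := rasvt_bound k L1 b00 M2_gt0.
have [N1 _ h1] := T1; have [N2 _ h2] := T2; have [N3 _ h3] := T3.
(* Thresholds for the growth conditions: noise below [tau / 2], thresholding error [3 N tau] below
   [gamma * e], and [gamma] below both [c n^2] and [n^2 / 4], the latter so that [2 gamma < n^2]. *)
have a1 : 0 < (2 * Cn)^-1 by rewrite invr_gt0 mulr_gt0.
have [N4 h4] := asymp_ll_lt P1.1 a1.
have a2 : 0 < e / (3 * CN) by rewrite divr_gt0 // mulr_gt0.
have [N5 h5] := asymp_ll_lt P2.1 a2.
have a3 : 0 < Num.min c (4^-1) by rewrite lt_min c0 invr_gt0 ltr0n.
have [N6 h6] := asymp_ll_lt P2.2 a3.
exists C, (N0 + N1 + N2 + N3 + N4 + N5 + N6 + k)%N, D; split=> // n hn.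
have [n0 [n1 [n2 [n3 [n4 [n5 [n6 kn]]]]]]] : (N0 <= n /\ N1 <= n /\ N2 <= n /\ N3 <= n /\
  N4 <= n /\ N5 <= n /\ N6 <= n /\ k <= n)%N by clear -hn; lia.
have ngt0 : (0 < n)%N by apply: leq_trans kn.
have {}h1 := h1 n n1; have {}h2 := h2 n n2; have {}h3 := h3 n n3.
have [tau0 {}h4] := h4 n n4; have [g0 {}h5] := h5 n n5; have [np {}h6] := h6 n n6.
have [hZ ha hT] := Theta_le (ltW M1_gt0) h2; rewrite -/b0 in hT.
have diag i : `|mu (Theta (Z n) (alpha n) i i)| <= cd.
  have := hT i i; rewrite ler_norml => /andP[t1 t2].
  rewrite -(link_le L1) in t1; rewrite -(link_le L1) in t2.
  have := ler_norm (mu b0); have := ler_norm (- mu (- b0)); rewrite normrN /cd => l1 l2.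
  rewrite ler_norml; move: (normr_ge0 (mu (- b0))) (normr_ge0 (mu b0)) => l3 l4.
  by apply/andP; split; lra.
have [G [mG PG hG]] := noise n n0 _ (T n) k discrete p (Z n) (alpha n) (P n) (A n)
  density_p (model n) (L2 n) diag.
exists G; split=> // w Gw.
have [_ /(_ w)[symA _] _ _] := model n.
have k3 : (0 < k + 3)%N by rewrite addn3.
have [x1 xm yE] := root_powR (R := R) ngt0 k3.
have nucN := nuc n (Z n) (alpha n) _ h2 x1 xm.
have sq0 : 0 <= Num.sqrt n%:R :> R := sqrtr_ge0 _.
have opA : opb (tau n / 2) (A n w - map_mx mu (Theta (Z n) (alpha n))).
  apply: opb_le (hG w Gw); first by rewrite mulr_ge0 // ltW.
  move: h4; rewrite powR12_sqrt // mulrC ltr_pdivlMr ?mulr_gt0 // => /ltW.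
  by rewrite ler_pdivlMr // => h; apply: le_trans h; rewrite le_eqVlt; apply/orP; left; apply/eqP; ring.
rewrite yE in h5.
apply: (bound n (Z n) (alpha n) (A n w) (tau n) _ (gamma n)) nucN _ _ _ _ => //.
- by move: g0; rewrite ltr0n.
- rewrite -(ltr_nat R) natrM natrX.
  have : (gamma n)%:R < 4^-1 * n%:R ^+ 2 :> R.
    by apply: (lt_le_trans h6); apply: ler_wpM2r; [exact: ltW|rewrite ge_min lexx orbT].
  by move: np; move: ((gamma n)%:R : R) (n%:R ^+ 2 : R) => u v; lra.
- move: h5; move: (_ / _ `^ _) (tau n) ((gamma n)%:R : R) => y t g.
  rewrite mulrAC ltr_pdivlMr ?mulr_gt0 // => h.
  have -> : 3 * (CN * y) * t = t * y * (3 * CN) by ring.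
  by rewrite [ltRHS]mulrC.
by apply: (le_trans (ltW h6)); apply: ler_wpM2r; [exact: ltW|rewrite ge_min lexx].
Qed.
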